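(* Let $f,g\in L^\infty(\mathbb{T})$ with $f=\bar g$, where (the Poisson extension of) $g$ is holomorphic inside the unit disc $\mathbb{D}$. Let $W$ be the integral operator on $L^2(\mathbb{T})$ with kernel $$W(e^{i\theta},e^{it})=\frac{f(e^{i\theta})g(e^{it})-f(e^{it})g(e^{i\theta})}{1-e^{i(\theta-t)}}.$$ Then, as operators on $H^2$, $$R_+WR_+=\Gamma_f^*\Gamma_f.$$ Further, if $R_+WR_+$ has finite rank, then $f$ is rational.
   Context: $\mathbb{T}$ is the unit circle, $L^2=L^2(\mathbb{T})$ (normalized measure $dt/2\pi$), and $H^2\subset L^2$ is the Hardy space with orthonormal basis $\{1,z,z^2,\dots\}$. $R_+:L^2\to H^2$ and $R_-:L^2\to L^2\ominus H^2$ are the orthogonal projections. $M_\psi$ is multiplication by $\psi$. The flip operator $J:L^2\to L^2$ is $Jh(z)=\bar z\,h(\bar z)$. For $\psi\in L^\infty$, the Hankel operator on $H^2$ with symbol $\psi$ is $\Gamma_\psi=JR_-M_\psi:H^2\to H^2$. The integral operator $W$ acts by $Wh(e^{i\theta})=\frac1{2\pi}\int_{\mathbb{T}}W(e^{i\theta},e^{it})h(e^{it})\,dt$, the integral being understood in the principal value sense at $t=\theta$. Functions on $\mathbb{T}$ are extended to harmonic functions on $\mathbb{D}$ by the Poisson kernel. ''$f$ is rational'' means that $f$ agrees almost everywhere on $\mathbb{T}$ with a rational function of $z$. *)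

(* Defs.v *)
From HB Require Import structures.
From mathcomp Require Import all_boot all_order all_algebra.
From mathcomp Require Import complex.
From mathcomp Require Import all_classical all_reals all_analysis.

Set Implicit Arguments.
Unset Strict Implicit.
Unset Printing Implicit Defensive.
Import Order.TTheory GRing.Theory Num.Theory.
Import numFieldNormedType.Exports.

Local Open Scope classical_set_scope.
Local Open Scope ring_scope.
Local Open Scope complex_scope.

Lemma two_pi_gt0 (R : realType) : 0 < 2 * pi :> R.
Proof. by rewrite mulr_gt0 // pi_gt0. Qed.

(* A function on the unit circle is represented by a function h : R[i] -> R[i],
   of which only the values h (expi t), t real, are ever used.  The Hilbert
   space elements are such functions modulo almost everywhere equality on the
   circle; operators are maps on representatives, characterised up to that
   equality, with value 0 where the characterised element does not exist. *)
Section circle.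
Context {R : realType}.
Local Notation C := R[i].
Implicit Types (f g h k u psi : C -> C) (A : (C -> C) -> C -> C)
  (S : set (C -> C)) (K : R -> R -> C).

Definition expi (t : R) : C := cos t +i* sin t.

(* dt / 2pi on [0, 2pi] *)
Definition circle : probability (measurableTypeR R) R :=
  uniform_prob (two_pi_gt0 R).

Definition ae_circle (P : C -> Prop) : Prop :=
  {ae circle, forall t : R, P (expi t)}.

Definition ae_eq_circle h k : Prop := ae_circle (fun z => h z = k z).

Definition circle_int (D : set R) (F : R -> C) : C :=
  Rintegral circle D (fun t => complex.Re (F t)) +i*
  Rintegral circle D (fun t => complex.Im (F t)).

Definition normLp (p : \bar R) h : \bar R :=
  Lnorm circle p (fun t => (complex.Re `|h (expi t)|)%:E).

Definition Lp (p : \bar R) : set (C -> C) := [set h |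
  [/\ measurable_fun [set: measurableTypeR R]
        (fun t : R => complex.Re (h (expi t))),
      measurable_fun [set: measurableTypeR R]
        (fun t : R => complex.Im (h (expi t)))
    & (normLp p h < +oo)%E]].

Definition L2 : set (C -> C) := Lp 2%:E.
Definition Linfty : set (C -> C) := Lp +oo%E.

Definition inner h k : C :=
  circle_int setT (fun t => h (expi t) * (k (expi t))^*).

(* closed linear span of 1, z, z^2, ... in L2 *)
Definition H2 : set (C -> C) := [set h | L2 h /\
  forall eps : R, 0 < eps ->
    exists p : {poly C}, (normLp 2%:E (fun z => h z - p.[z])%R < eps%:E)%E].

Definition orth_compl S : set (C -> C) := [set h | L2 h /\
  forall k, S k -> inner h k = 0].

Definition orth_proj S h : C -> C := xget (fun=> 0) [set u | S u /\
  forall k, S k -> inner (fun z => h z - u z) k = 0].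

Definition Rplus := orth_proj H2.
Definition Rminus := orth_proj (orth_compl H2).

Definition mulop psi h : C -> C := fun z => psi z * h z.

Definition flip h : C -> C := fun z => z^* * h (z^*).

Definition Hankel psi h : C -> C := flip (Rminus (mulop psi h)).

(* Hilbert space adjoint of an operator A on the subspace S *)
Definition adjoint S A k : C -> C := xget (fun=> 0) [set u | S u /\
  forall h, S h -> inner (A h) k = inner h u].

(* The principal value removes the arcs |e^(i theta) - e^(it)| <= eps, which are
   symmetric about theta. *)
Definition pv_trunc K h (theta eps : R) : C :=
  circle_int [set t | eps < complex.Re `|expi theta - expi t|]
    (fun t => K theta t * h (expi t)).

Definition pv_op K h : C -> C := xget (fun=> 0) [set k | L2 k /\
  {ae circle, forall theta : R,
     (pv_trunc K h theta eps : C^o) @[eps --> 0^'+] --> (k (expi theta) : C^o)}].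

Definition Wkernel f g (theta t : R) : C :=
  (f (expi theta) * g (expi t) - f (expi t) * g (expi theta)) /
  (1 - expi (theta - t)).

Definition poisson g (w : C) : C := circle_int setT
  (fun t => (1 - `|w| ^+ 2) / `|expi t - w| ^+ 2 * g (expi t)).

(* complex differentiability at every point of the open unit disc *)
Definition holomorphic_disc (F : C -> C) : Prop :=
  forall w : C, `|w| < 1 -> derivable (F : C^o -> C^o) w 1.

Definition rational_circle f : Prop := exists p q : {poly C},
  q != 0 /\ ae_eq_circle f (fun z => p.[z] / q.[z]).

Definition finite_rank S A : Prop :=
  exists n (e : 'I_n -> C -> C), (forall i, S (e i)) /\
    forall h, S h -> exists c : 'I_n -> C,
      ae_eq_circle (A h) (fun z => \sum_(i < n) c i * e i z).

End circle.

(* Main.v *)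
Require Import Defs.
From HB Require Import structures.
From mathcomp Require Import all_boot all_order all_algebra.
From mathcomp Require Import complex.
From mathcomp Require Import all_classical all_reals all_analysis.
From mathcomp Require Import measurable_realfun ess_sup_inf.
From mathcomp Require Import ring lra.

(* Write K for the principal value operator with kernel 1 / (1 - e^(i(theta-t))).
   It acts on H^2 as 1/2 and on the orthogonal complement of H^2 as -1/2: if Q_r is
   the kernel obtained by moving the singularity off the circle by 1 - r, then u is
   orthogonal to Q_r on the appropriate one of the two spaces, and the truncated
   kernel minus Q_r is bounded by a multiple of min(1/eps, eps/(t-theta)^2) when
   eps = 1 - r, so the truncated integrals converge at every Lebesgue point of u.
   Since g is bounded and analytic, g h lies in H^2 for h in H^2, hence
     W h = f K(g h) - g K(f h) = f g h / 2 - g (f h / 2 - R_-(f h)) = g R_-(f h).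
   As f is the conjugate of g, pairing with k in H^2 gives
     <k, g R_-(f h)> = <f k, R_-(f h)> = <R_-(f k), R_-(f h)>,
   which is the first claim because the flip is unitary.
   If the rank is finite, some nonzero polynomial q has R_-(f q) = 0; then f q is in
   H^2, and all its frequencies are at most deg q because those of f are at most 0,
   so f q is a polynomial. *)

Import Order.TTheory GRing.Theory Num.Theory.
Import numFieldNormedType.Exports.
Import ComplexField.Normc.

Set Implicit Arguments.
Unset Strict Implicit.
Unset Printing Implicit Defensive.

Local Open Scope classical_set_scope.
Local Open Scope complex_scope.
(* With ring_scope on top, [z^*] is [Num.conj z]; it is convertible to the [conjc z]
   of complex_scope. *)
Local Open Scope ring_scope.

(** * Complex numbers *)

(** Holomorphy of the Poisson extension enters through one consequence: the integrals of
    [g (expi t) * expi t ^+ n] vanish for [0 < n]. The extension splits into a power series in [w]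
    and one in [w^*]. Complex differentiability forces the derivative of the second to vanish, and
    the coefficients of that second series are exactly these integrals. The two values of K are a
    matter of mass. By symmetry about theta the truncated kernel has integral tending to 1/2, while
    Q_r can be taken with integral 1 or 0, according to which powers of [expi t] integrate to zero
    against u. At a Lebesgue point only the difference of the masses, -1/2 or 1/2, survives. As f h
    need lie in neither space, R_- cuts it into two parts before the limits are taken. Projections,
    adjoints and the principal value are all chosen by [xget], so every identity rests on an
    existence proof: completeness of L2 for the projections, an almost everywhere limit for W, an
    explicit candidate for the adjoint. The finite rank statement turns on positivity: a polynomial
    annihilated by R_+ W is already annihilated by its square root, the Hankel operator. *)

Section complex_numbers.
Context {R : realType}.
Local Notation C := R[i].
Implicit Types (x y z w : C) (t s : R) (n : nat).

Lemma normE z : `|z| = (normc z)%:C.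
Proof. by []. Qed.

Lemma normc_ge0 z : 0 <= normc z.
Proof. by case: z => a b; exact: sqrtr_ge0. Qed.

Lemma normc_sqr z : normc z ^+ 2 = complex.Re z ^+ 2 + complex.Im z ^+ 2.
Proof. by case: z => a b; rewrite /= sqr_sqrtr// addr_ge0// sqr_ge0. Qed.

Lemma normc_eq0 z : (normc z == 0) = (z == 0).
Proof.
apply/eqP/eqP => [/eq0_normc//|->]; exact: normc0.
Qed.

Lemma normc_gt0 z : (0 < normc z) = (z != 0).
Proof. by rewrite lt_def normc_eq0 normc_ge0 andbT. Qed.

Lemma normc_conj z : normc z^* = normc z.
Proof. by case: z => a b; rewrite /= sqrrN. Qed.

Lemma normcB x y : normc (x - y) = normc (y - x).
Proof. by rewrite -[RHS]normcN opprB. Qed.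

Lemma normc_leD x y : normc (x + y) <= normc x + normc y.
Proof. exact: (@le_normcD R x y). Qed.

Lemma normc_leB x y : normc (x - y) <= normc x + normc y.
Proof. by rewrite -[normc y]normcN; exact: normc_leD. Qed.

Lemma normcX z n : normc (z ^+ n) = normc z ^+ n.
Proof.
elim: n => [|n IH]; first by rewrite !expr0 normc1.
by rewrite !exprS normcM IH.
Qed.

Lemma normc_real (a : R) : normc a%:C = `|a|.
Proof. by rewrite /= expr0n /= addr0 sqrtr_sqr. Qed.

Lemma normc_Re z : `|complex.Re z| <= normc z.
Proof.
rewrite -[leLHS]ger0_norm// -(@ler_pXn2r _ 2)// ?nnegrE ?normc_ge0//.
by rewrite normc_sqr normr_id real_normK ?num_real// lerDl sqr_ge0.
Qed.

Lemma normc_Im z : `|complex.Im z| <= normc z.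
Proof.
rewrite -[leLHS]ger0_norm// -(@ler_pXn2r _ 2)// ?nnegrE ?normc_ge0//.
by rewrite normc_sqr normr_id real_normK ?num_real// lerDr sqr_ge0.
Qed.

Lemma normc_le_ReIm z : normc z <= `|complex.Re z| + `|complex.Im z|.
Proof.
rewrite -(@ler_pXn2r _ 2)// ?nnegrE ?normc_ge0 ?addr_ge0//.
rewrite normc_sqr sqrrD !real_normK ?num_real// addrAC.
by rewrite lerDl mulrn_wge0// mulr_ge0.
Qed.

Lemma mul_conjc z : z * z^* = (normc z ^+ 2)%:C.
Proof.
rewrite normc_sqr; case: z => a b; apply/eqP; rewrite eq_complex /=.
by apply/andP; split; apply/eqP; ring.
Qed.

Lemma ReD x y : complex.Re (x + y) = complex.Re x + complex.Re y.
Proof. by case: x y => a b [c d]. Qed.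

Lemma ImD x y : complex.Im (x + y) = complex.Im x + complex.Im y.
Proof. by case: x y => a b [c d]. Qed.

Lemma ReN x : complex.Re (- x) = - complex.Re x.
Proof. by case: x. Qed.

Lemma ImN x : complex.Im (- x) = - complex.Im x.
Proof. by case: x. Qed.

Lemma normc_Re_sub z w : `|complex.Re z - complex.Re w| <= normc (z - w).
Proof. by rewrite -ReN -ReD normc_Re. Qed.

Lemma normc_Im_sub z w : `|complex.Im z - complex.Im w| <= normc (z - w).
Proof. by rewrite -ImN -ImD normc_Im. Qed.

Lemma ReM x y : complex.Re (x * y) =
  complex.Re x * complex.Re y - complex.Im x * complex.Im y.
Proof. by case: x y => a b [c d]. Qed.

Lemma ImM x y : complex.Im (x * y) =
  complex.Re x * complex.Im y + complex.Im x * complex.Re y.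
Proof. by case: x y => a b [c d]. Qed.

Lemma ReJ x : complex.Re x^* = complex.Re x.
Proof. by case: x. Qed.

Lemma ImJ x : complex.Im x^* = - complex.Im x.
Proof. by case: x. Qed.

Lemma conjcE z : conjc z = z^*.
Proof. by []. Qed.

Lemma conjM x y : (x * y)^* = x^* * y^*.
Proof. exact: rmorphM. Qed.

Lemma conjD x y : (x + y)^* = x^* + y^*.
Proof. exact: rmorphD. Qed.

Lemma conjB x y : (x - y)^* = x^* - y^*.
Proof. exact: rmorphB. Qed.

Lemma conjX x n : (x ^+ n)^* = x^* ^+ n.
Proof. exact: rmorphXn. Qed.

Lemma conjV x : (x^-1)^* = (x^*)^-1.
Proof. exact: fmorphV. Qed.

Lemma ReV x : complex.Re x^-1 = complex.Re x * (normc x ^+ 2)^-1.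
Proof. by rewrite normc_sqr; case: x. Qed.

Lemma ImV x : complex.Im x^-1 = - (complex.Im x * (normc x ^+ 2)^-1).
Proof. by rewrite normc_sqr; case: x. Qed.

Lemma complex_ext x y :
  complex.Re x = complex.Re y -> complex.Im x = complex.Im y -> x = y.
Proof. by case: x y => a b [c d] /= -> ->. Qed.

Lemma expiD s t : expi (s + t) = expi s * expi t.
Proof.
apply: complex_ext; rewrite ?ReM ?ImM /=; first exact: cosD.
by rewrite sinD addrC.
Qed.

Lemma expi0 : expi 0 = 1 :> C.
Proof. by rewrite /expi cos0 sin0. Qed.

Lemma expiN t : expi (- t) = (expi t)^*.
Proof. by rewrite /expi cosN sinN. Qed.

Lemma normc_expi t : normc (expi t) = 1.
Proof. by rewrite /= cos2Dsin2 sqrtr1. Qed.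

Lemma expi_neq0 t : expi t != 0.
Proof. by rewrite -normc_eq0 normc_expi oner_eq0. Qed.

Lemma expiV t : (expi t)^-1 = expi (- t).
Proof.
by rewrite -[RHS]mul1r -[X in X * _](mulVf (expi_neq0 t)) -mulrA -expiD subrr expi0 mulr1.
Qed.

Lemma expiX t n : expi (t *+ n) = expi t ^+ n.
Proof.
elim: n => [|n IH]; first by rewrite mulr0n expi0 expr0.
by rewrite mulrS expiD IH exprS.
Qed.

Lemma expi_2pi t : expi (t + 2 * pi) = expi t.
Proof. by rewrite /expi mulr_natl mulr2n addrA !(cosDpi, sinDpi) !opprK. Qed.

Lemma mul_expi_conj t : expi t * (expi t)^* = 1.
Proof. by rewrite mul_conjc normc_expi expr1n. Qed.

End complex_numbers.

(** * Integrals against the normalized measure of the circle *)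

Section real_integrals.
Context {R : realType}.
Local Notation T := (measurableTypeR R).
Local Notation mu := (@circle R).
Implicit Types a b : R -> R.

Definition rmeasurable a := measurable_fun [set: T] (a : T -> R).
Definition rintegrable a := mu.-integrable [set: T] (EFin \o a).
Definition rint a : R := \int[mu]_t a t.

Lemma aeS (P Q : R -> Prop) : (forall t, P t -> Q t) ->
  {ae mu, forall t, P t} -> {ae mu, forall t, Q t}.
Proof.
move=> PQ aP; have F := ae_filter_ringOfSetsType mu.
exact: (@filterS _ _ F _ _ PQ aP).
Qed.

Lemma aeS2 (P Q S : R -> Prop) : (forall t, P t -> Q t -> S t) ->
  {ae mu, forall t, P t} -> {ae mu, forall t, Q t} -> {ae mu, forall t, S t}.
Proof.
move=> PQS aP aQ; have F := ae_filter_ringOfSetsType mu.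
exact: (@filterS2 _ _ F _ _ _ PQS aP aQ).
Qed.

Lemma aeS3 (P Q S U : R -> Prop) : (forall t, P t -> Q t -> S t -> U t) ->
  {ae mu, forall t, P t} -> {ae mu, forall t, Q t} ->
  {ae mu, forall t, S t} -> {ae mu, forall t, U t}.
Proof.
move=> PQSU aP aQ aS.
have aPQ : {ae mu, forall t, P t /\ Q t}.
  exact: (@aeS2 P Q (fun t => P t /\ Q t)).
by apply: (aeS2 _ aPQ aS) => t [Pt Qt]; exact: PQSU.
Qed.

Lemma rmeasurable_cst (k : R) : rmeasurable (fun=> k).
Proof. exact: (@measurable_cst _ _ T R setT k). Qed.

Lemma rmeasurable_id : rmeasurable (fun t => t).
Proof. exact: (@measurable_id _ T setT). Qed.

Lemma rmeasurableD a b : rmeasurable a -> rmeasurable b ->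
  rmeasurable (fun t => a t + b t).
Proof. exact: (@measurable_funD _ T _ setT a b). Qed.

Lemma rmeasurableB a b : rmeasurable a -> rmeasurable b ->
  rmeasurable (fun t => a t - b t).
Proof. exact: (@measurable_funB _ T _ setT a b). Qed.

Lemma rmeasurableN a : rmeasurable a -> rmeasurable (fun t => - a t).
Proof. exact: (@measurable_funN _ T _ setT a). Qed.

Lemma rmeasurableM a b : rmeasurable a -> rmeasurable b ->
  rmeasurable (fun t => a t * b t).
Proof. exact: (@measurable_funM _ T _ setT a b). Qed.

Lemma rmeasurableX a n : rmeasurable a -> rmeasurable (fun t => a t ^+ n).
Proof. exact: (@measurable_funX _ T _ setT a n). Qed.

Lemma rmeasurable_rintegrable a : rintegrable a -> rmeasurable a.
Proof. by move=> /measurable_int/measurable_EFinP. Qed.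

Lemma rintegrable_cst (k : R) : rintegrable (fun=> k).
Proof. exact: (@finite_measure_integrable_cst _ _ _ mu). Qed.

Lemma rint_cst (k : R) : rint (fun=> k) = k.
Proof.
by rewrite /rint Rintegral_cst// [X in fine X](@probability_setT _ _ _ mu) mulr1.
Qed.

Lemma rintegrableD a b : rintegrable a -> rintegrable b ->
  rintegrable (fun t => a t + b t).
Proof. exact: (@integrableD _ _ _ mu _ measurableT (EFin \o a) (EFin \o b)). Qed.

Lemma rintegrableZ (k : R) a : rintegrable a -> rintegrable (fun t => k * a t).
Proof. exact: (@integrableZl _ _ _ mu _ measurableT k (EFin \o a)). Qed.

Lemma rintegrableN a : rintegrable a -> rintegrable (fun t => - a t).
Proof.
by move=> /(rintegrableZ (-1)); under [X in rintegrable X -> _]eq_fun do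
  rewrite mulN1r.
Qed.

Lemma rintegrableB a b : rintegrable a -> rintegrable b ->
  rintegrable (fun t => a t - b t).
Proof. by move=> ia /rintegrableN; exact: rintegrableD. Qed.

Lemma rintegrable_le a b : rmeasurable a -> rintegrable b ->
  (forall t, `|a t| <= b t) -> rintegrable a.
Proof.
move=> ma ib ab; apply: le_integrable ib => //; first exact/measurable_EFinP.
by move=> t _ /=; rewrite lee_fin (le_trans (ab t))// ler_norm.
Qed.

Lemma rintegrable_le_ae a b : rmeasurable a -> rintegrable b ->
  {ae mu, forall t, `|a t| <= b t} -> rintegrable a.
Proof.
move=> ma ib ab; apply/integrableP; split; first exact/measurable_EFinP.
have /integrableP[mb] := ib; apply: le_lt_trans.
apply: ae_ge0_le_integral => //.
- by apply: measurableT_comp => //; exact/measurable_EFinP.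
- exact: measurableT_comp.
- apply: (aeS _ ab) => t abt _ /=.
  by rewrite lee_fin (le_trans abt)// ler_norm.
Qed.

Lemma rintD a b : rintegrable a -> rintegrable b ->
  rint (fun t => a t + b t) = rint a + rint b.
Proof. by move=> ia ib; exact: RintegralD. Qed.

Lemma rintB a b : rintegrable a -> rintegrable b ->
  rint (fun t => a t - b t) = rint a - rint b.
Proof. by move=> ia ib; exact: RintegralB. Qed.

Lemma rintZ (k : R) a : rintegrable a -> rint (fun t => k * a t) = k * rint a.
Proof. by move=> ia; exact: RintegralZl. Qed.

Lemma EFin_rint a : rintegrable a -> (rint a)%:E = (\int[mu]_t (a t)%:E)%E.
Proof. by move=> ia; rewrite fineK//; exact: integrable_fin_num. Qed.

Lemma rint_ge0 a : (forall t, 0 <= a t) -> 0 <= rint a.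
Proof. by move=> a0; exact: Rintegral_ge0. Qed.

Lemma rint_le a b : rintegrable a -> rintegrable b -> (forall t, a t <= b t) ->
  rint a <= rint b.
Proof. by move=> ia ib ab; apply: le_Rintegral. Qed.

Lemma rint_ae_eq a b : rmeasurable a -> rmeasurable b ->
  {ae mu, forall t, a t = b t} -> rint a = rint b.
Proof.
move=> ma mb ab; congr fine; apply: ae_eq_integral => //.
- exact/measurable_EFinP.
- exact/measurable_EFinP.
- by apply: (aeS _ ab) => t /= -> _.
Qed.

Lemma rint_le_ae a b : rintegrable a -> rintegrable b ->
  {ae mu, forall t, a t <= b t} -> rint a <= rint b.
Proof.
move=> ia ib ab.
(* Replacing [b] by the maximum of [a] and [b] leaves its integral unchanged and makes the
   inequality hold at every point. *)
have mx : rmeasurable (fun t => Num.max (a t) (b t)).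
  by apply: measurable_maxr; exact: rmeasurable_rintegrable.
have -> : rint b = rint (fun t => Num.max (a t) (b t)).
  apply: rint_ae_eq => //; first exact: rmeasurable_rintegrable.
  by apply: (aeS _ ab) => t /max_r.
apply: rint_le => // [|t]; last by rewrite le_max lexx.
apply: (@rintegrable_le _ (fun t => `|a t| + `|b t|)) => //.
  by apply: rintegrableD; exact: integrable_norm.
by move=> t; rewrite /Order.max; case: ifP => _; rewrite ?lerDl ?lerDr.
Qed.

Lemma rint_norm a : rintegrable a -> `|rint a| <= rint (fun t => `|a t|).
Proof. by move=> ia; exact: le_normr_Rintegral. Qed.

Lemma rint_eq0_ae a : rintegrable a -> (forall t, 0 <= a t) -> rint a = 0 ->
  {ae mu, forall t, a t = 0}.
Proof.
move=> ia a0 a_eq0.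
have i0 : (\int[mu]_t `|(a t)%:E| = 0)%E.
  under eq_integral do rewrite gee0_abs ?lee_fin//.
  rewrite -[LHS]fineK; last exact: integrable_fin_num.
  by rewrite -[X in X%:E]/(rint a) a_eq0.
have : ae_eq mu setT (EFin \o a) (cst 0%E).
  by apply/ae_eq_integral_abs => //; exact: measurable_int ia.
by apply: aeS => t /(_ I) [].
Qed.

End real_integrals.

Section complex_integrals.
Context {R : realType}.
Local Notation C := R[i].
Local Notation T := (measurableTypeR R).
Local Notation mu := (@circle R).
Implicit Types F G : R -> C.

Definition cmeasurable F :=
  rmeasurable (fun t => complex.Re (F t)) /\
  rmeasurable (fun t => complex.Im (F t)).
Definition cintegrable F :=
  rintegrable (fun t => complex.Re (F t)) /\
  rintegrable (fun t => complex.Im (F t)).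
Definition cint F : C := circle_int setT F.

Lemma cmeasurable_cst (k : C) : cmeasurable (fun=> k).
Proof. by split; exact: rmeasurable_cst. Qed.

Lemma cmeasurableD F G : cmeasurable F -> cmeasurable G ->
  cmeasurable (fun t => F t + G t).
Proof.
move=> [F1 F2] [G1 G2]; split.
  by under [X in rmeasurable X]eq_fun do rewrite ReD; exact: rmeasurableD.
by under [X in rmeasurable X]eq_fun do rewrite ImD; exact: rmeasurableD.
Qed.

Lemma cmeasurableM F G : cmeasurable F -> cmeasurable G ->
  cmeasurable (fun t => F t * G t).
Proof.
move=> [F1 F2] [G1 G2]; split.
  under [X in rmeasurable X]eq_fun do rewrite ReM.
  by apply: rmeasurableB; exact: rmeasurableM.
under [X in rmeasurable X]eq_fun do rewrite ImM.
by apply: rmeasurableD; exact: rmeasurableM.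
Qed.

Lemma cmeasurableN F : cmeasurable F -> cmeasurable (fun t => - F t).
Proof.
move=> mF; under [X in cmeasurable X]eq_fun do rewrite -mulN1r.
by apply: cmeasurableM => //; exact: cmeasurable_cst.
Qed.

Lemma cmeasurableB F G : cmeasurable F -> cmeasurable G ->
  cmeasurable (fun t => F t - G t).
Proof. by move=> mF /cmeasurableN; exact: cmeasurableD. Qed.

Lemma cmeasurableX F n : cmeasurable F -> cmeasurable (fun t => F t ^+ n).
Proof.
move=> mF; elim: n => [|n IH]; first exact: cmeasurable_cst.
by under [X in cmeasurable X]eq_fun do rewrite exprS; exact: cmeasurableM.
Qed.

Lemma cmeasurableJ F : cmeasurable F -> cmeasurable (fun t => (F t)^*).
Proof.
move=> [F1 F2]; split; first by under [X in rmeasurable X]eq_fun do rewrite ReJ.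
under [X in rmeasurable X]eq_fun do rewrite ImJ.
exact: rmeasurableN.
Qed.

Lemma rmeasurable_normc F : cmeasurable F -> rmeasurable (fun t => normc (F t)).
Proof.
move=> [F1 F2].
have -> : (fun t => normc (F t)) = (powR (R:=R) ^~ (2^-1)) \o
    (fun t => complex.Re (F t) ^+ 2 + complex.Im (F t) ^+ 2).
  apply/funext => t /=; rewrite powR12_sqrt ?addr_ge0 ?sqr_ge0//.
  by case: (F t).
apply: measurableT_comp; first exact: measurable_powR.
by apply: rmeasurableD; exact: rmeasurableX.
Qed.

Lemma cmeasurableV F : cmeasurable F -> cmeasurable (fun t => (F t)^-1).
Proof.
move=> mF.
have mV : rmeasurable (fun t => (normc (F t) ^+ 2)^-1).
  have -> : (fun t => (normc (F t) ^+ 2)^-1) =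
      (powR (R:=R) ^~ (-1)) \o (fun t => normc (F t) ^+ 2).
    by apply/funext => t /=; rewrite powR_inv1 ?sqr_ge0.
  apply: measurableT_comp; first exact: measurable_powR.
  by apply: rmeasurableX; exact: rmeasurable_normc.
case: mF => F1 F2; split.
  by under [X in rmeasurable X]eq_fun do rewrite ReV; exact: rmeasurableM.
under [X in rmeasurable X]eq_fun do rewrite ImV.
by apply: rmeasurableN; exact: rmeasurableM.
Qed.

Lemma cmeasurable_real (a : R -> R) :
  rmeasurable a -> cmeasurable (fun t => (a t)%:C).
Proof. by move=> ma; split => //; exact: rmeasurable_cst. Qed.

Lemma cmeasurable_expi (a : R -> R) :
  rmeasurable a -> cmeasurable (fun t => expi (a t)).
Proof.
move=> ma; split => /=.
  apply: (measurableT_comp (f := @cos R)) => //.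
  by apply: continuous_measurable_fun => ?; exact: continuous_cos.
apply: (measurableT_comp (f := @sin R)) => //.
by apply: continuous_measurable_fun => ?; exact: continuous_sin.
Qed.

Lemma cintegrable_measurable F : cintegrable F -> cmeasurable F.
Proof. by move=> [F1 F2]; split; exact: rmeasurable_rintegrable. Qed.

Lemma cintegrable_le F a : cmeasurable F -> rintegrable a ->
  (forall t, normc (F t) <= a t) -> cintegrable F.
Proof.
move=> [F1 F2] ia Fa; split; apply: rintegrable_le ia _ => // t.
  exact: le_trans (normc_Re _) _.
exact: le_trans (normc_Im _) _.
Qed.

Lemma cintegrable_normc F : cintegrable F -> rintegrable (fun t => normc (F t)).
Proof.
move=> iF; have /cintegrable_measurable mF := iF; case: iF => F1 F2.
apply: (@rintegrable_le _ _
  (fun t => `|complex.Re (F t)| + `|complex.Im (F t)|)).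
- exact: rmeasurable_normc.
- by apply: rintegrableD; exact: integrable_norm.
- by move=> t; rewrite ger0_norm ?normc_ge0//; exact: normc_le_ReIm.
Qed.

Lemma cintegrable_cst k : cintegrable (fun=> k).
Proof. by split; exact: rintegrable_cst. Qed.

Lemma cint_cst k : cint (fun=> k) = k.
Proof.
by rewrite /cint /circle_int -[X in X +i* _]/(rint _) -[X in _ +i* X]/(rint _)
  !rint_cst; case: k.
Qed.

Lemma cintegrableD F G : cintegrable F -> cintegrable G ->
  cintegrable (fun t => F t + G t).
Proof.
move=> [F1 F2] [G1 G2]; split.
  by under [X in rintegrable X]eq_fun do rewrite ReD; exact: rintegrableD.
by under [X in rintegrable X]eq_fun do rewrite ImD; exact: rintegrableD.
Qed.

Lemma cintegrableZ k F : cintegrable F -> cintegrable (fun t => k * F t).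
Proof.
move=> [F1 F2]; split.
  under [X in rintegrable X]eq_fun do rewrite ReM.
  by apply: rintegrableB; exact: rintegrableZ.
under [X in rintegrable X]eq_fun do rewrite ImM.
by apply: rintegrableD; exact: rintegrableZ.
Qed.

Lemma cintegrableB F G : cintegrable F -> cintegrable G ->
  cintegrable (fun t => F t - G t).
Proof.
move=> iF /(cintegrableZ (-1)) iG.
by under [X in cintegrable X]eq_fun do rewrite -mulN1r; exact: cintegrableD.
Qed.

Lemma cintegrableJ F : cintegrable F -> cintegrable (fun t => (F t)^*).
Proof.
move=> [F1 F2]; split; first by under [X in rintegrable X]eq_fun do rewrite ReJ.
by under [X in rintegrable X]eq_fun do rewrite ImJ; exact: rintegrableN.
Qed.

Lemma cintD F G : cintegrable F -> cintegrable G ->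
  cint (fun t => F t + G t) = cint F + cint G.
Proof.
move=> [F1 F2] [G1 G2]; apply: complex_ext; rewrite ?ReD ?ImD /=.
  by rewrite -rintD//; congr rint; apply/funext => t; rewrite ReD.
by rewrite -rintD//; congr rint; apply/funext => t; rewrite ImD.
Qed.

Lemma cintZ k F : cintegrable F -> cint (fun t => k * F t) = k * cint F.
Proof.
move=> [F1 F2]; apply: complex_ext; rewrite ?ReM ?ImM /=.
  rewrite -!rintZ// -rintB ?rintZ//; try exact: rintegrableZ.
  by congr rint; apply/funext => t; rewrite ReM.
rewrite -!rintZ// -rintD ?rintZ//; try exact: rintegrableZ.
by congr rint; apply/funext => t; rewrite ImM.
Qed.

Lemma cintB F G : cintegrable F -> cintegrable G ->
  cint (fun t => F t - G t) = cint F - cint G.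
Proof.
move=> iF iG; have iG' := cintegrableZ (-1) iG.
under [X in cint X]eq_fun do rewrite -mulN1r.
by rewrite cintD// cintZ// mulN1r.
Qed.

Lemma cintJ F : cintegrable F -> cint (fun t => (F t)^*) = (cint F)^*.
Proof.
move=> [F1 F2]; apply: complex_ext; rewrite ?ReJ ?ImJ /=.
  by congr rint; apply/funext => t; rewrite ReJ.
rewrite -mulN1r -rintZ//.
by congr rint; apply/funext => t; rewrite ImJ mulN1r.
Qed.

Lemma cint_sum (I : Type) (s : seq I) (F : I -> R -> C) :
  (forall i, cintegrable (F i)) ->
  cintegrable (fun t => \sum_(i <- s) F i t) /\
  cint (fun t => \sum_(i <- s) F i t) = \sum_(i <- s) cint (F i).
Proof.
move=> iF; elim: s => [|i s [IH1 IH2]].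
  under [in X in cintegrable X]eq_fun do rewrite big_nil.
  under [in X in cint X]eq_fun do rewrite big_nil.
  by rewrite big_nil cint_cst; split => //; exact: cintegrable_cst.
under [in X in cintegrable X]eq_fun do rewrite big_cons.
under [in X in cint X]eq_fun do rewrite big_cons.
by rewrite big_cons cintD// IH2; split => //; exact: cintegrableD.
Qed.

Lemma cint_ae_eq F G : cmeasurable F -> cmeasurable G ->
  {ae mu, forall t, F t = G t} -> cint F = cint G.
Proof.
move=> [F1 F2] [G1 G2] FG; apply: complex_ext; apply: rint_ae_eq => //.
  by apply: (aeS _ FG) => t ->.
by apply: (aeS _ FG) => t ->.
Qed.

(* The constant 2 avoids rotating the integral onto the positive axis. *)
Lemma normc_cint F : cintegrable F ->
  normc (cint F) <= 2 * rint (fun t => normc (F t)).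
Proof.
move=> iF; have iN := cintegrable_normc iF; case: iF => F1 F2.
apply: le_trans (normc_le_ReIm _) _; rewrite mulr_natl mulr2n lerD//=.
  apply: le_trans (rint_norm F1) _.
  by apply: rint_le => //; [exact: integrable_norm|move=> t; exact: normc_Re].
apply: le_trans (rint_norm F2) _.
by apply: rint_le => //; [exact: integrable_norm|move=> t; exact: normc_Im].
Qed.

Lemma normc_cint_le F a : cmeasurable F -> rintegrable a ->
  (forall t, normc (F t) <= a t) -> normc (cint F) <= 2 * rint a.
Proof.
move=> mF ia Fa; have iF := cintegrable_le mF ia Fa.
apply: le_trans (normc_cint iF) _; rewrite ler_pM2l//.
by apply: rint_le => //; exact: cintegrable_normc.
Qed.

Lemma circle_int_restrict D F :
  circle_int D F = cint (fun t => (\1_D t)%:C * F t).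
Proof.
rewrite /circle_int /cint /circle_int Rintegral_mkcond.
rewrite [X in _ +i* X = _]Rintegral_mkcond.
congr (_ +i* _); congr Rintegral; apply/funext => t; rewrite patchE.
  by case: ifPn => tD; rewrite indicE ?tD ?(negbTE tD)/= ?mul1r ?mul0r//;
    case: (F t) => x y /=; rewrite ?mul0r ?mul1r ?subr0.
by case: ifPn => tD; rewrite indicE ?tD ?(negbTE tD)/= ?mul1r ?mul0r//;
    case: (F t) => x y /=; rewrite ?mul0r ?mul1r ?addr0.
Qed.

End complex_integrals.

(** * The spaces L2 and H2 *)

Section square_integrable.
Context {R : realType}.
Local Notation C := R[i].
Local Notation mu := (@circle R).
Implicit Types (h k f : C -> C) (p : {poly C}) (eps c M : R).

Definition trace h (t : R) : C := h (expi t).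
(** The squared L2 norm. Working with squares avoids roots throughout; the price is a factor 2 in
    the triangle inequality. *)
Definition sqn h : R := rint (fun t => normc (trace h t) ^+ 2).

Lemma normLp2E h :
  normLp 2%:E h = ((\int[mu]_t (normc (trace h t) ^+ 2)%:E) `^ 2^-1)%E.
Proof.
rewrite /normLp unlock; congr poweR; apply: eq_integral => t _.
by rewrite /= powR_mulrn// ger0_norm ?normc_ge0.
Qed.

Lemma L2P h : L2 h <->
  cmeasurable (trace h) /\ rintegrable (fun t => normc (trace h t) ^+ 2).
Proof.
have eqN t : `|(normc (trace h t) ^+ 2)%:E|%E = (normc (trace h t) ^+ 2)%:E.
  by rewrite gee0_abs// lee_fin sqr_ge0.
split=> [[m1 m2]|[[m1 m2]]].
  rewrite normLp2E => fin_h; split; first by split.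
  apply/integrableP; split.
    apply/measurable_EFinP; apply: (@rmeasurableX R).
    by apply: rmeasurable_normc; split.
  by under eq_integral do rewrite eqN; apply: lty_poweRy fin_h.
move=> /integrableP[_]; under eq_integral do rewrite eqN.
by move=> fin_h; split => //; rewrite normLp2E poweR_lty.
Qed.

Lemma L2_measurable h : L2 h -> cmeasurable (trace h).
Proof. by move=> /L2P[]. Qed.

Lemma L2_sqr h : L2 h -> rintegrable (fun t => normc (trace h t) ^+ 2).
Proof. by move=> /L2P[]. Qed.

Lemma sqn_ge0 h : 0 <= sqn h.
Proof. by apply: rint_ge0 => t; exact: sqr_ge0. Qed.

Lemma sqnE h : L2 h -> (\int[mu]_t (normc (trace h t) ^+ 2)%:E = (sqn h)%:E)%E.
Proof. by move=> /L2_sqr ih; rewrite fineK//; exact: integrable_fin_num. Qed.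

Lemma normLp2_lt h eps : L2 h -> 0 < eps ->
  ((normLp 2%:E h < eps%:E)%E = (sqn h < eps ^+ 2)).
Proof.
move=> Lh eps0; rewrite normLp2E sqnE// poweR_EFin lte_fin powR12_sqrt ?sqn_ge0//.
by rewrite -[in LHS](@ger0_norm _ eps) ?ltW// -sqrtr_sqr ltr_sqrt// exprn_gt0.
Qed.

Lemma L2_le h M : cmeasurable (trace h) -> (forall t, normc (trace h t) <= M) ->
  L2 h.
Proof.
move=> mh hM; apply/L2P; split => //.
apply: (rintegrable_le _ (rintegrable_cst (M ^+ 2))).
  by apply: (@rmeasurableX R); exact: rmeasurable_normc.
by move=> t; rewrite ger0_norm ?sqr_ge0// lerXn2r// nnegrE ?normc_ge0//
  (le_trans (normc_ge0 _) (hM t)).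
Qed.

Lemma normc_sqrD (x y : C) :
  normc (x + y) ^+ 2 <= 2 * normc x ^+ 2 + 2 * normc y ^+ 2.
Proof.
apply: le_trans (_ : (normc x + normc y) ^+ 2 <= _).
  by rewrite lerXn2r ?nnegrE ?addr_ge0 ?normc_ge0// normc_leD.
rewrite -subr_ge0 [X in 0 <= X](_ : _ = (normc x - normc y) ^+ 2) ?sqr_ge0//.
by ring.
Qed.

Let sqrD_integrable h k : L2 h -> L2 k ->
  rintegrable (fun t => 2 * normc (trace h t) ^+ 2 + 2 * normc (trace k t) ^+ 2).
Proof.
by move=> Lh Lk; apply: rintegrableD; apply: rintegrableZ; exact: L2_sqr.
Qed.

Lemma L2D h k : L2 h -> L2 k -> L2 (fun z => h z + k z).
Proof.
move=> Lh Lk; have mhk : cmeasurable (trace (fun z => h z + k z)).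
  by apply: (@cmeasurableD R (trace h) (trace k)); exact: L2_measurable.
apply/L2P; split=> //; apply: (rintegrable_le _ (sqrD_integrable Lh Lk)).
  by apply: (@rmeasurableX R); exact: rmeasurable_normc.
by move=> t; rewrite ger0_norm ?sqr_ge0//; exact: normc_sqrD.
Qed.

Lemma sqnD h k : L2 h -> L2 k ->
  sqn (fun z => h z + k z) <= 2 * sqn h + 2 * sqn k.
Proof.
move=> Lh Lk; have [ih ik] := (L2_sqr Lh, L2_sqr Lk).
rewrite /sqn -!rintZ// -rintD; try exact: rintegrableZ.
apply: rint_le; [exact: (L2_sqr (L2D Lh Lk))|exact: sqrD_integrable|].
by move=> t; exact: normc_sqrD.
Qed.

Lemma L2Z (a : C) h : L2 h -> L2 (fun z => a * h z).
Proof.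
move=> Lh; apply/L2P; split.
  by apply: (@cmeasurableM R (fun=> a) (trace h));
    [exact: cmeasurable_cst|exact: L2_measurable].
rewrite /trace; under [X in rintegrable X]eq_fun do rewrite normcM exprMn.
by apply: rintegrableZ; exact: L2_sqr.
Qed.

Lemma sqnZ (a : C) h : L2 h -> sqn (fun z => a * h z) = normc a ^+ 2 * sqn h.
Proof.
move=> Lh; rewrite /sqn -rintZ; last exact: L2_sqr.
by congr rint; apply/funext => t; rewrite /trace normcM exprMn.
Qed.

Lemma L2B h k : L2 h -> L2 k -> L2 (fun z => h z - k z).
Proof.
move=> Lh /(L2Z (-1)) Lk; have := L2D Lh Lk.
by under [X in L2 X -> _]eq_fun do rewrite mulN1r.
Qed.

Lemma sqnBC h k : sqn (fun z => h z - k z) = sqn (fun z => k z - h z).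
Proof. by congr rint; apply/funext => t; rewrite /trace normcB. Qed.

Lemma sqn_triangle h k f : L2 h -> L2 k -> L2 f ->
  sqn (fun z => h z - f z) <=
  2 * sqn (fun z => h z - k z) + 2 * sqn (fun z => k z - f z).
Proof.
move=> Lh Lk Lf; have := sqnD (L2B Lh Lk) (L2B Lk Lf).
by under [X in sqn X <= _ -> _]eq_fun do rewrite addrA subrK.
Qed.

Lemma L2_horner p : L2 (horner p).
Proof.
have me : cmeasurable (@expi R) by exact: cmeasurable_expi rmeasurable_id.
elim/poly_ind: p => [|p c IH].
  apply: (@L2_le _ 0) => [|t]; rewrite /trace.
    by under [X in cmeasurable X]eq_fun do rewrite horner0; exact: cmeasurable_cst.
  by rewrite horner0 normc0.
have -> : horner (p * 'X + c%:P) = fun z => p.[z] * z + c.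
  by apply/funext => z; rewrite hornerMXaddC.
apply: L2D; last first.
  by apply: (@L2_le _ (normc c)) => // ; exact: cmeasurable_cst.
apply/L2P; split.
  by apply: (@cmeasurableM R (trace (horner p))) => //; exact: L2_measurable.
rewrite /trace; under [X in rintegrable X]eq_fun do
  rewrite normcM normc_expi mulr1.
exact: L2_sqr.
Qed.

Lemma L2_exprn n : L2 (fun z : C => z ^+ n).
Proof.
have <- : horner 'X^n = fun z : C => z ^+ n by apply/funext => z; rewrite hornerXn.
exact: L2_horner.
Qed.

Definition bounded_by f M := [/\ 0 < M, cmeasurable (trace f)
  & {ae mu, forall t, normc (trace f t) <= M}].

Lemma Linfty_bounded f : Linfty f -> exists M, bounded_by f M.
Proof.
move=> [m1 m2]; rewrite /normLp unlock.
rewrite [X in (0 < X)%E](@probability_setT _ _ _ mu) lte01.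
set e := ess_sup _ _ => ey.
(* [fine] is faithful only at finite values. The lower end is excluded because a nonnegative
   function on a space of positive mass has a nonnegative essential supremum. *)
have e0 : (-oo < e)%E.
  rewrite ltNye; apply/eqP => /ess_sup_eqNyP aeN.
  have : (e <= -oo%E)%E by apply/ess_supP; apply: (aeS _ aeN) => t ->.
  have : (0 <= e)%E.
    apply: ess_sup_gee.
      by rewrite [X in (0 < X)%E](@probability_setT _ _ _ mu) lte01.
    by apply: nearW => t; exact: abse_ge0.
  by move=> /le_trans /[apply].
exists (`|fine e| + 1); split; [by rewrite ltr_wpDl| by split|].
apply: (aeS _ (ess_sup_ge mu (abse \o (fun t : R => (complex.Re `|f (expi t)|)%:E)))).
move=> t /=; rewrite -/e -[e]fineK; last by rewrite fin_numE -ltey -ltNye e0 ey.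
rewrite lee_fin ger0_norm ?normc_ge0// => /le_trans; apply.
by rewrite (le_trans (ler_norm _))// lerDl.
Qed.

Lemma bounded_le_ae f M h : bounded_by f M ->
  {ae mu, forall t, normc (trace (fun z => f z * h z) t) ^+ 2 <=
    M ^+ 2 * normc (trace h t) ^+ 2}.
Proof.
move=> [M0 _]; apply: aeS => t fM; rewrite /trace normcM exprMn.
by rewrite ler_wpM2r ?sqr_ge0// lerXn2r// nnegrE ?normc_ge0// ltW.
Qed.

Lemma L2M f M h : bounded_by f M -> L2 h -> L2 (fun z => f z * h z).
Proof.
move=> bf Lh; have [_ mf _] := bf; have mfh : cmeasurable (trace (fun z => f z * h z)).
  by apply: (@cmeasurableM R (trace f)) => //; exact: L2_measurable.
apply/L2P; split => //.
apply: (rintegrable_le_ae _ (rintegrableZ (M ^+ 2) (L2_sqr Lh))).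
  by apply: (@rmeasurableX R); exact: rmeasurable_normc.
apply: (aeS _ (bounded_le_ae h bf)) => t; rewrite ger0_norm ?sqr_ge0//.
Qed.

Lemma bounded_L2 f M : bounded_by f M -> L2 f.
Proof.
move=> bf; have := L2M bf (L2_exprn 0).
by under [X in L2 X -> _]eq_fun do rewrite expr0 mulr1.
Qed.

Lemma L2J h : L2 h -> L2 (fun z => (h z)^*).
Proof.
move=> /L2P[mh ih]; apply/L2P; split; first exact: cmeasurableJ.
by under [X in rintegrable X]eq_fun do rewrite /trace normc_conj.
Qed.

Lemma L2_mul_integrable h k : L2 h -> L2 k ->
  cintegrable (fun t => trace h t * trace k t).
Proof.
move=> Lh Lk; apply: cintegrable_le (rintegrableD (L2_sqr Lh) (L2_sqr Lk)) _.
  by apply: cmeasurableM; exact: L2_measurable.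
move=> t; rewrite normcM.
rewrite -subr_ge0; set x := normc _; set y := normc _.
rewrite [X in 0 <= X](_ : _ = (x - y) ^+ 2 + x * y); last by ring.
by rewrite addr_ge0 ?sqr_ge0// mulr_ge0// normc_ge0.
Qed.

Lemma L2_integrable h : L2 h -> cintegrable (trace h).
Proof.
move=> Lh; have := L2_mul_integrable Lh (L2_exprn 0).
by rewrite {2}/trace; under [X in cintegrable X -> _]eq_fun do
  rewrite expr0 mulr1.
Qed.

Lemma inner_integrable h k : L2 h -> L2 k ->
  cintegrable (fun t => h (expi t) * (k (expi t))^*).
Proof. by move=> Lh /L2J; exact: L2_mul_integrable. Qed.

Lemma innerDl h1 h2 k : L2 h1 -> L2 h2 -> L2 k ->
  inner (fun z => h1 z + h2 z) k = inner h1 k + inner h2 k.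
Proof.
move=> L1 L2' Lk; rewrite /inner -!/(cint _) -cintD; try exact: inner_integrable.
by congr cint; apply/funext => t; rewrite mulrDl.
Qed.

Lemma innerZl (a : C) h k : L2 h -> L2 k ->
  inner (fun z => a * h z) k = a * inner h k.
Proof.
move=> Lh Lk; rewrite /inner -!/(cint _) -cintZ; last exact: inner_integrable.
by congr cint; apply/funext => t; rewrite mulrA.
Qed.

Lemma innerC h k : L2 h -> L2 k -> inner k h = (inner h k)^*.
Proof.
move=> Lh Lk; rewrite /inner -!/(cint _) -cintJ; last exact: inner_integrable.
by congr cint; apply/funext => t; rewrite conjM conjCK mulrC.
Qed.

Lemma innerBl h1 h2 k : L2 h1 -> L2 h2 -> L2 k ->
  inner (fun z => h1 z - h2 z) k = inner h1 k - inner h2 k.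
Proof.
move=> L1 L2' Lk; rewrite /inner -!/(cint _) -cintB; try exact: inner_integrable.
by congr cint; apply/funext => t; rewrite mulrBl.
Qed.

Lemma innerBr h k1 k2 : L2 h -> L2 k1 -> L2 k2 ->
  inner h (fun z => k1 z - k2 z) = inner h k1 - inner h k2.
Proof.
move=> Lh L1 L2'; rewrite (innerC (L2B L1 L2') Lh) innerBl// conjB.
by rewrite (innerC L1 Lh) (innerC L2' Lh).
Qed.

Lemma inner_sqn h : inner h h = (sqn h)%:C.
Proof.
rewrite /inner -/(cint _); under [X in cint X]eq_fun do rewrite mul_conjc.
by apply: complex_ext => //; rewrite /= -/(rint _) rint_cst.
Qed.

(** Cauchy-Schwarz in the additive form [2 x y <= c x^2 + y^2 / c]. The free parameter [c] makes the
    second term small first, after which [h] is taken small enough for the first. *)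
Lemma normc_inner h k c : L2 h -> L2 k -> 0 < c ->
  normc (inner h k) <= c * sqn h + c^-1 * sqn k.
Proof.
move=> Lh Lk c0; have cn0 : c != 0 by rewrite gt_eqF.
have [ih ik] := (L2_sqr Lh, L2_sqr Lk).
pose b t := c / 2 * normc (trace h t) ^+ 2 + c^-1 / 2 * normc (trace k t) ^+ 2.
have ib : rintegrable b by apply: rintegrableD; exact: rintegrableZ.
have -> : c * sqn h + c^-1 * sqn k = 2 * rint b.
  by rewrite rintD ?rintZ ?mulrDr ?mulrA//; try exact: rintegrableZ;
     congr (_ * _ + _ * _); field.
apply: normc_cint_le ib _.
  exact: cintegrable_measurable (inner_integrable Lh Lk).
move=> t; rewrite normcM normc_conj /b /trace.
set x := normc _; set y := normc _; rewrite -subr_ge0.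
rewrite [X in 0 <= X](_ : _ = (c * x - y) ^+ 2 / (2 * c)).
  by rewrite divr_ge0 ?sqr_ge0// mulr_ge0// ltW.
by field.
Qed.

Lemma sqn_eq0 h : L2 h -> sqn h = 0 -> ae_eq_circle h (fun=> 0).
Proof.
move=> Lh h0; have := rint_eq0_ae (L2_sqr Lh) (fun t => sqr_ge0 _) h0.
by apply: aeS => t /eqP; rewrite sqrf_eq0 normc_eq0 => /eqP.
Qed.

Lemma sqnB_eq0 h k : L2 h -> L2 k -> sqn (fun z => h z - k z) = 0 ->
  ae_eq_circle h k.
Proof.
move=> Lh Lk /(sqn_eq0 (L2B Lh Lk)); apply: aeS => t /eqP.
by rewrite subr_eq0 => /eqP.
Qed.

Lemma inner_ae_eq h1 h2 k1 k2 : L2 h1 -> L2 h2 -> L2 k1 -> L2 k2 ->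
  ae_eq_circle h1 h2 -> ae_eq_circle k1 k2 -> inner h1 k1 = inner h2 k2.
Proof.
move=> Lh1 Lh2 Lk1 Lk2 hh kk; apply: cint_ae_eq.
- exact: cintegrable_measurable (inner_integrable Lh1 Lk1).
- exact: cintegrable_measurable (inner_integrable Lh2 Lk2).
- by apply: (aeS2 _ hh kk) => t -> ->.
Qed.

Lemma sqn_ae_eq h k : L2 h -> L2 k -> ae_eq_circle h k -> sqn h = sqn k.
Proof.
move=> Lh Lk hk; apply: rint_ae_eq.
- exact: rmeasurable_rintegrable (L2_sqr Lh).
- exact: rmeasurable_rintegrable (L2_sqr Lk).
- by apply: (aeS _ hk) => t; rewrite /trace => ->.
Qed.

Lemma ae_eq_circle_sym h k : ae_eq_circle h k -> ae_eq_circle k h.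
Proof. by apply: aeS => t ->. Qed.

Lemma ae_eq_circle_trans h k f :
  ae_eq_circle h k -> ae_eq_circle k f -> ae_eq_circle h f.
Proof. by apply: aeS2 => t -> ->. Qed.

Lemma inner_closure_eq0 h k : L2 h -> L2 k ->
  (forall eps, 0 < eps ->
    exists h', [/\ L2 h', sqn (fun z => h z - h' z) < eps & inner h' k = 0]) ->
  inner h k = 0.
Proof.
move=> Lh Lk approx; apply/eqP; rewrite -normc_eq0 -[_ == _]negbK -normr_gt0.
apply/negP; rewrite ger0_norm ?normc_ge0//; set e := normc _ => e0.
(* With this [c] the term [c^-1 * sqn k] is at most [e / 2]; the [+ 1] keeps [c] positive when
   [sqn k = 0]. The approximation of [h] is then required up to [e / 2 / c]. *)
pose c := 2 * (sqn k + 1) / e.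
have c0 : 0 < c by rewrite !(mulr_gt0, invr_gt0)// ltr_wpDl// sqn_ge0.
have [|h' [Lh' hh' h'k]] := approx (e / 2 / c); first by apply: divr_gt0 => //; exact: divr_gt0.
have := normc_inner (L2B Lh Lh') Lk c0.
rewrite innerBl// h'k subr0 -/e => /le_lt_trans.
suff : c * sqn (fun z => h z - h' z) + c^-1 * sqn k < e.
  by move=> + /(_ _) E => /E; rewrite ltxx.
have -> : e = e / 2 + e / 2 by field.
rewrite ltr_leD//; first by rewrite mulrC -ltr_pdivlMr//.
rewrite /c invf_div mulrAC ler_pdivrMr; last first.
  by rewrite mulr_gt0// ltr_wpDl// sqn_ge0.
rewrite [leRHS](_ : _ = e * (sqn k + 1)); last by field.
by rewrite ler_pM2l// lerDl.
Qed.

End square_integrable.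

Section hardy_space.
Context {R : realType}.
Local Notation C := R[i].
Local Notation mu := (@circle R).
Implicit Types (h k f : C -> C) (p : {poly C}) (eps c M : R).

Lemma H2P h : H2 h <-> L2 h /\
  forall eps, 0 < eps -> exists p, sqn (fun z => h z - p.[z]) < eps.
Proof.
split=> -[Lh approx]; split => // eps eps0.
  have [|p] := approx (Num.sqrt eps); first by rewrite sqrtr_gt0.
  rewrite normLp2_lt ?sqrtr_gt0//; last exact: (L2B Lh (L2_horner p)).
  by rewrite sqr_sqrtr ?ltW//; exists p.
have [|p hp] := approx (eps ^+ 2); first by rewrite exprn_gt0.
by exists p; rewrite normLp2_lt//; exact: (L2B Lh (L2_horner p)).
Qed.

Lemma H2_L2 h : H2 h -> L2 h. Proof. by case. Qed.

Lemma H2_horner p : H2 (horner p).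
Proof.
apply/H2P; split; first exact: L2_horner.
move=> eps eps0; exists p; under [X in sqn X]eq_fun do rewrite subrr.
by rewrite /sqn /trace normc0 expr0n rint_cst.
Qed.

Lemma H2_exprn n : H2 (fun z : C => z ^+ n).
Proof.
have <- : horner 'X^n = fun z : C => z ^+ n by apply/funext => z; rewrite hornerXn.
exact: H2_horner.
Qed.

Lemma H2_closed h : L2 h -> (forall eps, 0 < eps ->
    exists2 k, H2 k & sqn (fun z => h z - k z) < eps) -> H2 h.
Proof.
move=> Lh approx; apply/H2P; split => // eps eps0.
have e0 : 0 < eps / 4 by rewrite divr_gt0.
have [k Hk hk] := approx _ e0; have /H2P[Lk /(_ _ e0)[p kp]] := Hk.
exists p; apply: le_lt_trans (sqn_triangle Lh Lk (L2_horner p)) _.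
by rewrite -mulrDr [ltRHS](_ : _ = 2 * (eps / 4 + eps / 4)) ?ltr_pM2l ?ltrD//; field.
Qed.

Lemma H2D h k : H2 h -> H2 k -> H2 (fun z => h z + k z).
Proof.
move=> Hh Hk; have /H2P[Lh aph] := Hh; have /H2P[Lk apk] := Hk.
apply/H2P; split=> [|eps eps0]; first exact: L2D.
have e0 : 0 < eps / 4 by rewrite divr_gt0.
have [[p hp] [q kq]] := (aph _ e0, apk _ e0); exists (p + q).
under [X in sqn X]eq_fun do rewrite hornerD opprD addrACA.
apply: le_lt_trans (sqnD (L2B Lh (L2_horner p)) (L2B Lk (L2_horner q))) _.
by rewrite -mulrDr [ltRHS](_ : _ = 2 * (eps / 4 + eps / 4)) ?ltr_pM2l ?ltrD//; field.
Qed.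

Lemma H2Z (a : C) h : H2 h -> H2 (fun z => a * h z).
Proof.
move=> Hh; have /H2P[Lh aph] := Hh.
apply/H2P; split=> [|eps eps0]; first exact: L2Z.
have a0 : 0 < normc a ^+ 2 + 1 by rewrite ltr_wpDl// sqr_ge0.
have [|p hp] := aph (eps / (normc a ^+ 2 + 1)); first by rewrite divr_gt0.
exists (a *: p); under [X in sqn X]eq_fun do rewrite hornerZ -mulrBr.
rewrite sqnZ; last exact: (L2B Lh (L2_horner p)).
move: hp; rewrite ltr_pdivlMr// mulrC; apply: le_lt_trans.
by rewrite ler_wpM2r ?sqn_ge0// lerDl.
Qed.

Lemma H2B h k : H2 h -> H2 k -> H2 (fun z => h z - k z).
Proof.
move=> Hh /(H2Z (-1)) Hk; have := H2D Hh Hk.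
by under [X in H2 X -> _]eq_fun do rewrite mulN1r.
Qed.

Lemma H2_ae_eq h k : L2 k -> H2 h -> ae_eq_circle h k -> H2 k.
Proof.
move=> Lk Hh hk; apply: H2_closed => // eps eps0; exists h => //.
have Lh := H2_L2 Hh.
rewrite (@sqn_ae_eq _ _ (horner 0)) //; first 1 last.
- exact: L2B.
- exact: L2_horner.
- by apply: (aeS _ hk) => t ->; rewrite horner0 subrr.
by rewrite /sqn /trace; under [X in rint X]eq_fun do
  rewrite horner0 normc0 expr0n; rewrite rint_cst.
Qed.

Lemma inner_horner p k : L2 k ->
  inner (horner p) k = \sum_(i < size p) p`_i * inner (fun z => z ^+ i) k.
Proof.
move=> Lk; pose F i t := p`_i * (expi t ^+ i * (k (expi t))^*).
have iF i : cintegrable (F i).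
  by apply: cintegrableZ; apply: (@inner_integrable _ (fun z => z ^+ i)) => //;
    exact: L2_exprn.
transitivity (cint (fun t => \sum_(i <- index_enum 'I_(size p)) F i t)).
  congr cint; apply/funext => t; rewrite horner_coef mulr_suml.
  by apply: eq_bigr => i _; rewrite /F mulrA.
rewrite (cint_sum _ (fun i : 'I_(size p) => iF i)).2; apply: eq_bigr => i _.
rewrite cintZ//; apply: (@inner_integrable _ (fun z => z ^+ i)) => //.
exact: L2_exprn.
Qed.

(** Polynomials are dense in [H2] and the pairing is continuous, so the powers of [z] suffice as
    test functions. *)
Lemma inner_H2_eq0 k : L2 k -> (forall n, inner (fun z => z ^+ n) k = 0) ->
  forall h, H2 h -> inner h k = 0.
Proof.
move=> Lk k0 h /H2P[Lh aph]; apply: inner_closure_eq0 => // eps /aph[p hp].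
exists (horner p); split => //; first exact: L2_horner.
by rewrite inner_horner// big1// => i _; rewrite k0 mulr0.
Qed.

Lemma H2_orth_self h : H2 h -> (forall n, inner (fun z => z ^+ n) h = 0) ->
  ae_eq_circle h (fun=> 0).
Proof.
move=> Hh h0; have Lh := H2_L2 Hh; apply: sqn_eq0 => //.
by have /complexI := etrans (esym (inner_sqn h)) (inner_H2_eq0 Lh h0 Hh).
Qed.

End hardy_space.

(** * Reflections of the circle *)

Section reflection.
Context {R : realType}.
Local Notation C := R[i].
Local Notation T := (measurableTypeR R).
Local Notation leb := (@lebesgue_measure R).
Local Notation mu := (@circle R).
Local Open Scope ereal_scope.
Implicit Types (c : R) (phi : R -> \bar R).

Lemma measurable_reflection c :
  measurable_fun [set: T] ((fun t => (c - t)%R) : T -> T).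
Proof. by apply: measurable_funB => //; exact: measurable_cst. Qed.

Lemma lebesgue_measure_reflection c (A : set R) : measurable A ->
  pushforward leb ((fun t => (c - t)%R) : T -> T) A = leb A.
Proof.
move=> mA; apply/esym/lebesgue_measure_unique => //=.
  exact: measurable_reflection.
move=> _ _ [[a b] _ <-]; rewrite /pushforward.
have -> : ((fun t : R => (c - t)%R) @^-1` `]a, b]) = `[(c - b)%R, (c - a)%R[%classic.
  apply/seteqP; split=> t /=; rewrite !in_itv /=.
    by move=> /andP[H1 H2]; apply/andP; split; lra.
  by move=> /andP[H1 H2]; apply/andP; split; lra.
rewrite !lebesgue_measure_itv/= !lte_fin.
by rewrite ltrD2l ltrN2; case: ifPn => // _; congr EFin; ring.
Qed.

Lemma ge0_integral_reflection c (D : set R) phi :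
  measurable D -> measurable_fun D phi -> (forall t, 0 <= phi t) ->
  \int[leb]_(t in D) phi t =
  \int[leb]_(t in (fun t => (c - t)%R) @^-1` D) phi (c - t)%R.
Proof.
move=> mD mphi phi0.
rewrite -(@ge0_integral_pushforward _ _ _ _ _ _ (measurable_reflection c) leb)//.
apply: eq_measure_integral => //=.
  exact: measurable_reflection.
move=> _ A mA _.
by rewrite lebesgue_measure_reflection.
Qed.

Lemma ge0_integral_itv_reflection (a b : R) phi :
  measurable_fun [set: T] phi -> (forall t, 0 <= phi t) ->
  \int[leb]_(t in `[a, b]) phi (a + b - t)%R = \int[leb]_(t in `[a, b]) phi t.
Proof.
move=> mphi phi0.
rewrite [RHS](ge0_integral_reflection (a + b))//; last exact: measurable_funTS.
congr integral; apply/seteqP; split=> t /=; rewrite !in_itv /=.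
  by move=> /andP[H1 H2]; apply/andP; split; lra.
by move=> /andP[H1 H2]; apply/andP; split; lra.
Qed.

(* [t |-> c - t] exchanges the ends of [0, c] and, modulo [2 pi], those of
   [c, 2 pi]. *)
Lemma ge0_integral_circle_reflection c phi :
  measurable_fun [set: T] phi -> (forall t, 0 <= phi t) ->
  (forall t, phi (t + 2 * pi)%R = phi t) -> (0 <= c <= 2 * pi)%R ->
  \int[mu]_t phi (c - t)%R = \int[mu]_t phi t.
Proof.
move=> mphi phi0 per /andP[c0 c2].
have mphic : measurable_fun [set: T] (fun t => phi (c - t)%R).
  exact: (measurableT_comp mphi (measurable_reflection c)).
have split_c (psi : R -> \bar R) : measurable_fun [set: T] psi ->
    \int[leb]_(t in `[0%R, (2 * pi)%R]) psi t =
    \int[leb]_(t in `[0%R, c]) psi t + \int[leb]_(t in `[c, (2 * pi)%R]) psi t.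
  move=> mpsi; rewrite (@itv_bndbnd_setU _ _ _ (BRight c)) ?bnd_simp//.
  rewrite integral_setU//.
  - by congr (_ + _); rewrite integral_itv_obnd_cbnd//; exact: measurable_funTS.
  - exact: measurable_funTS.
  - apply/disj_setPS => y [/=]; rewrite 2!in_itv/= => /andP[_ yx] /andP[].
    by rewrite ltNge yx.
rewrite !integral_uniform//; congr (_ * _).
rewrite !split_c//; congr (_ + _).
  rewrite -[RHS]ge0_integral_itv_reflection//.
  by apply: eq_integral => t _; rewrite add0r.
rewrite -[RHS]ge0_integral_itv_reflection//.
by apply: eq_integral => t _; rewrite -per; congr phi; ring.
Qed.

End reflection.

(** * Orthonormality of the powers of z and unitarity of the flip *)

Section orthonormality.
Context {R : realType}.
Local Notation C := R[i].
Local Notation T := (measurableTypeR R).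
Implicit Types (c : R) (h : C -> C) (n : nat).

Lemma rint_reflection c (a : R -> R) : rmeasurable a ->
  (forall t, a (t + 2 * pi) = a t) -> 0 <= c <= 2 * pi ->
  rint (fun t => a (c - t)) = rint a.
Proof.
move=> ma per c02; congr fine; rewrite integralE [RHS]integralE.
have mEa : measurable_fun [set: T] (EFin \o a) by exact/measurable_EFinP.
congr (_ - _)%E.
  rewrite -[RHS](ge0_integral_circle_reflection _ _ _ c02).
  - by apply: eq_integral => t _; rewrite !funeposE.
  - exact: measurable_funepos.
  - exact: funepos_ge0.
  - by move=> t; rewrite !funeposE /= per.
rewrite -[RHS](ge0_integral_circle_reflection _ _ _ c02).
- by apply: eq_integral => t _; rewrite !funenegE.
- exact: measurable_funeneg.
- exact: funeneg_ge0.
- by move=> t; rewrite !funenegE /= per.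
Qed.

Lemma cint_reflection c (F : R -> C) : cmeasurable F ->
  (forall t, F (t + 2 * pi) = F t) -> 0 <= c <= 2 * pi ->
  cint (fun t => F (c - t)) = cint F.
Proof.
move=> [F1 F2] per c02; apply: complex_ext => /=.
  by apply: (rint_reflection F1) => // t; rewrite per.
by apply: (rint_reflection F2) => // t; rewrite per.
Qed.

Lemma cmeasurable_trace_exprn n : cmeasurable (fun t : R => expi t ^+ n).
Proof. by apply: cmeasurableX; exact: cmeasurable_expi rmeasurable_id. Qed.

(** Two reflections replace an antiderivative. The one about [c = 0] shows that the integral equals
    its conjugate; the one with [c = pi / n] brings in the factor [expi pi = -1] and shows that it
    equals minus its conjugate. *)
Lemma cint_expi_eq0 n : (0 < n)%N -> cint (fun t : R => expi t ^+ n) = 0.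
Proof.
move=> n0; have mF := cmeasurable_trace_exprn n.
have per t : expi (t + 2 * pi) ^+ n = expi t ^+ n :> C by rewrite expi_2pi.
have iJ : cintegrable (fun t : R => (expi t ^+ n)^*).
  apply: cintegrable_le (cmeasurableJ mF) (rintegrable_cst 1) _ => t.
  by rewrite normc_conj normcX normc_expi expr1n.
have pi0 := pi_ge0 R.
have n1 : 1 <= n%:R :> R by rewrite ler1n.
have cbound : (0 <= pi / n%:R :> R) && (pi / n%:R <= 2 * pi :> R).
  by rewrite divr_ge0//= ler_pdivrMr ?ltr0n//; nra.
have := cint_reflection mF per cbound.
have b0 : (0 <= 0 :> R) && (0 <= 2 * pi :> R) by rewrite lexx mulr_ge0.
have := cint_reflection mF per b0.
 under [X in cint X = _ -> _]eq_fun do rewrite add0r expiN -conjX.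
move=> e0; under [X in cint X = _ -> _]eq_fun do rewrite expiD expiN exprMn -conjX.
rewrite cintZ// e0 -expiX.
have -> : pi / n%:R *+ n = pi :> R.
  by rewrite -[LHS]mulr_natr divfK// pnatr_eq0 -lt0n.
have -> : expi pi = -1 :> C.
  by apply: complex_ext; rewrite ?ReN ?ImN /= ?cospi ?sinpi ?oppr0.
rewrite mulN1r => /eqP; rewrite eq_sym -subr_eq0 opprK -mulr2n.
by rewrite mulrn_eq0 /= => /eqP.
Qed.

Lemma inner_exprn n m :
  inner (fun z : C => z ^+ n) (fun z => z ^+ m) = (n == m)%:R.
Proof.
have lt_case i j : (i < j)%N ->
    inner (fun z : C => z ^+ i) (fun z => z ^+ j) = 0.
  move=> ij; rewrite innerC; try exact: L2_exprn.
  apply/eqP; rewrite conjC_eq0; apply/eqP.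
  rewrite -(@cint_expi_eq0 (j - i)) ?subn_gt0//.
  congr cint; apply/funext => t.
  rewrite -[in LHS](subnK (ltnW ij)) exprD -mulrA mul_conjc normcX normc_expi.
  by rewrite !expr1n mulr1.
have [nm|mn|->] := ltngtP n m; first exact: lt_case.
  by rewrite innerC ?lt_case ?conjC0//; exact: L2_exprn.
rewrite inner_sqn /sqn /trace; under [X in rint X]eq_fun do
  rewrite normcX normc_expi !expr1n.
by rewrite rint_cst.
Qed.

Lemma inner_flip h k : L2 h -> L2 k -> inner (flip h) (flip k) = inner h k.
Proof.
move=> Lh Lk; have mF := cintegrable_measurable (inner_integrable Lh Lk).
have per t : h (expi (t + 2 * pi)) * (k (expi (t + 2 * pi)))^* =
    h (expi t) * (k (expi t))^* by rewrite expi_2pi.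
have b0 : (0 <= 0 :> R) && (0 <= 2 * pi :> R) by rewrite lexx mulr_ge0// pi_ge0.
rewrite -[RHS](cint_reflection mF per b0); congr cint; apply/funext => t.
rewrite sub0r expiN /flip !conjcE conjM conjCK mulrACA.
by rewrite [_^* * _]mulrC mul_expi_conj mul1r.
Qed.

End orthonormality.

(** * Completeness of L2 and the projection on H2 *)

Section riesz_fischer.
Context {R : realType}.
Local Notation C := R[i].
Local Notation T := (measurableTypeR R).
Local Notation mu := (@circle R).
Implicit Types (h : C -> C) (k n : nat) (u : (C -> C) ^nat).

(** The L1 norm is at most the L2 norm on a probability space, by integrating
    [x <= c / 2 + x^2 / (2 c)]. *)
Lemma rint_normc_le h c : L2 h -> 0 < c -> sqn h <= c ^+ 2 ->
  rint (fun t => normc (trace h t)) <= c.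
Proof.
move=> Lh c0 hc; have cn0 : c != 0 by rewrite gt_eqF.
pose b t := c / 2 + (2 * c)^-1 * normc (trace h t) ^+ 2.
have i1 : rintegrable (fun t => (2 * c)^-1 * normc (trace h t) ^+ 2).
  by apply: rintegrableZ; exact: L2_sqr.
have ib : rintegrable b by apply: rintegrableD => //; exact: rintegrable_cst.
apply: (@le_trans _ _ (rint b)).
  apply: rint_le => // [|t]; first exact: (cintegrable_normc (L2_integrable Lh)).
  rewrite /b -subr_ge0; set x := normc _.
  rewrite [X in 0 <= X](_ : _ = (c - x) ^+ 2 / (2 * c)); last by field.
  by rewrite divr_ge0 ?sqr_ge0// mulr_ge0// ltW.
rewrite rintD ?rint_cst ?rintZ//; [|exact: L2_sqr|exact: rintegrable_cst].
have e2 : c / 2 = (2 * c)^-1 * c ^+ 2 by field.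
have : (2 * c)^-1 * sqn h <= c / 2.
  by rewrite e2 ler_pM2l// invr_gt0 mulr_gt0.
rewrite -/(sqn h); lra.
Qed.

Lemma sum_half_le2 n : \sum_(0 <= k < n) (2^-1 : R) ^+ k <= 2.
Proof.
suff -> : \sum_(0 <= k < n) (2^-1 : R) ^+ k = 2 - 2 * 2^-1 ^+ n.
  by rewrite gerBl mulr_ge0// exprn_ge0.
elim: n => [|n IH]; first by rewrite big_geq// expr0; ring.
by rewrite big_nat_recr//= IH exprS; field.
Qed.

Lemma cvgn_of_summable (x D : R ^nat) :
  (forall k, `|x k.+1 - x k| <= D k) ->
  (\sum_(k <oo) (D k)%:E < +oo)%E -> cvgn x.
Proof.
move=> xD sumD; have D0 k : 0 <= D k by exact: le_trans (xD k).
have cD : cvgn (series D).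
  apply: nondecreasing_is_cvgn; first exact: nondecreasing_series.
  exists (fine (\sum_(k <oo) (D k)%:E)%E) => _ [n _ <-].
  rewrite -lee_fin fineK; last first.
    by rewrite ge0_fin_numE// nneseries_ge0// => k _ _; rewrite lee_fin.
  rewrite /series /= -sumEFin.
  by apply: nneseries_lim_ge => k _ _; rewrite lee_fin.
have /normed_cvg cx : cvgn [normed series (telescope x)].
  by apply: (series_le_cvg _ D0 xD cD) => k; exact: normr_ge0.
have -> : x = (fun n => x 0%N + series (telescope x) n).
  by apply/funext => n; exact: eq_sum_telescope.
by apply: is_cvgD => //; exact: is_cvg_cst.
Qed.

(** The geometric rate makes the increments summable in L1, hence summable at almost every point,
    which gives a pointwise limit. Fatou's lemma then carries the Cauchy bound over to the limit. *)
Lemma riesz_fischer u : (forall k, L2 (u k)) ->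
  (forall j k, (k <= j)%N ->
    sqn (fun z => u j z - u k z) <= (2^-1 ^+ k) ^+ 2) ->
  exists U, L2 U /\
    forall k, sqn (fun z => U z - u k z) <= (2^-1 ^+ k) ^+ 2.
Proof.
move=> Lu cauchy.
pose D k t := normc (trace (fun z => u k.+1 z - u k z) t).
have LD k : L2 (fun z => u k.+1 z - u k z) by exact: L2B.
have c0 k : 0 < (2^-1 : R) ^+ k by rewrite exprn_gt0.
have iD k : rintegrable (D k) by exact: (cintegrable_normc (L2_integrable (LD k))).
have D0 k t : (0 <= (D k t)%:E)%E by rewrite lee_fin normc_ge0.
have mD k : measurable_fun [set: T] (EFin \o D k) by exact: measurable_int (iD k).
have sumD : {ae mu, forall t, (\sum_(k <oo) (D k t)%:E < +oo)%E}.
  have : mu.-integrable [set: T] (fun t => \sum_(k <oo) (D k t)%:E)%E.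
    apply/integrableP; split.
      by apply: ge0_emeasurable_sum => [k t _ _|k _]; [exact: D0|exact: mD].
    under eq_integral do rewrite gee0_abs ?nneseries_ge0//.
    rewrite integral_nneseries//.
    apply: (@le_lt_trans _ _ 2%:E); last exact: ltry.
    apply: lime_le; first by apply: is_cvg_nneseries => k _ _; exact: integral_ge0.
    apply: nearW => n.
    apply: (@le_trans _ _ (\sum_(0 <= k < n) (2^-1 ^+ k)%:E)%E); last first.
      by rewrite sumEFin lee_fin sum_half_le2.
    apply: lee_sum => k _; rewrite -[leLHS]fineK; last exact: (integrable_fin_num measurableT (iD k)).
    by rewrite lee_fin; apply: (rint_normc_le (LD k)) => //; exact: cauchy.
  move=> /(integrable_ae measurableT).
  by apply: aeS => t /(_ I); rewrite ge0_fin_numE// nneseries_ge0.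
(* An upper limit exists and is measurable whether or not the sequence converges, so [U] is
   measurable on the whole circle. *)
pose limf (v : nat -> R) := fine (limn_esup (EFin \o v)).
have limfE (v : nat -> R) (l : R) : v @ \oo --> l -> limf v = l.
  move=> vl; have vl' : EFin \o v @ \oo --> l%:E.
    by apply: cvg_EFin => //; exact: nearW.
  by rewrite /limf (cvg_limn_einf_sup vl').2.
pose U z := limf (fun k => complex.Re (u k z)) +i* limf (fun k => complex.Im (u k z)).
have mlim (v : nat -> R -> R) : (forall k, rmeasurable (v k)) ->
    rmeasurable (fun t => limf (v ^~ t)).
  move=> mv; apply: (measurableT_comp (f := @fine R)); first exact: fine_measurable.
  by apply: measurable_fun_limn_esup => k; apply/measurable_EFinP; exact: mv.
have mU : cmeasurable (trace U).
  by split; apply: mlim => k; have [] := L2_measurable (Lu k).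
have fatouU k :
    (\int[mu]_t (normc (trace (fun z => U z - u k z) t) ^+ 2)%:E <=
      ((2^-1 ^+ k) ^+ 2)%:E)%E.
  pose a j t := (normc (trace (fun z => u j z - u k z) t) ^+ 2)%:E.
  have ma j : measurable_fun [set: T] (a j).
    exact: measurable_int (L2_sqr (L2B (Lu j) (Lu k))).
  apply: (@le_trans _ _ (\int[mu]_t (limn_einf (a ^~ t)))%E).
    apply: ae_ge0_le_integral => //.
    - by move=> t _; rewrite lee_fin sqr_ge0.
    - apply/measurable_EFinP; apply: (@rmeasurableX R); apply: rmeasurable_normc.
      apply: (@cmeasurableB R (trace U)) => //; exact: L2_measurable.
    - by move=> t _; rewrite limn_einf_lim; apply: lime_ge; [exact: is_cvg_einfs|apply: nearW => n;
        apply: le_ereal_inf_tmp => _ [j _ <-]; rewrite lee_fin sqr_ge0].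
    - apply: (emeasurable_fun_cvg (fun n t => einfs (a ^~ t) n)) => [n|t _].
        exact: measurable_fun_einfs.
      by rewrite limn_einf_lim; exact: is_cvg_einfs.
    - apply: (aeS _ sumD) => t St _.
      have cv (p : C -> R) : (forall z w, `|p z - p w| <= normc (z - w)) ->
          cvgn (fun j => p (trace (u j) t)).
        by move=> pB; apply: (cvgn_of_summable _ St) => j; exact: pB.
      have /cvg_ex[x Rx] := cv (@complex.Re R) (fun z w => normc_Re_sub z w).
      have /cvg_ex[y Iy] := cv (@complex.Im R) (fun z w => normc_Im_sub z w).
      have -> : trace (fun z => U z - u k z) t = (x +i* y) - trace (u k) t.
        by rewrite /trace /U (limfE _ _ Rx) (limfE _ _ Iy).
      suff : a ^~ t @ \oo --> (normc ((x +i* y) - trace (u k) t) ^+ 2)%:E.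
        by move=> /cvg_limn_einf_sup[-> _].
      apply: cvg_EFin; first exact: nearW.
      under [X in X @ _ --> _]eq_fun do
        rewrite /= normc_sqr ReD ImD !expr2.
      rewrite normc_sqr ReD ImD !expr2.
      by apply: cvgD; apply: cvgM; apply: cvgD => //; exact: cvg_cst.
  apply: le_trans (fatou _ _ ma _) _ => // [j t _|]; first by rewrite lee_fin sqr_ge0.
  rewrite limn_einf_lim; apply: lime_le; first exact: is_cvg_einfs.
  (* The tail infimum is bounded by a term of index at least [k] as well as at least [n], where the
     Cauchy hypothesis applies. *)
  apply: nearW => n; apply: le_trans (ereal_inf_lbound _) _.
    by exists (maxn n k); [exact: leq_maxl|reflexivity].
  rewrite sqnE; last exact: L2B.
  by rewrite lee_fin cauchy// leq_maxr.
have LUk k : L2 (fun z => U z - u k z).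
  apply/L2P; split.
    by apply: (@cmeasurableB R (trace U)) => //; exact: L2_measurable.
  apply/integrableP; split.
    apply/measurable_EFinP; apply: (@rmeasurableX R); apply: rmeasurable_normc.
    by apply: (@cmeasurableB R (trace U)) => //; exact: L2_measurable.
  under eq_integral do rewrite gee0_abs ?lee_fin ?sqr_ge0//.
  by apply: le_lt_trans (fatouU k) _; exact: ltry.
exists U; split.
  have := L2D (LUk 0%N) (Lu 0%N).
  by under [X in L2 X -> _]eq_fun do rewrite subrK.
by move=> k; have := fatouU k; rewrite sqnE// lee_fin.
Qed.

End riesz_fischer.

Section projections.
Context {R : realType}.
Local Notation C := R[i].
Implicit Types (h k u f g : C -> C) (p : {poly C}) (n m : nat) (S : set (C -> C)).

Lemma inner_horner_exprn p n : inner (horner p) (fun z => z ^+ n) = p`_n.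
Proof.
rewrite inner_horner; last exact: L2_exprn.
under eq_bigr do rewrite inner_exprn.
have [np|pn] := ltnP n (size p).
  rewrite (bigD1 (Ordinal np))//= eqxx mulr1 big1 ?addr0// => i.
  by rewrite -val_eqE /= => /negbTE ->; rewrite mulr0.
rewrite nth_default// big1// => i _.
by rewrite ltn_eqF ?mulr0// (leq_trans (ltn_ord i)).
Qed.

Lemma sqn_horner p n : (size p <= n)%N ->
  sqn (horner p) = \sum_(0 <= i < n) normc p`_i ^+ 2.
Proof.
move=> pn; apply: complexI; rewrite -inner_sqn inner_horner; last exact: L2_horner.
rewrite -(big_mkord xpredT (fun i => p`_i * inner (fun z => z ^+ i) (horner p))).
rewrite rmorph_sum /= [RHS](big_cat_nat _ pn)//= [X in _ + X]big_nat_cond [X in _ + X]big1.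
  rewrite addr0; apply: eq_bigr => i _; rewrite innerC ?inner_horner_exprn.
  - by rewrite mul_conjc.
  - exact: L2_horner.
  - exact: L2_exprn.
by move=> i /andP[/andP[pi _] _]; rewrite nth_default// normc0 expr0n.
Qed.

Section fourier_partial_sums.
Variable h : C -> C.
Hypothesis Lh : L2 h.

Let a n := inner h (fun z => z ^+ n).
Let S n := \poly_(i < n) a i.
Let A n := \sum_(0 <= i < n) normc (a i) ^+ 2.

Let inner_hS n m : (m < n)%N -> inner (fun z => h z - (S n).[z]) (fun z => z ^+ m) = 0.
Proof.
move=> mn; rewrite innerBl//; [|exact: L2_horner|exact: L2_exprn].
by rewrite inner_horner_exprn coef_poly mn subrr.
Qed.

(** Pythagoras: [h - S n] is orthogonal to [S n], so [A n] and the squared distance from [h] to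
    [S n] add up to [sqn h]. *)
Let bessel n : A n <= sqn h.
Proof.
have LS := L2_horner (S n); have LhS := L2B Lh LS.
suff -> : A n = sqn h - sqn (fun z => h z - (S n).[z]) by rewrite gerBl sqn_ge0.
have iS0 : inner (horner (S n)) (fun z => h z - (S n).[z]) = 0.
  rewrite inner_horner// big1// => i _; rewrite innerC//; last exact: L2_exprn.
  rewrite inner_hS ?conjC0 ?mulr0//.
  by rewrite (leq_trans (ltn_ord i))// size_poly.
have ihS : inner h (horner (S n)) = inner (horner (S n)) (horner (S n)).
  apply/eqP; rewrite -subr_eq0 -innerBl//.
  by rewrite innerC// iS0 conjC0.
have -> : A n = sqn (horner (S n)).
  rewrite (@sqn_horner _ n) ?size_poly//; apply: eq_big_nat => i /andP[_ ni].
  by rewrite coef_poly ni.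
apply: complexI; rewrite rmorphB /= -!inner_sqn.
rewrite (innerBl Lh LS LhS) iS0 subr0 (innerBr Lh Lh LS).
by rewrite opprB addrC subrK ihS.
Qed.

Let sqn_SB n m : (n <= m)%N ->
  sqn (fun z => (S m).[z] - (S n).[z]) = A m - A n.
Proof.
move=> nm; have -> : (fun z => (S m).[z] - (S n).[z]) = horner (S m - S n).
  by apply/funext => z; rewrite hornerD hornerN.
rewrite (@sqn_horner _ m); last first.
  by rewrite (leq_trans (size_polyD _ _))// size_polyN geq_max !(leq_trans (size_poly _ _)).
rewrite /A !(@big_cat_nat _ _ _ n 0 m)// [RHS]addrAC subrr add0r.
rewrite [X in X + _ = _]big_nat_cond [X in X + _ = _]big1 => [|i].
  rewrite add0r; apply: eq_big_nat => i /andP[ni im].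
  by rewrite coefB !coef_poly im ltnNge ni subr0.
move=> /andP[/andP[_ ni] _].
by rewrite coefB !coef_poly ni (leq_trans ni) // subrr normc0 expr0n.
Qed.

(** The projection is the limit of the Fourier sums. Bessel bounds the monotone sequence [A], and
    passing to indices where [A] is close to its supremum produces the geometric rate that
    [riesz_fischer] asks for. *)
Lemma H2_projection_exists : exists u, H2 u /\
  forall k, H2 k -> inner (fun z => h z - u z) k = 0.
Proof.
pose l := sup (range A).
have ubA : has_ubound (range A) by exists (sqn h) => _ [n _ <-]; exact: bessel.
have supA : has_sup (range A) by split => //; exists (A 0%N), 0%N.
have Al n : A n <= l by apply: ub_le_sup => //; exists n.
(* The extra condition [k < N k] ensures that each frequency [m] belongs to all sufficiently late
   sums, whence the orthogonality of [h - u] to [z ^+ m] in the limit. *)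
have /choice[N hN'] : forall k : nat, exists n,
    (k < n)%N /\ l - (2^-1 ^+ k) ^+ 2 < A n.
  move=> k; have e0 : 0 < ((2^-1 : R) ^+ k) ^+ 2 by rewrite !exprn_gt0.
  have [_ [n _ <-] nl] := sup_adherent e0 supA.
  exists (maxn n k.+1); split; first exact: leq_maxr.
  rewrite (lt_le_trans nl)// -subr_ge0 -sqn_SB ?leq_maxl//.
  exact: sqn_ge0.
have hN (k : nat) := (hN' k).2.
pose v (k : nat) := horner (S (N k)).
have Lv (k : nat) : L2 (v k) by exact: L2_horner.
have cauchy (j k : nat) : (k <= j)%N -> sqn (fun z => v j z - v k z) <= (2^-1 ^+ k) ^+ 2.
  move=> kj; have ejk : (2^-1 ^+ j) ^+ 2 <= (2^-1 ^+ k) ^+ 2 :> R.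
    by rewrite lerXn2r ?nnegrE ?exprn_ge0// ler_wiXn2l// invf_le1 ?ler1n.
  have := Al (N j); have := Al (N k); have := hN j; have := hN k.
  have [Nle|/ltnW Nle] := leqP (N k) (N j).
    by rewrite (sqn_SB Nle); lra.
  by rewrite sqnBC (sqn_SB Nle); lra.
have [u [Lu uv]] := riesz_fischer Lv cauchy.
have small eps : 0 < eps -> exists K, forall k : nat, (K <= k)%N ->
    sqn (fun z => u z - v k z) < eps.
  move=> e0; have q1 : `|(2^-1 : R) ^+ 2| < 1.
    by rewrite ger0_norm ?exprn_ge0// expr2 -invfM invf_lt1// -natrM ltr1n.
  have := cvg_expr q1 => /cvgrPdist_lt /(_ _ e0)[K _ hK].
  exists K => k Kk; apply: le_lt_trans (uv k) _.
  have := hK k Kk; rewrite sub0r normrN ger0_norm ?exprn_ge0//.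
  by rewrite -!exprM mulnC.
have Hu : H2 u.
  apply: H2_closed => // eps /small[K hK]; exists (v K); first exact: H2_horner.
  exact: hK.
exists u; split => // k Hk.
have Lhu := L2B Lh Lu.
rewrite innerC//; last exact: H2_L2.
rewrite (inner_H2_eq0 Lhu _ Hk) ?conjC0// => m.
rewrite innerC//; last exact: L2_exprn.
apply/eqP; rewrite conjC_eq0; apply/eqP.
apply: inner_closure_eq0 => //; first exact: L2_exprn.
move=> eps /small[K hK]; pose k' := maxn K m.
exists (fun z => h z - v k' z); split; first exact: L2B.
  rewrite [X in sqn X](_ : _ = fun z => v k' z - u z); last first.
    by apply/funext => z; ring.
  rewrite sqnBC; apply: hK; exact: leq_maxl.
by apply: inner_hS; apply: leq_ltn_trans (hN' k').1; exact: leq_maxr.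
Qed.

End fourier_partial_sums.
Lemma orth_H2_L2 h : orth_compl H2 h -> L2 h. Proof. by case. Qed.

Lemma H2_ae_unique u v : H2 u -> H2 v ->
  (forall k, H2 k -> inner (fun z => u z - v z) k = 0) -> ae_eq_circle u v.
Proof.
move=> Hu Hv uv; apply: sqnB_eq0; try exact: H2_L2.
have := uv _ (H2B Hu Hv); rewrite inner_sqn => /complexI.
exact.
Qed.

Lemma RplusP h : L2 h -> H2 (Rplus h) /\
  forall k, H2 k -> inner (fun z => h z - Rplus h z) k = 0.
Proof. by move=> Lh; exact: xgetPex (H2_projection_exists Lh). Qed.

Lemma Rplus_ae_eq h u : L2 h -> H2 u ->
  (forall k, H2 k -> inner (fun z => h z - u z) k = 0) ->
  ae_eq_circle (Rplus h) u.
Proof.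
move=> Lh Hu hu; have [HR hR] := RplusP Lh.
apply: H2_ae_unique => // k Hk; have Lk := H2_L2 Hk.
have [Lu LR] := (H2_L2 Hu, H2_L2 HR).
have := hu _ Hk; rewrite innerBl// => /eqP; rewrite subr_eq0 => /eqP hku.
have := hR _ Hk; rewrite innerBl// => /eqP; rewrite subr_eq0 => /eqP hkR.
by rewrite innerBl// -hku -hkR subrr.
Qed.

Lemma Rplus_H2 h : H2 h -> ae_eq_circle (Rplus h) h.
Proof.
move=> Hh; have Lh := H2_L2 Hh; apply: Rplus_ae_eq => // k Hk.
by rewrite innerBl ?subrr//; exact: H2_L2.
Qed.

(** What [Rplus] leaves over is itself a projection on the complement: the part removed from it lies
    in [H2] and is orthogonal to the complement. Uniqueness identifies it with [Rminus h]. *)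
Lemma RminusP h : L2 h -> orth_compl H2 (Rminus h) /\
  ae_eq_circle (Rminus h) (fun z => h z - Rplus h z).
Proof.
move=> Lh; have [HR hR] := RplusP Lh; have LR := H2_L2 HR.
have LhR := L2B Lh LR.
have exM : exists u, orth_compl H2 u /\ forall k, orth_compl H2 k ->
    inner (fun z => h z - u z) k = 0.
  exists (fun z => h z - Rplus h z); split => // k [Lk k0].
  under [X in inner X]eq_fun do rewrite opprB addrC subrK.
  by rewrite innerC// k0 ?conjC0.
have [orthM hM] : orth_compl H2 (Rminus h) /\ forall k, orth_compl H2 k ->
    inner (fun z => h z - Rminus h z) k = 0 := xgetPex (fun=> 0) exM.
split => //; have [LM M0] := orthM.
have orthD : orth_compl H2 (fun z => Rminus h z - (h z - Rplus h z)).
  split=> [|k Hk]; first exact: L2B.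
  by rewrite innerBl ?M0 ?hR ?subrr//; exact: H2_L2.
have [LD D0] := orthD.
apply: sqnB_eq0 => //.
have : inner (fun z => Rminus h z - (h z - Rplus h z))
    (fun z => Rminus h z - (h z - Rplus h z)) = 0.
  have e : (fun z => Rminus h z - (h z - Rplus h z)) =
      fun z => Rplus h z - (h z - Rminus h z) by apply/funext => z; ring.
  rewrite {1}e innerBl ?hM//; last exact: L2B.
  by rewrite innerC// D0 ?conjC0 ?subr0.
by rewrite inner_sqn => /complexI.
Qed.

Lemma Rminus_L2 h : L2 h -> L2 (Rminus h).
Proof. by move=> /RminusP[/orth_H2_L2]. Qed.

Lemma sub_Rminus_H2 h : L2 h -> H2 (fun z => h z - Rminus h z).
Proof.
move=> Lh; have [HR _] := RplusP Lh; have [_ aeM] := RminusP Lh.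
apply: H2_ae_eq HR _; first exact: L2B (Rminus_L2 Lh).
by apply: (aeS _ aeM) => t ->; rewrite opprB addrC subrK.
Qed.

Lemma inner_Rminus h k : L2 h -> orth_compl H2 k ->
  inner (Rminus h) k = inner h k.
Proof.
move=> Lh [Lk k0]; apply/eqP; rewrite eq_sym -subr_eq0 -innerBl//; last first.
  exact: Rminus_L2.
have Hd := sub_Rminus_H2 Lh.
by rewrite innerC ?k0 ?conjC0//; exact: H2_L2.
Qed.

(** [u] itself witnesses that the defining property of the adjoint can be met, and an element of
    [H2] is determined by its pairings with [H2]. *)
Lemma adjoint_H2_ae_eq (A : (C -> C) -> C -> C) k u : H2 u ->
  (forall h, H2 h -> inner (A h) k = inner h u) ->
  ae_eq_circle (adjoint H2 A k) u.
Proof.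
move=> Hu Au; have exA : exists v, H2 v /\ forall h, H2 h ->
    inner (A h) k = inner h v by exists u.
have [HA Ak] : H2 (adjoint H2 A k) /\ forall h, H2 h ->
    inner (A h) k = inner h (adjoint H2 A k) := xgetPex (fun=> 0) exA.
apply: H2_ae_unique => // h Hh.
have [Lh Lu LA] := And3 (H2_L2 Hh) (H2_L2 Hu) (H2_L2 HA).
rewrite innerC//; last exact: L2B.
by rewrite innerBr// -Ak// -Au// subrr conjC0.
Qed.

End projections.

(** * Lebesgue points and approximate identities *)

Section chords.
Context {R : realType}.
Local Notation C := R[i].
Implicit Types (t s y : R).

Definition chord t s : R := normc (expi t - expi s).

Lemma chordE t s : chord t s = 2 * `|sin ((t - s) / 2)|.
Proof.
apply: (@pexpIrn _ 2); rewrite ?nnegrE ?normc_ge0 ?mulr_ge0//.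
rewrite normc_sqr !(ReD, ImD, ReN, ImN) /= exprMn real_normK ?num_real//.
have -> : cos t = cos (t - s) * cos s - sin (t - s) * sin s.
  by rewrite -cosD subrK.
have -> : sin t = sin (t - s) * cos s + cos (t - s) * sin s.
  by rewrite -sinD subrK.
have e2 : t - s = (t - s) / 2 + (t - s) / 2 by field.
set x := (t - s) / 2 in e2 *; rewrite e2 cosD sinD.
have h1 := cos2Dsin2 s; have h2 := cos2Dsin2 x.
have h1' : cos s ^+ 2 = 1 - sin s ^+ 2 by rewrite -h1 addrK.
have h2' : cos x ^+ 2 = 1 - sin x ^+ 2 by rewrite -h2 addrK.
transitivity (((cos x ^+ 2 - sin x ^+ 2 - 1) ^+ 2 + 4 * cos x ^+ 2 * sin x ^+ 2)
  * (cos s ^+ 2 + sin s ^+ 2)); first by ring.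
by rewrite h1 h2'; ring.
Qed.

Lemma cos_antitone t s : 0 <= t -> t <= s -> s <= pi -> cos s <= cos t.
Proof.
move=> t0 ts sp; rewrite leNgt ltr_cos ?in_itv/= ?t0 ?sp ?(le_trans ts) ?(le_trans t0)//.
by rewrite -leNgt.
Qed.

Lemma sin_ge_mul_cos y : 0 <= y <= pi / 2 -> y * cos y <= sin y.
Proof.
move=> /andP[]; rewrite le_eqVlt => /predU1P[<-|y0] yp.
  by rewrite mul0r sin0.
have [c] := @MVT R sin cos 0 y y0 (fun x _ => is_derive_sin x)
  (continuous_subspaceT (fun x => @continuous_sin R x)).
rewrite in_itv /= => /andP[c0 cy]; rewrite sin0 !subr0 mulrC => ->.
have yp' : y <= pi by have := pi_ge0 R; lra.
by rewrite ler_pM2l// cos_antitone// ltW.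
Qed.

(** The mean value bound [y * cos y <= sin y] says nothing useful once [cos y] is negative. Applied
    to the half angle in [sin y = 2 sin (y / 2) cos (y / 2)], it gives a factor that stays positive
    up to [pi]. *)
Lemma sin_ge_mul_cos2 y : 0 <= y < pi -> y * cos (y / 2) ^+ 2 <= sin y.
Proof.
move=> /andP[y0 yp]; have y2 : 0 <= y / 2 <= pi / 2.
  by apply/andP; split; lra.
have c0 : 0 <= cos (y / 2).
  by apply: cos_ge0_pihalf; apply/andP; split; lra.
have e : y = y / 2 + y / 2 by field.
rewrite [in leRHS]e sinD.
have := ler_wpM2r c0 (sin_ge_mul_cos y2).
set x := cos (y / 2); set z := sin (y / 2) => h.
have -> : y * x ^+ 2 = 2 * (y / 2 * x * x) by field.
lra.
Qed.

Lemma chord_ge_dist t : 0 < t < 2 * pi -> exists2 c, 0 < c <= 1 &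
  forall s, 0 <= s <= 2 * pi -> c * `|t - s| <= chord t s.
Proof.
move=> /andP[t0 t2].
(* The largest value of [|t - s| / 2] for [s] in [[0, 2 * pi]]. It is below [pi] because [t] is
   interior; at an endpoint the opposite endpoint would be a second zero of the chord. *)
pose m := Num.max t (2 * pi - t) / 2.
have mp : m < pi by rewrite /m ltr_pdivrMr// gt_max; apply/andP; split; lra.
have m0 : 0 <= m by rewrite /m divr_ge0// le_max ltW.
have cm : 0 < cos (m / 2).
  by apply: cos_gt0_pihalf; apply/andP; split; lra.
exists (cos (m / 2) ^+ 2).
  by rewrite exprn_gt0//= expr_le1 ?ltW// cos_le1.
move=> s /andP[s0 s2]; rewrite chordE.
pose y := `|t - s| / 2.
have ym : y <= m.
  rewrite /y /m ler_pM2r ?invr_gt0// le_max.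
  by apply/orP; have [h|h] := ger0P (t - s); [left|right]; lra.
have y0 : 0 <= y by rewrite divr_ge0.
have yp : 0 <= y < pi by rewrite y0 (le_lt_trans ym).
have -> : `|sin ((t - s) / 2)| = sin y.
  have siny : 0 <= sin y by apply: sin_ge0_pi; rewrite y0 ltW// (le_lt_trans ym).
  rewrite /y in siny *; have [h|h] := leP 0 (t - s).
    by rewrite (ger0_norm h) in siny *; rewrite ger0_norm.
  rewrite (ltr0_norm h) mulNr sinN in siny *.
  by rewrite ler0_norm// -oppr_ge0.
have h := sin_ge_mul_cos2 yp.
have : cos (m / 2) ^+ 2 * y <= sin y.
  apply: le_trans h; rewrite mulrC ler_wpM2l//.
  rewrite lerXn2r ?nnegrE ?(ltW cm)//.
    by apply: cos_ge0_pihalf; apply/andP; split; lra.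
  by apply: cos_antitone; lra.
by rewrite {1}/y; lra.
Qed.

End chords.

Section lebesgue_points.
Context {R : realType}.
Local Notation C := R[i].
Local Notation T := (measurableTypeR R).
Local Notation mu := (@circle R).
Local Notation leb := (@lebesgue_measure R).
Implicit Types (a phi G : R -> R) (theta t r : R).

Lemma ae_leb_circle (P : R -> Prop) :
  {ae leb, forall t, P t} -> {ae mu, forall t, P t}.
Proof.
move=> [A [mA A0 PA]]; exists A; split => //.
have /null_content_dominatesP := dominates_uniform_prob (two_pi_gt0 R).
exact.
Qed.

Lemma ae_circle_neq t0 : {ae mu, forall t, t != t0}.
Proof.
apply: ae_leb_circle; exists [set t0]; split => //.
- exact: lebesgue_measure_set1.
- by move=> t /= /negP/negPn/eqP.
Qed.

Lemma ae_circle_itv : {ae mu, forall t, 0 < t < 2 * pi}.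
Proof.
have ae_cc : {ae mu, forall t, 0 <= t <= 2 * pi}.
  exists (~` `[0, 2 * pi]%classic : set T); split.
  - by apply: measurableC; exact: measurable_itv.
  - rewrite /circle /= /uniform_prob integral_uniform_pdf.
    by rewrite setICl integral_set0.
  - by move=> t /= tN; rewrite in_itv.
apply: (aeS3 _ ae_cc (ae_circle_neq 0) (ae_circle_neq (2 * pi))) => t.
by move=> /andP[t0 t2] tn0 tn2; rewrite !lt_def t0 t2 tn0 eq_sym tn2.
Qed.

Definition near_point theta r : R -> R := \1_[set t | `|t - theta| < r].

(** Meant for a [phi] that measures the distance to a value at [theta]: its integral over the points
    within [r] of [theta] is o(r). *)
Definition lebesgue_point phi theta := forall delta, 0 < delta ->
  exists2 r0, 0 < r0 & forall r, 0 < r < r0 ->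
    rint (fun t => near_point theta r t * phi t) <= delta * r.

Lemma rmeasurable_indic (A : set R) : measurable (A : set T) -> rmeasurable \1_A.
Proof. by move=> mA; exact: measurable_indic. Qed.

Lemma rmeasurable_near_point theta r : rmeasurable (near_point theta r).
Proof.
apply: rmeasurable_indic.
have -> : [set t | `|t - theta| < r] = ball theta r.
  by apply/seteqP; split=> t /=; rewrite /ball /= distrC.
exact: measurable_ball.
Qed.

Lemma near_point_01 theta r t : 0 <= near_point theta r t <= 1.
Proof. by rewrite /near_point indicE; case: (_ \in _); rewrite lexx ler01. Qed.

Lemma rintegrable_near_point theta r phi : rintegrable phi ->
  rintegrable (fun t => near_point theta r t * phi t).
Proof.
move=> iphi; apply: rintegrable_le (integrable_norm iphi) _.
  by apply: rmeasurableM; [exact: rmeasurable_near_point|exact: rmeasurable_rintegrable].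
move=> t; have /andP[n0 n1] := near_point_01 theta r t.
by rewrite normrM ger0_norm// ler_piMl.
Qed.

Lemma ae_lebesgue_point a : rintegrable a ->
  {ae mu, forall theta, lebesgue_point (fun t => `|a t - a theta|) theta}.
Proof.
move=> ia; pose A := `[0, 2 * pi]%classic : set R.
have ma := rmeasurable_rintegrable ia.
have pi0 := pi_gt0 R.
have mA : measurable (A : set T) by exact: measurable_itv.
have pi_circle (phi : R -> \bar R) : measurable_fun [set: T] phi ->
    (forall t, 0 <= phi t)%E ->
    (\int[leb]_(t in A) phi t = (2 * pi)%:E * \int[mu]_t phi t)%E.
  move=> mphi phi0; rewrite integral_uniform// muleA -EFinM subr0 divff ?mul1e//.
  by rewrite gt_eqF// mulr_gt0.
have iA : leb.-integrable A (EFin \o a).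
  have mEa : measurable_fun [set: T] (EFin \o a) by exact/measurable_EFinP.
  apply/integrableP; split; first exact: measurable_funTS.
  rewrite pi_circle//; last exact: measurableT_comp.
  by have /integrableP[_ fin_a] := ia; rewrite lte_mul_pinfty// lee_fin mulr_ge0// ltW.
have /lebesgue_differentiation/ae_leb_circle aeleb :=
  integrable_locally_restrict (measurable_itv _) iA.
apply: (aeS2 _ aeleb ae_circle_itv) => theta lpt /andP[th0 th2] delta d0.
have Ath : A theta by rewrite /A /= in_itv /= !ltW.
(* The ball has length [2 r] and [circle] is Lebesgue measure over [2 * pi], so an average of at
   most [delta * pi] becomes the bound [delta * r]. *)
have dp0 : 0 < delta * pi by rewrite mulr_gt0.
have := lpt => /fine_cvgP[fin_av /cvgrPdist_lt /(_ _ dp0) av_small].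
have [r0 /= r00 hr0] : \forall r \near (0 : R)^'+,
    (davg (a \_ A) theta r <= (delta * pi)%:E)%E.
  apply: filterS2 fin_av av_small => r fin_r.
  rewrite sub0r normrN /= ger0_norm ?fine_ge0 ?davg_ge0// => /ltW.
  by rewrite -lee_fin fineK.
exists r0 => // r /andP[rp rr0].
have := hr0 r; rewrite /= sub0r normrN gtr0_norm// => /(_ rr0 rp).
rewrite /davg /iavg lebesgue_measure_ball ?(ltW rp)//.
have r2 : 0 < r *+ 2 by rewrite mulrn_wgt0.
rewrite inver gt_eqF// lee_pdivrMl// => int_le.
pose phi t := near_point theta r t * `|a t - a theta|.
have phi0 t : 0 <= phi t.
  by have /andP[n0 _] := near_point_01 theta r t; rewrite mulr_ge0.
have iphi : rintegrable phi.
  apply: rintegrable_near_point; apply: integrable_norm.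
  by apply: rintegrableB => //; exact: rintegrable_cst.
have mphi : measurable_fun [set: T] (EFin \o phi) by exact: measurable_int iphi.
have int_phi : (\int[leb]_(t in A) (phi t)%:E <= (r *+ 2 * (delta * pi))%:E)%E.
  apply: le_trans int_le; rewrite integral_mkcond [leRHS]integral_mkcond.
  apply: ge0_le_integral => //.
  - by move=> t _; rewrite patchE; case: ifP => // _; rewrite lee_fin.
  - by apply: (measurable_restrictT _ mA).1; exact: (measurable_funTS mphi).
  - apply: (measurable_restrictT _ (measurable_ball theta r)).1.
    apply: measurable_funTS; apply: measurableT_comp => //; apply/measurable_EFinP.
    apply: measurable_funB => //; apply: (measurable_restrictT _ mA).1.
    exact: measurable_funTS.
  - move=> t _; rewrite !patchE; case: ifPn => [tA|tA]; last first.
      by case: ifPn => _; [exact: abse_ge0|exact: lexx].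
    case: ifPn => [tb|tb].
      rewrite /= /shift patchE tA (mem_set Ath) lee_fin /phi.
      by have /andP[_ n1] := near_point_01 theta r t; rewrite ler_piMl.
    rewrite /phi /near_point indicE memNset ?mul0r// => tr.
    by move/negP: tb; apply; rewrite inE /ball /= distrC.
have phi0E t : (0 <= (phi t)%:E)%E by rewrite lee_fin.
move: int_phi; rewrite (pi_circle _ mphi phi0E).
rewrite -[X in (_ * X)%E]fineK; last exact: (integrable_fin_num measurableT iphi).
rewrite -EFinM lee_fin -/(rint phi).
have -> : r *+ 2 * (delta * pi) = 2 * pi * (delta * r) by ring.
by rewrite ler_pM2l// mulr_gt0.
Qed.

(* Dyadic decomposition of the kernel: on [2^(k-1) eps <= |t - theta| < 2^k eps]
   the bound [B eps / |t - theta|^2] is at most [4 B / (4^k eps)]. *)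
Lemma dyadic_bound (B eps x g : R) n : 0 < B -> 0 < eps -> 0 <= x ->
  g <= B / eps -> g * x ^+ 2 <= B * eps ->
  g <= \sum_(0 <= k < n.+1) 4 * B / (4 ^+ k * eps) * (x < 2 ^+ k * eps)%R%:R
       + B / (4 ^+ n * eps).
Proof.
move=> B0 e0 x0 g1 g2.
have p4 k : 0 < 4 ^+ k * eps :> R by rewrite mulr_gt0// exprn_gt0.
have far k : 2 ^+ k * eps <= x -> g <= B / (4 ^+ k * eps).
  move=> kx; rewrite ler_pdivlMr//.
  have [g0|g0] := leP g 0.
    by rewrite (le_trans (mulr_le0_ge0 g0 (ltW (p4 k))))// ltW.
  rewrite -(ler_pM2r e0) (le_trans _ g2)//.
  rewrite -mulrA ler_pM2l// -mulrA -expr2.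
  have -> : 4 ^+ k * eps ^+ 2 = (2 ^+ k * eps) ^+ 2.
    by rewrite exprMn -exprM mulnC exprM; congr (_ ^+ _ * _); ring.
  by rewrite lerXn2r ?nnegrE// mulr_ge0 ?exprn_ge0// ltW.
have term0 k : 0 <= 4 * B / (4 ^+ k * eps) * (x < 2 ^+ k * eps)%R%:R.
  by rewrite mulr_ge0// divr_ge0 ?ltW// mulr_gt0.
have near m : x < 2 ^+ m * eps ->
    g <= \sum_(0 <= k < m.+1) 4 * B / (4 ^+ k * eps) * (x < 2 ^+ k * eps)%R%:R.
  elim: m => [|m IH] xm.
    rewrite big_nat1 xm mulr1 expr0 mul1r; apply: le_trans g1 _.
    by rewrite ler_pM2r ?invr_gt0//; lra.
  rewrite big_nat_recr//=; have [xm'|xm'] := ltP x (2 ^+ m * eps).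
    by rewrite (le_trans (IH xm'))// lerDl.
  rewrite (le_trans (far _ xm'))// xm mulr1.
  rewrite [leLHS](_ : _ = 4 * B / (4 ^+ m.+1 * eps)) ?lerDr ?sumr_ge0//.
  by rewrite exprS; field; rewrite !gt_eqF// exprn_gt0.
have [xn|xn] := ltP x (2 ^+ n * eps).
  by rewrite (le_trans (near _ xn))// lerDl divr_ge0// ltW.
by rewrite (le_trans (far _ xn))// lerDr sumr_ge0.
Qed.

End lebesgue_points.

Section approximate_identity.
Context {R : realType}.
Local Notation mu := (@circle R).
Implicit Types (phi G : R -> R) (theta B eps r : R).

Lemma rint_sum n (F : nat -> R -> R) : (forall k, rintegrable (F k)) ->
  rintegrable (fun t => \sum_(0 <= k < n) F k t) /\
  rint (fun t => \sum_(0 <= k < n) F k t) = \sum_(0 <= k < n) rint (F k).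
Proof.
move=> iF; elim: n => [|n [IH1 IH2]].
  have -> : (fun t => \sum_(0 <= k < 0) F k t) = (fun=> 0).
    by apply/funext => t; rewrite big_geq.
  by rewrite big_geq// rint_cst; split => //; exact: rintegrable_cst.
have -> : (fun t => \sum_(0 <= k < n.+1) F k t) =
    (fun t => \sum_(0 <= k < n) F k t + F n t).
  by apply/funext => t; rewrite big_nat_recr.
by rewrite big_nat_recr//= rintD// IH2; split => //; exact: rintegrableD.
Qed.

Lemma dyadic_scale r eps : 0 < eps -> eps < r ->
  exists n, 2 ^+ n * eps < r /\ r <= 2 ^+ n.+1 * eps.
Proof.
move=> e0 er.
have exn : exists n, r <= 2 ^+ n * eps.
  have /archi_boundP : 0 <= r / eps by rewrite divr_ge0 ?ltW// (lt_trans e0).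
  set n := Num.bound _ => rn; exists n; rewrite -ler_pdivrMr// (le_trans (ltW rn))//.
  by rewrite -natrX ler_nat ltnW// ltn_expl.
case: (ex_minnP exn) => -[|n].
  by rewrite expr0 mul1r leNgt er.
move=> rn min_n; exists n; split=> //; rewrite ltNge; apply/negP => /min_n.
by rewrite ltnn.
Qed.

(** The bounds on [G] are those of an approximate identity at scale [eps]. Dyadic shells within [r0]
    are controlled by the Lebesgue point, the rest by the total integral of [phi]. [eps0] is fixed
    before [G] because the kernels to which this applies vary with [eps]. *)
Lemma kernel_small phi theta B : rintegrable phi -> (forall t, 0 <= phi t) ->
  lebesgue_point phi theta -> 0 < B ->
  forall eta, 0 < eta -> exists2 eps0, 0 < eps0 & forall eps, 0 < eps < eps0 ->
  forall G, rmeasurable G -> (forall t, 0 <= G t) ->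
  {ae mu, forall t, G t <= B / eps} ->
  {ae mu, forall t, G t * (t - theta) ^+ 2 <= B * eps} ->
  rint (fun t => phi t * G t) <= eta.
Proof.
move=> iphi phi0 lp B0 eta eta0.
(* The shell of radius [2 ^+ k * eps] carries weight [4 B / (4 ^+ k * eps)], so this choice bounds
   its contribution by [eta / 4 * 2^-1 ^+ k], with sum at most [eta / 2]. *)
have [|r0 r00 small] := lp (eta / (16 * B)).
  by rewrite divr_gt0// mulr_gt0.
pose I := rint phi; have I0 : 0 <= I by exact: rint_ge0.
have I1 : 0 < I + 1 by rewrite ltr_wpDl.
(* Beyond the last shell the kernel is at most [B / (4 ^+ n * eps)], which is at most
   [4 B eps / r0 ^+ 2]; for [eps < e1] its product with [I] is at most [eta / 2]. *)
pose e1 := eta * r0 ^+ 2 / (8 * B * (I + 1)).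
have e10 : 0 < e1 by rewrite divr_gt0 ?mulr_gt0// exprn_gt0.
exists (Num.min r0 e1); first by rewrite lt_min r00.
move=> eps /andP[eps0]; rewrite lt_min => /andP[eps_r0 eps_e1] G mG G0 G1 G2.
have [n [n_lt n_ge]] := dyadic_scale eps0 eps_r0.
have p4 k : 0 < 4 ^+ k * eps :> R by rewrite mulr_gt0// exprn_gt0.
pose c k := 4 * B / (4 ^+ k * eps).
have c0 k : 0 < c k by rewrite divr_gt0// mulr_gt0.
pose d := B / (4 ^+ n * eps).
pose F k t := c k * (near_point theta (2 ^+ k * eps) t * phi t).
have iF k : rintegrable (F k) by apply: rintegrableZ; exact: rintegrable_near_point.
have [iS rS] := rint_sum n.+1 iF.
have idphi : rintegrable (fun t => d * phi t) by exact: rintegrableZ.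
have iG : rintegrable (fun t => phi t * G t).
  apply: (rintegrable_le_ae _ (rintegrableZ (B / eps) iphi)).
    by apply: rmeasurableM => //; exact: rmeasurable_rintegrable.
  apply: (aeS _ G1) => t Gt; rewrite ger0_norm ?mulr_ge0// mulrC.
  by rewrite ler_wpM2r.
have : rint (fun t => phi t * G t) <=
    rint (fun t => \sum_(0 <= k < n.+1) F k t + d * phi t).
  apply: rint_le_ae => //; first exact: rintegrableD.
  apply: (aeS2 _ G1 G2) => t G1t G2t.
  have := @dyadic_bound _ B eps `|t - theta| (G t) n B0 eps0 (normr_ge0 _) G1t.
  rewrite real_normK ?num_real// => /(_ G2t) bound.
  rewrite mulrC (le_trans (ler_wpM2r (phi0 t) bound))//.
  rewrite mulrDl mulr_suml lerD2r le_eqVlt; apply/orP; left; apply/eqP.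
  apply: eq_bigr => k _; rewrite /F /c mulrA; congr (_ * _ * _).
  rewrite /near_point indicE; congr ((nat_of_bool _)%:R).
  by apply/idP/idP; rewrite inE.
move=> /le_trans; apply.
rewrite rintD// rS rintZ// -/I.
have -> : eta = eta / 2 + eta / 2 by field.
apply: lerD.
  apply: (@le_trans _ _ (\sum_(0 <= k < n.+1) eta / 4 * 2^-1 ^+ k)).
    apply: ler_sum_nat => k /andP[_ kn].
    have kr : 0 < 2 ^+ k * eps < r0.
      rewrite mulr_gt0 ?exprn_gt0//=; apply: le_lt_trans n_lt.
      by rewrite ler_pM2r// ler_eXn2l// ltr1n.
    rewrite rintZ; last exact: rintegrable_near_point.
    apply: le_trans (ler_wpM2l (ltW (c0 k)) (small _ kr)) _.
    rewrite /c le_eqVlt; apply/orP; left; apply/eqP.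
    have -> : 4 ^+ k = 2 ^+ k * 2 ^+ k :> R by rewrite -exprMn; congr (_ ^+ _); ring.
    rewrite exprVn; have k2 : 2 ^+ k != 0 :> R by rewrite expf_neq0.
    by field; rewrite k2 !gt_eqF.
  rewrite -mulr_sumr; have := @sum_half_le2 R n.+1; set s := \sum_(_ <= _ < _) _.
  have -> : eta / 2 = eta / 4 * 2 by field.
  by move=> s2; rewrite ler_pM2l// divr_gt0.
have r_le : r0 ^+ 2 <= 4 * (4 ^+ n * eps) * eps.
  have -> : 4 * (4 ^+ n * eps) * eps = (2 ^+ n.+1 * eps) ^+ 2.
    have e4 : 4 ^+ n = (2 ^+ n) ^+ 2 :> R.
      by rewrite -exprM mulnC exprM; congr (_ ^+ _); ring.
    by rewrite e4 [2 ^+ n.+1]exprS; ring.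
  by rewrite lerXn2r ?nnegrE// ?ltW// mulr_gt0// exprn_gt0.
rewrite /d mulrAC ler_pdivrMr//.
have : eps * (8 * B * (I + 1)) <= eta * r0 ^+ 2.
  by rewrite -ler_pdivlMr ?mulr_gt0// ltW.
move=> h; have h2 : eps * (8 * B * (I + 1)) <= eta * (4 * (4 ^+ n * eps) * eps).
  by rewrite (le_trans h)// ler_pM2l.
have h3 : 8 * B * (I + 1) <= eta * (4 * (4 ^+ n * eps)).
  by rewrite -(ler_pM2l eps0) (le_trans h2)//; set u := 4 ^+ n; nra.
have BI : 0 <= B * I by rewrite mulr_ge0// ltW.
move: h3 BI B0; rewrite mulrDr mulr1; set u := 4 ^+ n; set v := u * eps; lra.
Qed.

End approximate_identity.

(** * The principal value integral *)

Section cauchy_kernel.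
Context {R : realType}.
Local Notation C := R[i].
Local Notation T := (measurableTypeR R).
Local Notation mu := (@circle R).
Implicit Types (theta t r eps : R) (v : R -> C) (u : C -> C) (n : nat).

Lemma geometric_le0 (y r M : R) : 0 <= r < 1 -> (forall n, y <= r ^+ n * M) ->
  y <= 0.
Proof.
move=> /andP[r0 r1] yM; rewrite leNgt; apply/negP => y0.
have M0 : 0 < M by rewrite (lt_le_trans y0)// -[M]mul1r -(expr0 r).
have nr : `|r| < 1 by rewrite ger0_norm.
have /cvgrPdist_lt /(_ (y / M)) [|n _ /(_ n (leqnn n))] := cvg_expr nr.
  by rewrite divr_gt0.
rewrite /= sub0r normrN ger0_norm ?exprn_ge0// ltr_pdivlMr//.
by rewrite ltNge yM.
Qed.

Lemma expi_sub_conj theta t : expi (theta - t) = (expi (t - theta))^* :> C.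
Proof. by rewrite -opprB expiN. Qed.

Lemma chord_norm theta t : chord theta t = normc (1 - expi (theta - t)).
Proof.
rewrite /chord (_ : expi theta = expi (theta - t) * expi t); last first.
  by rewrite -expiD subrK.
have -> : expi (theta - t) * expi t - expi t = (expi (theta - t) - 1) * expi t.
  by rewrite mulrBl mul1r.
by rewrite normcM normc_expi mulr1 normcB.
Qed.

Section fixed_angle.
Variable theta : R.

Let x t : C := expi (theta - t).

Let nx t : normc (x t) = 1. Proof. exact: normc_expi. Qed.

Let mx : cmeasurable x.
Proof.
apply: cmeasurable_expi; apply: rmeasurableB; first exact: rmeasurable_cst.
exact: rmeasurable_id.
Qed.

Lemma normc_sub_rexpi r t : 0 <= r -> 1 - r <= normc (1 - r%:C * x t).
Proof.
move=> r0; have := normc_leD (1 - r%:C * x t) (r%:C * x t).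
rewrite subrK normc1 normcM nx mulr1 normc_real ger0_norm//; lra.
Qed.

(** The Szego kernel of the disc at the point [r%:C * expi theta]: integration against it evaluates
    the analytic part of a function there. *)
Definition cauchy_ker r t : C := (1 - r%:C * x t)^-1.

Lemma cmeasurable_cauchy_ker r : cmeasurable (cauchy_ker r).
Proof.
apply: cmeasurableV; apply: cmeasurableB; first exact: cmeasurable_cst.
by apply: cmeasurableM => //; exact: cmeasurable_cst.
Qed.

Lemma normc_cauchy_ker r t : 0 <= r < 1 -> normc (cauchy_ker r t) <= (1 - r)^-1.
Proof.
move=> /andP[r0 r1]; rewrite normcV lef_pV2 ?posrE ?subr_gt0//.
  exact: normc_sub_rexpi.
by apply: lt_le_trans (normc_sub_rexpi t r0); rewrite subr_gt0.
Qed.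

Lemma one_sub_rexpi_neq0 r t : 0 <= r < 1 -> 1 - r%:C * x t != 0.
Proof.
move=> /andP[r0 r1]; rewrite -normc_gt0.
by apply: lt_le_trans (normc_sub_rexpi t r0); rewrite subr_gt0.
Qed.

(** The geometric series is unrolled rather than integrated term by term: each step drops a
    vanishing moment and gains a factor [r], while the remaining integral stays bounded. *)
Lemma cint_mul_cauchy_ker v r : 0 <= r < 1 -> cintegrable v ->
  (forall n, cint (fun t => v t * x t ^+ n) = 0) ->
  cint (fun t => v t * cauchy_ker r t) = 0.
Proof.
move=> r01 iv v0; have /andP[r0 r1] := r01; have mv := cintegrable_measurable iv.
have ivn := cintegrable_normc iv.
pose J n t := v t * x t ^+ n * cauchy_ker r t.
pose M := (1 - r)^-1 * rint (fun t => normc (v t)).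
have iM : rintegrable (fun t => (1 - r)^-1 * normc (v t)) by exact: rintegrableZ.
have mJ n : cmeasurable (J n).
  apply: cmeasurableM; last exact: cmeasurable_cauchy_ker.
  by apply: cmeasurableM => //; exact: cmeasurableX.
have leJ n t : normc (J n t) <= (1 - r)^-1 * normc (v t).
  rewrite /J !normcM normcX nx expr1n mulr1 mulrC.
  by rewrite ler_wpM2r ?normc_ge0// normc_cauchy_ker.
have iJ n : cintegrable (J n) by exact: cintegrable_le (mJ n) iM (leJ n).
have ivx n : cintegrable (fun t => v t * x t ^+ n).
  apply: cintegrable_le ivn _; first by apply: cmeasurableM => //; exact: cmeasurableX.
  by move=> t; rewrite normcM normcX nx expr1n mulr1.
have step n : cint (J n) = r%:C * cint (J n.+1).
  rewrite -cintZ// -[LHS]subr0 -(v0 n) -cintB//.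
  congr cint; apply/funext => t; rewrite /J exprSr /cauchy_ker.
  by have := one_sub_rexpi_neq0 t r01; move: (r%:C) (x t) => a b h; field.
have geo n : cint (J 0%N) = r%:C ^+ n * cint (J n).
  elim: n => [|n IH]; first by rewrite expr0 mul1r.
  by rewrite IH step exprSr mulrA.
suff -> : (fun t => v t * cauchy_ker r t) = J 0%N.
  apply/eqP; rewrite -normc_eq0 eq_le normc_ge0 andbT.
  apply: (@geometric_le0 _ r (2 * M) r01) => n.
  rewrite (geo n) normcM normcX normc_real ger0_norm//.
  rewrite ler_wpM2l ?exprn_ge0//.
  by apply: le_trans (normc_cint_le (mJ n) iM (leJ n)) _; rewrite rintZ.
by apply/funext => t; rewrite /J expr0 mulr1.
Qed.

Lemma cint_expi_sub n : (0 < n)%N -> cint (fun t => x t ^+ n) = 0.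
Proof.
move=> n0; have ie : cintegrable (fun t : R => (expi t ^+ n)^*).
  apply: cintegrable_le (rintegrable_cst 1) _ => [|t].
    by apply: cmeasurableJ; exact: cmeasurable_trace_exprn.
  by rewrite normc_conj normcX normc_expi expr1n.
have -> : (fun t => x t ^+ n) = fun t => expi theta ^+ n * (expi t ^+ n)^*.
  by apply/funext => t; rewrite /x expiD expiN exprMn conjX.
rewrite cintZ// cintJ ?cint_expi_eq0 ?conjC0 ?mulr0//.
apply: cintegrable_le (rintegrable_cst 1) _ => [|t].
  exact: cmeasurable_trace_exprn.
by rewrite normcX normc_expi expr1n.
Qed.

Lemma cintegrable_cauchy_ker r : 0 <= r < 1 -> cintegrable (cauchy_ker r).
Proof.
move=> r01; apply: cintegrable_le (rintegrable_cst (1 - r)^-1) _.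
  exact: cmeasurable_cauchy_ker.
by move=> t; exact: normc_cauchy_ker.
Qed.

Lemma cint_cauchy_ker r : 0 <= r < 1 -> cint (cauchy_ker r) = 1.
Proof.
move=> r01; have ix : cintegrable x.
  by apply: cintegrable_le (rintegrable_cst 1) _ => // t; rewrite nx.
have ixk : cintegrable (fun t => x t * cauchy_ker r t).
  apply: cintegrable_le (rintegrable_cst (1 - r)^-1) _ => [|t].
    by apply: cmeasurableM => //; exact: cmeasurable_cauchy_ker.
  by rewrite normcM nx mul1r; exact: normc_cauchy_ker.
have -> : cauchy_ker r = fun t => 1 + r%:C * (x t * cauchy_ker r t).
  apply/funext => t; rewrite /cauchy_ker.
  by have := one_sub_rexpi_neq0 t r01; move: (r%:C) (x t) => a b h; field.
rewrite cintD ?cintZ ?cint_cst//; [|exact: cintegrable_cst|exact: cintegrableZ].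
rewrite cint_mul_cauchy_ker ?mulr0 ?addr0// => n.
by under [X in cint X]eq_fun do rewrite -exprS; exact: cint_expi_sub.
Qed.

Definition pv_ker t : C := (1 - x t)^-1.

(** The map sending [x] to [(1 - x)^-1] carries the unit circle to the line of real part 1/2. This
    is the origin of the factor 1/2 in the principal value. *)
Lemma pv_ker_add_conj t : 1 - x t != 0 -> pv_ker t + (pv_ker t)^* = 1.
Proof.
move=> x1; rewrite /pv_ker conjV conjB conjC1.
have x1' : 1 - (x t)^* != 0 by rewrite -[1]conjC1 -conjB conjC_eq0.
have := mul_expi_conj (theta - t); rewrite -/(x t).
move: (x t) ((x t)^*) x1 x1' => a b ha hb ab.
have d : (1 - a) * (1 - b) = (1 - b) + (1 - a).
  rewrite [LHS](_ : _ = 1 - a - b + a * b); last by ring.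
  by rewrite ab; ring.
transitivity (((1 - b) + (1 - a)) / ((1 - a) * (1 - b))).
  by field; rewrite ha hb.
by rewrite -d divff// mulf_neq0.
Qed.

(** The difference is [(1 - r) x / ((1 - x) (1 - r x))]. Since [1 - r] is at most the modulus of
    [1 - r x], that of [1 - x] is at most twice as large, which yields the inverse square decay in
    the chord. *)
Lemma pv_ker_sub_cauchy_ker r t : 0 <= r < 1 -> 1 - x t != 0 ->
  normc (pv_ker t - cauchy_ker r t) * chord theta t ^+ 2 <= 2 * (1 - r).
Proof.
move=> r01 x1; have r1x := one_sub_rexpi_neq0 t r01; have /andP[r0 r1] := r01.
have -> : pv_ker t - cauchy_ker r t =
    (1 - r%:C) * x t / ((1 - x t) * (1 - r%:C * x t)).
  rewrite /pv_ker /cauchy_ker; move: (r%:C) (x t) r1x x1 => a b h1 h2.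
  by field; rewrite h1.
have d0 : 0 < normc (1 - x t) by rewrite normc_gt0.
have e0 : 0 < normc (1 - r%:C * x t) by rewrite normc_gt0.
rewrite chord_norm -/(x t) normcM normcV !normcM nx mulr1.
have n1r : normc (1 - r%:C) = 1 - r.
  by rewrite -[1]/(1%:C) -raddfB normc_real ger0_norm ?subr_ge0 ?ltW.
have tri : normc (1 - x t) <= 2 * normc (1 - r%:C * x t).
  have := normc_leD (1 - r%:C * x t) ((r%:C - 1) * x t).
  have -> : 1 - r%:C * x t + (r%:C - 1) * x t = 1 - x t by ring.
  rewrite normcM nx mulr1 [normc (r%:C - 1)]normcB n1r.
  have := normc_sub_rexpi t r0; lra.
rewrite n1r; have -> : (1 - r) / (normc (1 - x t) * normc (1 - r%:C * x t)) * normc (1 - x t) ^+ 2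
    = (1 - r) * normc (1 - x t) / normc (1 - r%:C * x t).
  by field; rewrite !gt_eqF.
by rewrite ler_pdivrMr// [2 * _]mulrC -mulrA ler_wpM2l// subr_ge0 ltW.
Qed.

End fixed_angle.
End cauchy_kernel.

Section principal_value.
Context {R : realType}.
Local Notation C := R[i].
Local Notation T := (measurableTypeR R).
Local Notation mu := (@circle R).
Local Notation leb := (@lebesgue_measure R).
Implicit Types (theta t r eps eta M : R) (v w : R -> C) (u : C -> C) (q : C).

Lemma cintegrable_mul_bounded v w M : cintegrable v -> cmeasurable w ->
  (forall t, normc (w t) <= M) -> cintegrable (fun t => v t * w t).
Proof.
move=> iv mw wM; have mv := cintegrable_measurable iv.
apply: cintegrable_le (rintegrableZ M (cintegrable_normc iv)) _.
  exact: cmeasurableM.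
by move=> t; rewrite normcM mulrC ler_wpM2r// normc_ge0.
Qed.

Definition far_set theta eps : set R := [set t | eps < chord theta t].

Lemma measurable_far_set theta eps : measurable (far_set theta eps : set T).
Proof.
have mc : rmeasurable (chord theta).
  apply: rmeasurable_normc; apply: cmeasurableB; first exact: cmeasurable_cst.
  exact: cmeasurable_expi rmeasurable_id.
rewrite (_ : far_set _ _ = [set: T] `&` chord theta @^-1` `]eps, +oo[).
  by apply: mc => //; exact: measurable_itv.
by apply/seteqP; split=> t /=; rewrite in_itv/= andbT => // -[].
Qed.

Definition trunc_ker theta eps t : C :=
  (\1_(far_set theta eps) t)%:C * pv_ker theta t.

Lemma far_set01 theta eps t : 0 <= (\1_(far_set theta eps) t : R) <= 1.
Proof. by rewrite indicE; case: (_ \in _); rewrite lexx ler01. Qed.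

Lemma rintegrable_far_set theta eps : rintegrable \1_(far_set theta eps).
Proof.
apply: rintegrable_le (rintegrable_cst 1) _ => [|t].
  exact: rmeasurable_indic (measurable_far_set _ _).
by have /andP[h0 h1] := far_set01 theta eps t; rewrite ger0_norm.
Qed.

Lemma cmeasurable_pv_ker theta : cmeasurable (pv_ker theta).
Proof.
apply: cmeasurableV; apply: cmeasurableB; first exact: cmeasurable_cst.
apply: cmeasurable_expi; apply: rmeasurableB; first exact: rmeasurable_cst.
exact: rmeasurable_id.
Qed.

Lemma cmeasurable_trunc_ker theta eps : cmeasurable (trunc_ker theta eps).
Proof.
apply: cmeasurableM; last exact: cmeasurable_pv_ker.
by apply: cmeasurable_real; exact: rmeasurable_indic (measurable_far_set _ _).
Qed.

Lemma trunc_kerE theta eps t :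
  trunc_ker theta eps t = if eps < chord theta t then pv_ker theta t else 0.
Proof.
rewrite /trunc_ker indicE; case: ifPn => h.
  by rewrite mem_set ?mul1r.
by rewrite memNset ?mul0r//; exact/negP.
Qed.

Lemma normc_trunc_ker theta eps t : 0 < eps ->
  normc (trunc_ker theta eps t) <= eps^-1.
Proof.
move=> e0; rewrite trunc_kerE; case: ifPn => [h|_]; last first.
  by rewrite normc0 invr_ge0 ltW.
rewrite normcV -chord_norm lef_pV2 ?posrE ?(ltW h)//.
exact: lt_trans h.
Qed.

Lemma one_sub_expi_neq0 theta t eps : 0 <= eps -> eps < chord theta t ->
  1 - expi (theta - t) != 0 :> C.
Proof. by move=> e0 h; rewrite -normc_gt0 -chord_norm (le_lt_trans e0). Qed.

Lemma cintegrable_trunc_ker theta eps : 0 < eps ->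
  cintegrable (trunc_ker theta eps).
Proof.
move=> e0; apply: cintegrable_le (rintegrable_cst eps^-1) _.
  exact: cmeasurable_trunc_ker.
by move=> t; exact: normc_trunc_ker.
Qed.

Lemma expi_shift_2pi t : expi (t - 2 * pi) = expi t :> C.
Proof. by rewrite -[in RHS](subrK (2 * pi) t) expi_2pi. Qed.

Lemma real_complex_half (a : R) : (a / 2)%:C = a%:C / 2 :> C.
Proof. by rewrite rmorphM fmorphV rmorph_nat. Qed.

(* The truncated kernel is conjugated by the reflection [t -> 2 theta - t], and
   the sum of the kernel and its conjugate is 1. *)
Lemma cint_trunc_ker theta eps : 0 < theta < 2 * pi -> 0 < eps ->
  cint (trunc_ker theta eps) = (rint \1_(far_set theta eps) / 2)%:C.
Proof.
move=> /andP[th0 th2] e0.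
have iK := cintegrable_trunc_ker theta e0.
(* Twice [theta], taken modulo [2 * pi] into the range that [cint_reflection] accepts. *)
pose c := if theta <= pi then theta + theta else theta + theta - 2 * pi.
have c02 : (0 <= c) && (c <= 2 * pi).
  by rewrite /c; case: ifPn => [h|]; rewrite -?ltNge => *; apply/andP; split; lra.
have refl_expi t : expi (theta - (c - t)) = expi (t - theta) :> C.
  rewrite /c; case: ifP => _; first by congr expi; ring.
  by rewrite -[RHS]expi_2pi; congr expi; ring.
have conjK t : trunc_ker theta eps (c - t) = (trunc_ker theta eps t)^*.
  rewrite !trunc_kerE !chord_norm /pv_ker refl_expi expi_sub_conj.
  rewrite -[1 in LHS]conjC1 -conjB normc_conj -conjV.
  by case: ifP => _; rewrite ?conjC0.
have perK t : trunc_ker theta eps (t + 2 * pi) = trunc_ker theta eps t.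
  have e : expi (theta - (t + 2 * pi)) = expi (theta - t) :> C.
    by rewrite opprD addrA expi_shift_2pi.
  by rewrite !trunc_kerE !chord_norm /pv_ker e.
have realK : (cint (trunc_ker theta eps))^* = cint (trunc_ker theta eps).
  rewrite -cintJ// -[RHS](cint_reflection (cintegrable_measurable iK) perK c02).
  by congr cint; apply/funext => t; rewrite conjK.
have : cint (trunc_ker theta eps) + (cint (trunc_ker theta eps))^* =
    (rint \1_(far_set theta eps))%:C.
  rewrite -cintJ// -cintD//; last exact: cintegrableJ.
  transitivity (cint (fun t => (\1_(far_set theta eps) t)%:C)); last first.
    by apply: complex_ext => //=; rewrite -/(rint _) rint_cst.
  congr cint; apply/funext => t; rewrite trunc_kerE indicE.
  case: ifPn => h; last by rewrite memNset ?conjC0 ?addr0//; exact/negP.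
  rewrite mem_set// pv_ker_add_conj//.
  exact: one_sub_expi_neq0 (ltW e0) h.
rewrite realK => h; rewrite real_complex_half -h -mulr2n.
by rewrite -[cint _ *+ 2]mulr_natr mulfK// pnatr_eq0.
Qed.

Lemma rint_near_point theta r : 0 < r -> rint (near_point theta r) <= r / pi.
Proof.
move=> r0; have pi0 := pi_gt0 R.
have mb : measurable ([set t | `|t - theta| < r] : set T).
  rewrite (_ : [set t | _] = ball theta r); first exact: measurable_ball.
  by apply/seteqP; split=> t /=; rewrite /ball /= distrC.
have i1 : rintegrable (near_point theta r).
  have := rintegrable_near_point theta r (rintegrable_cst 1).
  by under [X in rintegrable X -> _]eq_fun do rewrite mulr1.
rewrite -lee_fin EFin_rint//.
have nn t : (0 <= (near_point theta r t)%:E)%E.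
  by rewrite lee_fin; have /andP[] := near_point_01 theta r t.
rewrite (integral_uniform _ (measurable_int _ i1) nn).
rewrite subr0 integral_indic//.
apply: (@le_trans _ _ ((2 * pi)^-1%:E * leb (ball theta r))%E).
  rewrite lee_pmul2l//; last by rewrite lte_fin invr_gt0 mulr_gt0.
  apply: le_measure; rewrite ?inE//.
  - by apply: measurableI => //; exact: measurable_itv.
  - exact: measurable_ball.
  - by move=> t [/= h _]; rewrite /ball /= distrC.
rewrite lebesgue_measure_ball ?(ltW r0)// -EFinM lee_fin.
have pin0 : pi != 0 :> R by rewrite gt_eqF.
rewrite le_eqVlt; apply/orP; left; apply/eqP.
by move: (@pi R) pin0 => p pin0; field.
Qed.

Lemma rint_far_set theta : 0 < theta < 2 * pi -> forall eta, 0 < eta ->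
  exists2 eps0, 0 < eps0 & forall eps, 0 < eps < eps0 ->
    `|rint \1_(far_set theta eps) - 1| <= eta.
Proof.
move=> th eta eta0; have pi0 := pi_gt0 R.
have [c /andP[c0 c1] hc] := chord_ge_dist th.
exists (c * eta * pi / 2); first by rewrite divr_gt0// !mulr_gt0.
move=> eps /andP[e0 eps_lt].
have iF := rintegrable_far_set theta eps.
have le1 : rint \1_(far_set theta eps) <= 1.
  rewrite -[leRHS](@rint_cst R 1); apply: (rint_le iF (rintegrable_cst 1)) => t.
  by have /andP[] := far_set01 theta eps t.
rewrite ler0_norm ?subr_le0// opprB lerBlDr -lerBlDl.
(* A chord of at most [eps] forces a distance of at most [eps / c]; the factor 2 makes the
   inequality strict, and the bound on [eps] gives [r / pi <= eta]. *)
pose r := 2 * eps / c; have r0 : 0 < r by rewrite divr_gt0// mulr_gt0.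
have i1 : rintegrable (near_point theta r).
  have := rintegrable_near_point theta r (rintegrable_cst 1).
  by under [X in rintegrable X -> _]eq_fun do rewrite mulr1.
have h1 : 1 - rint (near_point theta r) <= rint \1_(far_set theta eps).
  rewrite -[X in X - _](@rint_cst R 1) -rintB//; last exact: rintegrable_cst.
  apply: rint_le_ae => //; first by apply: rintegrableB => //; exact: rintegrable_cst.
  apply: (aeS _ ae_circle_itv) => t /andP[t0 t2].
  rewrite /near_point !indicE; have [h|h] := ltP eps (chord theta t).
    by rewrite (mem_set (h : far_set theta eps t)) gerBl ler0n.
  suff h2 : `|t - theta| < r.
    by rewrite (mem_set (h2 : [set s | `|s - theta| < r] t)) subrr ler0n.
  rewrite distrC -(ltr_pM2l c0); apply: le_lt_trans (hc t _) _.
    by rewrite !ltW.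
  by apply: le_lt_trans h _; rewrite /r mulrC divfK ?gt_eqF//; lra.
apply: le_trans h1; rewrite lerD2l lerN2; apply: le_trans (rint_near_point theta r0) _.
rewrite ler_pdivrMr// /r ler_pdivrMr//; lra.
Qed.

(* [trace u] is orthogonal to [Q r], so [Q (1 - eps)] may be subtracted from the
   truncated kernel; what remains is an approximate identity of mass [1/2 - q]. *)
Lemma pv_trunc_estimate theta u (Q : R -> R -> C) q : 0 < theta < 2 * pi ->
  cintegrable (trace u) ->
  lebesgue_point (fun t => normc (trace u t - trace u theta)) theta ->
  (forall r, 0 <= r < 1 -> [/\ cmeasurable (Q r),
    forall t, normc (Q r t) <= (1 - r)^-1,
    forall t, 1 - expi (theta - t) != 0 ->
      normc (pv_ker theta t - Q r t) * chord theta t ^+ 2 <= 2 * (1 - r),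
    cint (fun t => trace u t * Q r t) = 0 & cint (Q r) = q]) ->
  forall eta, 0 < eta -> exists2 eps0, 0 < eps0 & forall eps, 0 < eps < eps0 ->
    normc (cint (fun t => trace u t * trunc_ker theta eps t) -
           trace u theta * (2^-1 - q)) <= eta.
Proof.
move=> th iu lp hQ eta eta0.
have [c /andP[c0 c1] hc] := chord_ge_dist th.
have c2 : 0 < c ^+ 2 by rewrite exprn_gt0.
(* The numerator serves both kernel bounds, [2 / eps] near [theta] and [2 * eps] over the squared
   chord away from it; [c ^+ 2] converts the squared chord into a squared distance. *)
pose B := 2 / c ^+ 2; have B0 : 0 < B by rewrite divr_gt0.
have B2 : 2 <= B by rewrite ler_pdivlMr// ler_piMr// expr_le1// ltW.
pose phi t := normc (trace u t - trace u theta).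
have iut : cintegrable (fun t => trace u t - trace u theta).
  by apply: cintegrableB => //; exact: cintegrable_cst.
have iphi : rintegrable phi by exact: cintegrable_normc.
have eta4 : 0 < eta / 4 by rewrite divr_gt0.
have [e1 e10 small] := kernel_small iphi (fun t => normc_ge0 _) lp B0 eta4.
pose a := normc (trace u theta); have a0 : 0 <= a by exact: normc_ge0.
have a1 : 0 < a + 1 by rewrite ltr_wpDl.
have [|e2 e20 far] := rint_far_set th (eta := eta / (a + 1)); first by rewrite divr_gt0.
exists (Num.min 1 (Num.min e1 e2)); first by rewrite !lt_min ltr01 e10.
move=> eps /andP[e0]; rewrite !lt_min => /and3P[eps1 eps_e1 eps_e2].
have r01 : 0 <= 1 - eps < 1 by rewrite subr_ge0 ltW//= gtrBl.
have := hQ _ r01; rewrite subKr; set Qe := Q _.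
move=> [mQ leQ farQ uQ0 Qq].
have mK := cmeasurable_trunc_ker theta eps.
have mKQ : cmeasurable (fun t => trunc_ker theta eps t - Qe t) by exact: cmeasurableB.
have leKQ t : normc (trunc_ker theta eps t - Qe t) <= eps^-1 + eps^-1.
  by apply: le_trans (normc_leB _ _) _; rewrite lerD ?normc_trunc_ker.
have iQ : cintegrable Qe by apply: cintegrable_le (rintegrable_cst eps^-1) leQ.
have iK := cintegrable_trunc_ker theta e0.
have iuK := cintegrable_mul_bounded iu mK (fun t => normc_trunc_ker theta t e0).
have iuQ := cintegrable_mul_bounded iu mQ leQ.
have iKQ := cintegrable_mul_bounded iut mKQ leKQ.
have -> : cint (fun t => trace u t * trunc_ker theta eps t) -
    trace u theta * (2^-1 - q) =
    cint (fun t => (trace u t - trace u theta) * (trunc_ker theta eps t - Qe t)) +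
    trace u theta * (((rint \1_(far_set theta eps) - 1) / 2)%:C).
  rewrite -[X in X - _]subr0 -uQ0 -cintB//.
  have -> : (fun t => trace u t * trunc_ker theta eps t - trace u t * Qe t) =
    fun t => (trace u t - trace u theta) * (trunc_ker theta eps t - Qe t) +
      trace u theta * (trunc_ker theta eps t - Qe t).
    by apply/funext => t; ring.
  rewrite cintD//; last by apply: cintegrableZ; exact: cintegrableB.
  rewrite cintZ; last exact: cintegrableB.
  rewrite cintB// Qq cint_trunc_ker//.
  have -> : ((rint \1_(far_set theta eps) - 1) / 2)%:C =
      (rint \1_(far_set theta eps) / 2)%:C - 2^-1 :> C.
    rewrite mulrBl mul1r rmorphB /=; congr (_ - _).
    by rewrite -[2^-1]mul1r real_complex_half mul1r.
  by ring.
apply: le_trans (normc_leD _ _) _.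
have -> : eta = eta / 2 + eta / 2 by field.
apply: lerD; last first.
  rewrite normcM normc_real normrM [`|2^-1|]ger0_norm// -/a mulrA.
  rewrite ler_pM2r ?invr_gt0//.
  have := far eps; rewrite e0 eps_e2 => /(_ isT); rewrite ler_pdivlMr// => h.
  apply: le_trans h; rewrite mulrC ler_wpM2l ?normr_ge0//; lra.
apply: le_trans (normc_cint iKQ) _.
have -> : eta / 2 = 2 * (eta / 4) by field.
rewrite ler_pM2l//; under [X in rint X]eq_fun do rewrite normcM.
apply: (small eps); first by rewrite e0.
- exact: rmeasurable_normc.
- by move=> t; exact: normc_ge0.
- apply: aeW => t; apply: le_trans (leKQ t) _.
  by rewrite -mulr2n -mulr_natl ler_pM2r// invr_gt0.
apply: (aeS _ ae_circle_itv) => t /andP[t0 t2].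
have ct : c * `|theta - t| <= chord theta t by apply: hc; rewrite !ltW.
have ct2 : c ^+ 2 * (t - theta) ^+ 2 <= chord theta t ^+ 2.
  rewrite -exprMn -[leLHS]real_normK ?num_real// normrM gtr0_norm// distrC.
  by rewrite lerXn2r ?nnegrE ?normc_ge0 ?mulr_ge0// ltW.
rewrite /B mulrAC ler_pdivlMr// -mulrA [_ * c ^+ 2]mulrC.
apply: le_trans (ler_wpM2l (normc_ge0 _) ct2) _.
rewrite trunc_kerE; case: ifPn => [h|].
  exact: (farQ t (one_sub_expi_neq0 (ltW e0) h)).
(* Inside the removed arc only [Qe] is left; its size [eps^-1] is compensated by a squared chord of
   at most [eps ^+ 2]. *)
rewrite -leNgt sub0r normcN => h.
have h2 : chord theta t ^+ 2 <= eps ^+ 2.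
  by rewrite lerXn2r ?nnegrE ?normc_ge0// ltW.
apply: le_trans (ler_pM (normc_ge0 _) (sqr_ge0 _) (leQ t) h2) _.
rewrite expr2 mulrA mulVf ?gt_eqF// mul1r; lra.
Qed.

End principal_value.

(** * Almost everywhere limits of the truncated integrals *)

Section singular_integral.
Context {R : realType}.
Local Notation C := R[i].
Local Notation mu := (@circle R).
Implicit Types (theta t r eps eta : R) (u h g f : C -> C) (n m : nat) (l : C).

Lemma ae_lebesgue_point_trace u : cintegrable (trace u) -> {ae mu, forall theta,
  lebesgue_point (fun t => normc (trace u t - trace u theta)) theta}.
Proof.
move=> iu; have [iu1 iu2] := iu.
apply: (aeS2 _ (ae_lebesgue_point iu1) (ae_lebesgue_point iu2)) => theta.
move=> lp1 lp2 delta d0; have d2 : 0 < delta / 2 by rewrite divr_gt0.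
have [[r1 r10 h1] [r2 r20 h2]] := (lp1 _ d2, lp2 _ d2).
exists (Num.min r1 r2); first by rewrite lt_min r10.
move=> r /andP[r0]; rewrite lt_min => /andP[rr1 rr2].
have iuB : cintegrable (fun t => trace u t - trace u theta).
  by apply: cintegrableB => //; exact: cintegrable_cst.
have i1 : rintegrable (fun t => near_point theta r t *
    `|complex.Re (trace u t) - complex.Re (trace u theta)|).
  apply: rintegrable_near_point; apply: integrable_norm.
  by apply: rintegrableB => //; exact: rintegrable_cst.
have i2 : rintegrable (fun t => near_point theta r t *
    `|complex.Im (trace u t) - complex.Im (trace u theta)|).
  apply: rintegrable_near_point; apply: integrable_norm.
  by apply: rintegrableB => //; exact: rintegrable_cst.
have -> : delta * r = delta / 2 * r + delta / 2 * r by field.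
apply: le_trans (lerD (h1 r _) (h2 r _)); rewrite ?r0//.
rewrite -rintD//; apply: rint_le; last 1 first.
- move=> t; have /andP[n0 _] := near_point_01 theta r t.
  rewrite -mulrDr ler_wpM2l//.
  by apply: le_trans (normc_le_ReIm _) _; rewrite ReD ImD ReN ImN.
- by apply: rintegrable_near_point; exact: cintegrable_normc.
- exact: rintegrableD.
Qed.

Definition pv_cvg u theta l := forall eta, 0 < eta ->
  exists2 eps0, 0 < eps0 & forall eps, 0 < eps < eps0 ->
    normc (cint (fun t => trace u t * trunc_ker theta eps t) - l) <= eta.

Lemma cint_trace_expi_sub u theta n : L2 u ->
  cint (fun t => trace u t * expi (theta - t) ^+ n) =
  expi theta ^+ n * inner u (fun z => z ^+ n).
Proof.
move=> Lu; rewrite -cintZ; last exact: (inner_integrable Lu (L2_exprn n)).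
by congr cint; apply/funext => t; rewrite expiD expiN exprMn conjX mulrCA.
Qed.

(** The Szego kernel pairs [u] with the nonnegative frequencies, all absent from [u], and has mass
    1; hence the value [2^-1 - 1]. *)
Lemma pv_cvg_orth u : orth_compl H2 u ->
  {ae mu, forall theta, pv_cvg u theta (- (u (expi theta) / 2))}.
Proof.
move=> [Lu u0]; have iu := L2_integrable Lu.
apply: (aeS2 _ (ae_lebesgue_point_trace iu) ae_circle_itv) => theta lp th.
have -> : - (u (expi theta) / 2) = trace u theta * (2^-1 - 1).
  by rewrite /trace; field.
apply: (pv_trunc_estimate (Q := cauchy_ker theta)) => // r r01; split.
- exact: cmeasurable_cauchy_ker.
- by move=> t; exact: normc_cauchy_ker.
- by move=> t; exact: pv_ker_sub_cauchy_ker.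
- apply: cint_mul_cauchy_ker => // n.
  by rewrite cint_trace_expi_sub// u0 ?mulr0//; exact: H2_exprn.
- exact: cint_cauchy_ker.
Qed.

(** The hypothesis is on moments, the form in which products with [g] supply it. The comparison
    kernel contains only negative powers of [expi (theta - t)], so it has mass 0 and the whole 1/2
    remains. *)
Lemma pv_cvg_analytic u : L2 u ->
  (forall n, (0 < n)%N -> cint (fun t => trace u t * expi t ^+ n) = 0) ->
  {ae mu, forall theta, pv_cvg u theta (u (expi theta) / 2)}.
Proof.
move=> Lu u0; have iu := L2_integrable Lu.
apply: (aeS2 _ (ae_lebesgue_point_trace iu) ae_circle_itv) => theta lp th.
have -> : u (expi theta) / 2 = trace u theta * (2^-1 - 0) by rewrite subr0.
apply: (pv_trunc_estimate (Q := fun r t => 1 - (cauchy_ker theta r t)^*)) => //.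
move=> r r01; have /andP[r0 r1] := r01.
have mk := cmeasurable_cauchy_ker theta r.
have ik := cintegrable_cauchy_ker theta r01.
(* This [Q r] approximates [pv_ker] since [pv_ker = 1 - pv_ker^*]. *)
have QE t : 1 - (cauchy_ker theta r t)^* =
    (- r%:C * (expi (theta - t) * cauchy_ker theta r t))^*.
  rewrite -[1]conjC1 -conjB; congr (_^*); rewrite /cauchy_ker.
  have := one_sub_rexpi_neq0 theta t r01; move: (r%:C) (expi _) => a b h.
  by field.
have mx : cmeasurable (fun t => expi (theta - t) : C).
  apply: cmeasurable_expi; apply: rmeasurableB; first exact: rmeasurable_cst.
  exact: rmeasurable_id.
split.
- by apply: cmeasurableB; [exact: cmeasurable_cst|exact: cmeasurableJ].
- move=> t; rewrite QE normc_conj !normcM normcN normc_real normc_expi mul1r.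
  rewrite ger0_norm//; apply: le_trans (normc_cauchy_ker theta t r01).
  by rewrite ler_piMl ?normc_ge0// ltW.
- move=> t x1; rewrite -(pv_ker_add_conj x1).
  have -> : pv_ker theta t - (pv_ker theta t + (pv_ker theta t)^* -
      (cauchy_ker theta r t)^*) = - (pv_ker theta t - cauchy_ker theta r t)^*.
    by rewrite conjB; ring.
  by rewrite normcN normc_conj; exact: pv_ker_sub_cauchy_ker.
- have iv : cintegrable (fun t => (trace u t)^* * expi (theta - t)).
    apply: (cintegrable_mul_bounded (cintegrableJ iu) mx (M := 1)) => t.
    by rewrite normc_expi.
  have ivk : cintegrable (fun t => (trace u t)^* * expi (theta - t) *
      cauchy_ker theta r t).
    apply: (cintegrable_mul_bounded iv mk) => t.
    exact: (normc_cauchy_ker theta t r01).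
  have -> : (fun t => trace u t * (1 - (cauchy_ker theta r t)^*)) =
      (fun t => (- r%:C * ((trace u t)^* * expi (theta - t) *
        cauchy_ker theta r t))^*).
    by apply/funext => t; rewrite QE !conjM conjCK; ring.
  rewrite cintJ; last exact: cintegrableZ.
  rewrite cintZ// cint_mul_cauchy_ker ?mulr0 ?conjC0// => n.
  have iz : cintegrable (fun t => trace u t * expi t ^+ n.+1).
    exact: L2_mul_integrable Lu (L2_exprn n.+1).
  have -> : (fun t => (trace u t)^* * expi (theta - t) * expi (theta - t) ^+ n) =
      (fun t => expi theta ^+ n.+1 * (trace u t * expi t ^+ n.+1)^*).
    apply/funext => t; rewrite -mulrA -exprS expiD expiN exprMn conjM conjX.
    by rewrite mulrCA.
  by rewrite cintZ ?cintJ ?u0 ?conjC0 ?mulr0//; exact: cintegrableJ.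
- rewrite cintB ?cint_cst ?cintJ ?cint_cauchy_ker ?conjC1 ?subrr//.
    exact: cintegrable_cst.
  exact: cintegrableJ.
Qed.

Lemma H2_moments u n : H2 u -> (0 < n)%N ->
  cint (fun t => trace u t * expi t ^+ n) = 0.
Proof.
move=> Hu n0; have Lk := L2J (L2_exprn n).
transitivity (inner u (fun z => (z ^+ n)^*)).
  by congr cint; apply/funext => t; rewrite conjCK.
apply: inner_H2_eq0 => // m.
rewrite -(@cint_expi_eq0 R (m + n)) ?addn_gt0 ?n0 ?orbT//.
by congr cint; apply/funext => t; rewrite conjCK exprD.
Qed.

(** Moving [g z^n] to the other side leaves a continuous functional of [u]. By density only
    [u = z^m] matters, and there the moment of [g] of positive index [m + n] appears. *)
Lemma mul_H2_moments g M u n : bounded_by g M ->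
  (forall m, (0 < m)%N -> cint (fun t => trace g t * expi t ^+ m) = 0) ->
  H2 u -> (0 < n)%N ->
  cint (fun t => trace (fun z => g z * u z) t * expi t ^+ n) = 0.
Proof.
move=> bg g0 Hu n0.
have Lk : L2 (fun z => (g z * z ^+ n)^*) by apply: L2J; exact: L2M bg (L2_exprn n).
transitivity (inner u (fun z => (g z * z ^+ n)^*)).
  by congr cint; apply/funext => t; rewrite conjCK /trace; ring.
apply: inner_H2_eq0 => // m.
rewrite -(g0 (m + n)%N) ?addn_gt0 ?n0 ?orbT//.
by congr cint; apply/funext => t; rewrite conjCK exprD /trace; ring.
Qed.

Lemma pv_cvgD u1 u2 theta l1 l2 : L2 u1 -> L2 u2 ->
  pv_cvg u1 theta l1 -> pv_cvg u2 theta l2 ->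
  pv_cvg (fun z => u1 z + u2 z) theta (l1 + l2).
Proof.
move=> L1 L2' h1 h2 eta eta0; have e2 : 0 < eta / 2 by rewrite divr_gt0.
have [[r1 r10 d1] [r2 r20 d2]] := (h1 _ e2, h2 _ e2).
exists (Num.min r1 r2); first by rewrite lt_min r10.
move=> r /andP[r0]; rewrite lt_min => /andP[rr1 rr2].
have iK (u : C -> C) : L2 u ->
    cintegrable (fun t => trace u t * trunc_ker theta r t).
  move=> Lu; apply: (cintegrable_mul_bounded (L2_integrable Lu)).
    exact: cmeasurable_trunc_ker.
  by move=> t; exact: normc_trunc_ker.
have -> : cint (fun t => trace (fun z => u1 z + u2 z) t * trunc_ker theta r t) -
    (l1 + l2) = (cint (fun t => trace u1 t * trunc_ker theta r t) - l1) +
    (cint (fun t => trace u2 t * trunc_ker theta r t) - l2).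
  rewrite addrACA -opprD -cintD; try exact: iK.
  by congr (cint _ - _); apply/funext => t; rewrite /trace mulrDl.
have -> : eta = eta / 2 + eta / 2 by field.
apply: le_trans (normc_leD _ _) _; apply: lerD; [apply: d1|apply: d2];
  by rewrite r0.
Qed.

Lemma pv_cvg_L2 u : L2 u ->
  {ae mu, forall theta, pv_cvg u theta (u (expi theta) / 2 - Rminus u (expi theta))}.
Proof.
move=> Lu; have [oM _] := RminusP Lu; have LM := orth_H2_L2 oM.
have HB := sub_Rminus_H2 Lu.
have lim1 := pv_cvg_analytic (H2_L2 HB) (fun n => H2_moments HB).
apply: (aeS2 _ lim1 (pv_cvg_orth oM)) => theta h1 h2.
have := pv_cvgD (H2_L2 HB) LM h1 h2.
have -> : (fun z => u z - Rminus u z + Rminus u z) = u.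
  by apply/funext => z; rewrite subrK.
by congr pv_cvg; field.
Qed.

Lemma pv_cvgP (F : R -> C) l :
  (forall eta, 0 < eta -> exists2 eps0, 0 < eps0 & forall eps, 0 < eps < eps0 ->
    normc (F eps - l) <= eta) -> (F eps : C^o) @[eps --> 0^'+] --> (l : C^o).
Proof.
move=> Fl; apply/cvgrPdist_le => e e0.
(* A positive element of [C] has zero imaginary part, so the tolerance is a real number. *)
have ->: e = (complex.Re e)%:C.
  by apply: complex_ext => //=; exact: ger0_Im (ltW e0).
have re0 : 0 < complex.Re e by move: e0; rewrite ltcE => /andP[].
have [eps0 eps00 small] := Fl _ re0.
near=> eps; rewrite normE lecR normcB; apply: small.
by apply/andP; split; near: eps; [exact: nbhs_right_gt|exact: nbhs_right_lt].
Unshelve. all: by end_near. Qed.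

Lemma pv_trunc_Wkernel f g h theta eps :
  L2 (fun z => f z * h z) -> L2 (fun z => g z * h z) -> 0 < eps ->
  pv_trunc (Wkernel f g) h theta eps =
  f (expi theta) * cint (fun t => trace (fun z => g z * h z) t * trunc_ker theta eps t) -
  g (expi theta) * cint (fun t => trace (fun z => f z * h z) t * trunc_ker theta eps t).
Proof.
move=> Lf Lg e0; rewrite /pv_trunc -/(far_set theta eps) circle_int_restrict.
have iK (u : C -> C) : L2 u ->
    cintegrable (fun t => trace u t * trunc_ker theta eps t).
  move=> Lu; apply: (cintegrable_mul_bounded (L2_integrable Lu)).
    exact: cmeasurable_trunc_ker.
  by move=> t; exact: normc_trunc_ker.
have [iKf iKg] := (iK _ Lf, iK _ Lg).
rewrite -cintZ// -[X in _ - X]cintZ// -cintB; try exact: cintegrableZ.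
congr cint; apply/funext => t; rewrite /trace /Wkernel /trunc_ker /pv_ker.
ring.
Qed.

Lemma pv_op_Wkernel f g Mf Mg h : bounded_by f Mf -> bounded_by g Mg ->
  (forall n, (0 < n)%N -> cint (fun t => trace g t * expi t ^+ n) = 0) ->
  H2 h -> L2 (pv_op (Wkernel f g) h) /\
  ae_eq_circle (pv_op (Wkernel f g) h)
    (fun z => g z * Rminus (fun z => f z * h z) z).
Proof.
move=> bf bg g0 Hh; have Lh := H2_L2 Hh.
have [Lf Lg] := (L2M bf Lh, L2M bg Lh).
set k := fun z => g z * _.
have Lk : L2 k by apply: (L2M bg); exact: Rminus_L2.
have kP : {ae mu, forall theta,
    (pv_trunc (Wkernel f g) h theta eps : C^o) @[eps --> 0^'+] -->
    (k (expi theta) : C^o)}.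
  apply: (aeS2 _ (pv_cvg_analytic Lg (fun n => mul_H2_moments bg g0 Hh))
    (pv_cvg_L2 Lf)) => theta limg limf.
  apply: pv_cvgP => eta eta0.
  pose a := normc (f (expi theta)); pose b := normc (g (expi theta)).
  have [a0 b0] : 0 <= a /\ 0 <= b by split; exact: normc_ge0.
  have ab0 : 0 < a + b + 1 by rewrite ltr_wpDl// addr_ge0.
  have e0 : 0 < eta / (a + b + 1) by rewrite divr_gt0.
  have [[r1 r10 d1] [r2 r20 d2]] := (limg _ e0, limf _ e0).
  exists (Num.min r1 r2); first by rewrite lt_min r10.
  move=> r /andP[r0]; rewrite lt_min => /andP[rr1 rr2].
  have {}d1 := d1 r _; have {}d2 := d2 r _.
  rewrite pv_trunc_Wkernel//.
  set I1 := cint _; set I2 := cint _.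
  have -> : f (expi theta) * I1 - g (expi theta) * I2 - k (expi theta) =
      f (expi theta) * (I1 - g (expi theta) * h (expi theta) / 2) -
      g (expi theta) * (I2 - (f (expi theta) * h (expi theta) / 2 -
        Rminus (fun z => f z * h z) (expi theta))).
    by rewrite /k; field.
  apply: le_trans (normc_leB _ _) _; rewrite !normcM -/a -/b.
  have h1 := ler_wpM2l a0 (d1 _); have h2 := ler_wpM2l b0 (d2 _).
  rewrite r0 in h1 h2; apply: le_trans (lerD (h1 rr1) (h2 rr2)) _.
  rewrite -mulrDl mulrA ler_pdivrMr// mulrC ler_wpM2l ?lerDl// ltW//.
(* [k] shows that [xget] has an element to choose; uniqueness of limits then identifies the chosen
   one with [k] almost everywhere. *)
have exW : exists k, L2 k /\ {ae mu, forall theta,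
    (pv_trunc (Wkernel f g) h theta eps : C^o) @[eps --> 0^'+] -->
    (k (expi theta) : C^o)} by exists k.
have [LW WP] := xgetPex (fun=> 0) exW.
split; first exact: LW.
apply: (aeS2 _ WP kP) => theta lim1 lim2.
exact: (cvg_unique (@norm_hausdorff _ _) lim1 lim2).
Qed.

End singular_integral.

(** * The Poisson extension *)

Section poisson_extension.
Context {R : realType}.
Local Notation C := R[i].
Variable g : C -> C.
Hypothesis ig : cintegrable (trace g).
Implicit Types (v w z : C) (s t : R) (n : nat) (c : R -> C).

Lemma normc_one_sub v z : normc z = 1 -> 1 - normc v <= normc (1 - v * z).
Proof.
move=> z1; have := normc_leD (1 - v * z) (v * z).
by rewrite subrK normc1 normcM z1 mulr1; lra.
Qed.

Lemma one_sub_neq0 v z : normc z = 1 -> normc v < 1 -> 1 - v * z != 0.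
Proof.
move=> z1 v1; rewrite -normc_gt0.
by apply: lt_le_trans (normc_one_sub v z1); rewrite subr_gt0.
Qed.

Lemma normcV_one_sub v z : normc z = 1 -> normc v < 1 ->
  normc (1 - v * z)^-1 <= (1 - normc v)^-1.
Proof.
move=> z1 v1; rewrite normcV lef_pV2 ?posrE ?subr_gt0 ?normc_gt0 ?one_sub_neq0//.
exact: normc_one_sub.
Qed.

(* The quotient [(I (v + z) - I v) / z] for [I v := int g / (1 - v c)], extended by
   the derivative at [z = 0]. *)
Definition diff_quot c v z : C :=
  cint (fun t => trace g t * (c t / ((1 - v * c t) * (1 - (v + z) * c t)))).

Section unimodular.
Variable c : R -> C.
Hypotheses (mc : cmeasurable c) (c1 : forall t, normc (c t) = 1).

Let mV v : cmeasurable (fun t => (1 - v * c t)^-1).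
Proof.
apply: cmeasurableV; apply: cmeasurableB; first exact: cmeasurable_cst.
by apply: cmeasurableM => //; exact: cmeasurable_cst.
Qed.

Lemma cintegrable_kernel v w n : normc v < 1 -> normc w < 1 ->
  cintegrable (fun t => trace g t *
    (c t ^+ n * ((1 - v * c t)^-1 * (1 - w * c t)^-1))).
Proof.
move=> v1 w1; apply: (cintegrable_mul_bounded ig
  (M := (1 - normc v)^-1 * (1 - normc w)^-1)).
  apply: cmeasurableM; first exact: cmeasurableX.
  by apply: cmeasurableM; exact: mV.
move=> t; rewrite normcM normcX c1 expr1n mul1r normcM.
by rewrite ler_pM ?normc_ge0// normcV_one_sub.
Qed.

Lemma diff_quot_cvg v : normc v < 1 -> exists2 K, 0 < K &
  forall z, normc z <= (1 - normc v) / 2 ->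
  normc (diff_quot c v z - diff_quot c v 0) <= K * normc z.
Proof.
(* Half the distance from [v] to the circle. For [normc z <= d] the factor [1 - v * c t], occurring
   twice, and [1 - (v + z) * c t] all have modulus at least [d], hence the cube in the constant. *)
move=> v1; pose d := (1 - normc v) / 2; have d0 : 0 < d by rewrite /d; lra.
pose I := rint (fun t => normc (trace g t)).
have I0 : 0 <= I by apply: rint_ge0 => t; exact: normc_ge0.
exists (2 * (d^-1 ^+ 3 * (I + 1))).
  by rewrite mulr_gt0// mulr_gt0 ?ltr_wpDl// exprn_gt0// invr_gt0.
move=> z zd; have vz : normc (v + z) < 1.
  by apply: le_lt_trans (normc_leD _ _) _; rewrite /d in zd; lra.
have bound w : normc w <= 1 - d -> normc w < 1 ->
    forall t, normc (1 - w * c t)^-1 <= d^-1.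
  move=> wd w1 t; apply: le_trans (normcV_one_sub (c1 t) w1) _.
  by rewrite lef_pV2 ?posrE ?subr_gt0//; lra.
have bv := @bound v _ v1; have bz := @bound (v + z) _ vz.
have {}bv t : normc (1 - v * c t)^-1 <= d^-1 by apply: bv; rewrite /d; lra.
have {}bz t : normc (1 - (v + z) * c t)^-1 <= d^-1.
  by apply: bz; apply: le_trans (normc_leD _ _) _; rewrite /d in zd *; lra.
have iq (w : C) : normc w < 1 -> cintegrable (fun t => trace g t *
    (c t / ((1 - v * c t) * (1 - w * c t)))).
  move=> w1; have := cintegrable_kernel 1 v1 w1.
  by under [X in cintegrable X -> _]eq_fun do rewrite expr1 -invfM.
rewrite /diff_quot addr0 -cintB; [|exact: iq|exact: iq].
pose k t := (1 - v * c t)^-1 * ((1 - v * c t)^-1 * (1 - (v + z) * c t)^-1).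
have -> : (fun t => trace g t * (c t / ((1 - v * c t) * (1 - (v + z) * c t))) -
    trace g t * (c t / ((1 - v * c t) * (1 - v * c t)))) =
    fun t => z * (trace g t * (c t ^+ 2 * k t)).
  apply/funext => t; rewrite /k.
  have := one_sub_neq0 (c1 t) v1; have := one_sub_neq0 (c1 t) vz.
  by move: (c t) (trace g t) => a b h1 h2; field; rewrite h1.
have mk : cmeasurable k.
  by apply: cmeasurableM => //; apply: cmeasurableM => //; exact: mV.
have bk t : normc (k t) <= d^-1 ^+ 3.
  rewrite /k !normcM exprS ler_pM ?mulr_ge0 ?normc_ge0//.
  by rewrite expr2 ler_pM ?normc_ge0.
have mck : cmeasurable (fun t => c t ^+ 2 * k t).
  by apply: cmeasurableM => //; exact: cmeasurableX.
have bck t : normc (c t ^+ 2 * k t) <= d^-1 ^+ 3.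
  by rewrite normcM normcX c1 expr1n mul1r.
have igk := cintegrable_mul_bounded ig mck bck.
rewrite cintZ// normcM mulrC ler_wpM2r ?normc_ge0//.
have imaj := rintegrableZ (d^-1 ^+ 3) (cintegrable_normc ig).
apply: le_trans (normc_cint_le (cintegrable_measurable igk) imaj _) _ => [t|].
  by rewrite normcM mulrC ler_wpM2r ?normc_ge0.
rewrite rintZ ?cintegrable_normc// ler_pM2l// ler_wpM2l ?exprn_ge0 ?invr_ge0 ?ltW//.
by rewrite -/I ltrDl.
Qed.

End unimodular.

Let b t : C := expi t.
Let a t : C := (expi t)^*.
Let mb : cmeasurable b. Proof. exact: cmeasurable_expi rmeasurable_id. Qed.
Let ma : cmeasurable a. Proof. exact: cmeasurableJ. Qed.
Let b1 t : normc (b t) = 1. Proof. exact: normc_expi. Qed.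
Let a1 t : normc (a t) = 1. Proof. by rewrite normc_conj normc_expi. Qed.

(** The Poisson kernel as a Szego kernel plus its conjugate, minus the constant term counted twice.
    The first summand depends on [w] alone and the second on [w^*] alone, which separates the
    holomorphic from the antiholomorphic part. *)
Lemma poisson_kernelE w t : normc w < 1 ->
  (1 - `|w| ^+ 2) / `|expi t - w| ^+ 2 =
  (1 - w * a t)^-1 + (1 - w^* * b t)^-1 - 1 :> C.
Proof.
move=> w1; have h1 := one_sub_neq0 (a1 t) w1.
have h2 : 1 - w^* * b t != 0 by apply: one_sub_neq0; rewrite ?normc_conj.
rewrite !normCK conjB /a /b; have b0 := @expi_neq0 R t.
have aE : (expi t)^* = (expi t)^-1 :> C by rewrite expiV expiN.
rewrite /a /b aE in h1 h2 *; move: (expi t) (w^*) b0 h1 h2 => x c x0 h1 h2.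
have h3 : x - w != 0.
  apply: contraNneq h1 => xw; rewrite -(mulfV x0) -mulrBl xw mul0r//.
by field; rewrite x0 h2 h3.
Qed.

Lemma cintegrable_kernel1 c v : cmeasurable c -> (forall t, normc (c t) = 1) ->
  normc v < 1 -> cintegrable (fun t => trace g t * (1 - v * c t)^-1).
Proof.
move=> mc c1 v1; have n0 : normc (0 : C) < 1 by rewrite normc0.
have := cintegrable_kernel mc c1 0 v1 n0.
by under [X in cintegrable X -> _]eq_fun do
  rewrite expr0 mul1r mul0r subr0 invr1 mulr1.
Qed.

Lemma poissonE w : normc w < 1 -> poisson g w =
  cint (fun t => trace g t * (1 - w * a t)^-1) +
  cint (fun t => trace g t * (1 - w^* * b t)^-1) - cint (trace g).
Proof.
move=> w1; have w1' : normc w^* < 1 by rewrite normc_conj.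
have [ia ib] := (cintegrable_kernel1 ma a1 w1, cintegrable_kernel1 mb b1 w1').
rewrite -cintD// -cintB//; last exact: cintegrableD.
congr cint; apply/funext => t; rewrite poisson_kernelE// /trace; ring.
Qed.

Lemma poisson_increment w z : normc w < 1 -> normc (w + z) < 1 ->
  poisson g (w + z) - poisson g w =
  z * diff_quot a w z + z^* * diff_quot b w^* z^*.
Proof.
move=> w1 wz1; have w1' : normc w^* < 1 by rewrite normc_conj.
have wz1' : normc (w^* + z^*) < 1 by rewrite -conjD normc_conj.
have inc c v y : cmeasurable c -> (forall t, normc (c t) = 1) ->
    normc v < 1 -> normc (v + y) < 1 ->
    cint (fun t => trace g t * (1 - (v + y) * c t)^-1) -
    cint (fun t => trace g t * (1 - v * c t)^-1) = y * diff_quot c v y.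
  move=> mc c1 v1 vy1; rewrite -cintB; try exact: cintegrable_kernel1.
  rewrite -cintZ; last first.
    have := cintegrable_kernel mc c1 1 v1 vy1.
    by under [X in cintegrable X -> _]eq_fun do rewrite expr1 -invfM.
  congr cint; apply/funext => t.
  have := one_sub_neq0 (c1 t) v1; have := one_sub_neq0 (c1 t) vy1.
  by move: (c t) (trace g t) => p q h1 h2; field; rewrite h1.
rewrite !poissonE// conjD -(inc a)// -(inc b)//.
by ring.
Qed.

End poisson_extension.

(** * Vanishing moments from holomorphy of the Poisson extension *)

Section holomorphic_moments.
Context {R : realType}.
Local Notation C := R[i].
Variable g : C -> C.
Hypothesis ig : cintegrable (trace g).
Implicit Types (v w z : C) (s t eta : R) (n : nat).

Let b t : C := expi t.
Let a t : C := (expi t)^*.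
Let mb : cmeasurable b. Proof. exact: cmeasurable_expi rmeasurable_id. Qed.
Let ma : cmeasurable a. Proof. exact: cmeasurableJ. Qed.
Let b1 t : normc (b t) = 1. Proof. exact: normc_expi. Qed.
Let a1 t : normc (a t) = 1. Proof. by rewrite normc_conj normc_expi. Qed.

(* The difference quotients of the antiholomorphic part of the Poisson extension
   along the real and the imaginary direction have opposite limits. *)
Lemma derivable_poisson_diff_quot w : normc w < 1 ->
  derivable (poisson g : C^o -> C^o) w 1 -> diff_quot g b w^* 0 = 0.
Proof.
move=> w1; have w1' : normc w^* < 1 by rewrite normc_conj.
pose P z := diff_quot g a w z; pose N z := diff_quot g b w^* z.
rewrite -/(N 0) => /cvg_ex[L FL].
have [K1 K10 HP] := diff_quot_cvg ig ma a1 w1.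
have [K2 K20 HN] := diff_quot_cvg ig mb b1 w1'; rewrite normc_conj in HN.
suff small eta : 0 < eta -> normc (N 0) <= 3 * eta.
  apply/eqP; rewrite -normc_eq0 eq_le normc_ge0 andbT leNgt; apply/negP => N0.
  by have := small (normc (N 0) / 4); rewrite divr_gt0// => /(_ isT); lra.
move=> eta0.
have eC : 0 < eta%:C :> C by rewrite -[0]/(0%:C) ltcR.
have /cvgrPdist_le /(_ _ eC)[d d0' near_L] := FL; have d0 : 0 < d := d0'.
have Red0 : 0 < complex.Re d by move: d0; rewrite ltcE => /andP[].
have dE : d = (complex.Re d)%:C.
  by apply: complex_ext => //=; exact: ger0_Im (ltW d0).
pose m := (1 - normc w) / 2; have m0 : 0 < m by rewrite /m; lra.
(* The entries put [z] of modulus [s] within reach of the derivative estimate, keep [w + z] inside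
   the disc, and make [K1 * s] and [K2 * s] at most [eta]. *)
pose s := Num.min (complex.Re d / 2)
  (Num.min m (Num.min (eta / K1) (eta / K2))).
have s0 : 0 < s by rewrite !lt_min m0 !divr_gt0.
have sd : s < complex.Re d.
  by apply: le_lt_trans (_ : complex.Re d / 2 < _); [rewrite ge_min lexx|lra].
have sm : s <= m by rewrite !ge_min lexx orbT.
have s1 : K1 * s <= eta.
  by rewrite mulrC -ler_pdivlMr// !ge_min lexx !orbT.
have s2 : K2 * s <= eta.
  by rewrite mulrC -ler_pdivlMr// !ge_min lexx !orbT.
have quot z : normc z = s ->
    normc (L - (P z + z^-1 * z^* * N z^*)) <= eta.
  move=> zs; have z0 : z != 0 by rewrite -normc_gt0 zs.
  have wz : normc (w + z) < 1.
    by apply: le_lt_trans (normc_leD _ _) _; rewrite zs /m in sm *; lra.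
  have : ball_ [eta Num.Def.normr] 0 d z.
    by rewrite /ball_ /= sub0r normrN normE zs dE ltcR.
  move=> /near_L /(_ z0); rewrite normE lecR => h; apply: le_trans h.
  rewrite le_eqVlt; apply/orP; left; apply/eqP; congr (normc (L - _)).
  rewrite /shift /= [z *: _]mulr1 [z + w]addrC.
  rewrite (poisson_increment ig w1 wz) -/(P z) -/(N z^*).
  by move: (P z) (N _) => p q; rewrite [RHS]mulrDr !mulrA mulVf// mul1r.
have HPs z : normc z = s -> normc (P z - P 0) <= eta.
  by move=> zs; apply: le_trans (HP z _) _; rewrite zs.
have HNs z : normc z = s -> normc (N z - N 0) <= eta.
  by move=> zs; apply: le_trans (HN z _) _; rewrite zs.
pose x := s%:C : C; pose y := s%:C * 'i : C.
have xs : normc x = s by rewrite normc_real gtr0_norm.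
have i1 : normc ('i : C) = 1 by rewrite /= expr0n /= add0r expr1n sqrtr1.
have ys : normc y = s by rewrite normcM i1 mulr1 xs.
have xc : x^* = x by apply: complex_ext => //=; rewrite oppr0.
have yc : y^* = - y.
  by rewrite conjM xc -mulrN; congr (x * _); apply: complex_ext; rewrite //= ?oppr0.
have x0 : x != 0 by rewrite -normc_gt0 xs.
have y0 : y != 0 by rewrite -normc_gt0 ys.
have qx := quot x xs; rewrite xc mulVf// mul1r in qx.
have qy := quot y ys; rewrite yc mulrN mulVf// mulN1r in qy.
have nys : normc (- y) = s by rewrite normcN.
(* The quotient is [P x + N x] on the real axis and [P y - N (- y)] on the imaginary axis. Six
   errors of at most [eta] remain: two from the derivative, two from [P], two from [N]. *)
have e2 : N 0 + N 0 = (L - (P y - N (- y))) - (L - (P x + N x)) +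
    ((P y - P 0) - (P x - P 0) - (N x - N 0) - (N (- y) - N 0)).
  by move: (N 0) (N _) (P _) (P _) (N _) (P _) => *; ring.
have : normc (N 0 + N 0) <= eta + eta + (eta + eta + eta + eta).
  rewrite e2; apply: le_trans (normc_leD _ _) _; apply: lerD.
    by apply: le_trans (normc_leB _ _) _; apply: lerD.
  apply: le_trans (normc_leB _ _) _; apply: lerD; last exact: HNs.
  apply: le_trans (normc_leB _ _) _; apply: lerD; last exact: HNs.
  by apply: le_trans (normc_leB _ _) _; apply: lerD; exact: HPs.
have -> : N 0 + N 0 = (2 : R)%:C * N 0 by rewrite rmorph_nat mulr_natl mulr2n.
by rewrite normcM normc_real ger0_norm//; lra.
Qed.

(* From [1/(1-x)^2 = sum_(j < n) (j+1) x^j + x^n ((n+1) - n x)/(1-x)^2]: once the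
   first moments vanish, [Z n s] is the integral of [g b / (1 - s b)^2] over [s^n]. *)
Let Z n s := cint (fun t => trace g t *
  (b t ^+ n.+1 * (n.+1%:R - n%:R * s%:C * b t) / (1 - s%:C * b t) ^+ 2)).

Let integrand_meas n s : cmeasurable (fun t =>
  b t ^+ n.+1 * (n.+1%:R - n%:R * s%:C * b t) / (1 - s%:C * b t) ^+ 2).
Proof.
apply: cmeasurableM.
  apply: cmeasurableM; first exact: cmeasurableX.
  apply: cmeasurableB; first exact: cmeasurable_cst.
  by apply: cmeasurableM => //; exact: cmeasurable_cst.
apply: cmeasurableV; apply: cmeasurableX; apply: cmeasurableB.
  exact: cmeasurable_cst.
by apply: cmeasurableM => //; exact: cmeasurable_cst.
Qed.

Let integrand_bound n s t : 0 <= s <= 2^-1 ->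
  normc (b t ^+ n.+1 * (n.+1%:R - n%:R * s%:C * b t) / (1 - s%:C * b t) ^+ 2)
  <= (n.+1%:R + n%:R) * 4.
Proof.
move=> /andP[s0 s2]; have sn : normc (s%:C : C) = s by rewrite normc_real ger0_norm.
have nn k : normc (k%:R : C) = k%:R.
  by rewrite -(rmorph_nat (real_complex R)) normc_real ger0_norm.
rewrite normcM normcM normcX b1 expr1n mul1r normcV normcX ler_pM ?normc_ge0//.
- by rewrite invr_ge0 exprn_ge0// normc_ge0.
- apply: le_trans (normc_leB _ _) _; rewrite !normcM !nn sn b1 mulr1 lerD2l.
  by rewrite ler_piMr//; lra.
have h := normc_one_sub (s%:C) (b1 t); rewrite sn in h.
have -> : 4 = ((2^-1) ^+ 2)^-1 :> R by field.
rewrite lef_pV2 ?posrE ?exprn_gt0//; last by lra.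
by rewrite lerXn2r ?nnegrE ?normc_ge0//; lra.
Qed.

Let int_pow n : cintegrable (fun t => trace g t * b t ^+ n).
Proof.
apply: (cintegrable_mul_bounded ig (M := 1)) => [|t]; first exact: cmeasurableX.
by rewrite normcX b1 expr1n.
Qed.

Let Z_rec n s : 0 <= s <= 2^-1 ->
  Z n s = n.+1%:R * cint (fun t => trace g t * b t ^+ n.+1) + s%:C * Z n.+1 s.
Proof.
move=> s02; have /andP[s0 s2] := s02.
have iZ := cintegrable_mul_bounded ig (integrand_meas n.+1 s)
  (fun t => integrand_bound n.+1 t s02).
rewrite -!cintZ// -cintD; [|exact: cintegrableZ|exact: cintegrableZ].
congr cint; apply/funext => t; rewrite !exprS.
have : 1 - s%:C * b t != 0.
  by apply: one_sub_neq0 => //; rewrite normc_real ger0_norm//; lra.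
rewrite -[n.+2%:R]natr1 -[n.+1%:R]natr1.
by move: (b t) (b t ^+ n) (s%:C) (n%:R) => p q r k h; field.
Qed.

(** The coefficients of a power series vanishing on a real interval are peeled off one at a time: if
    [Z n] vanishes, letting [s] tend to 0 in [Z_rec] kills the moment of index [n.+1], and dividing
    by [s] passes to [Z n.+1]. The range [s <= 2^-1] keeps the integrands uniformly bounded. *)
Lemma holomorphic_poisson_moments : holomorphic_disc (poisson g) ->
  forall n, (0 < n)%N -> cint (fun t => trace g t * expi t ^+ n) = 0.
Proof.
move=> holo.
have Z0 s : 0 < s <= 2^-1 -> Z 0 s = 0.
  move=> /andP[s0 s2].
  have ns : normc (s%:C : C) = s by rewrite normc_real gtr0_norm.
  have s1 : normc (s%:C : C) < 1 by rewrite ns; lra.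
  have sc : (s%:C : C)^* = s%:C by apply: complex_ext => //=; rewrite oppr0.
  have := derivable_poisson_diff_quot s1 (holo _ _); rewrite sc.
  rewrite normE ltcR => /(_ s1) <-; congr cint; apply/funext => t.
  by rewrite expr1 addr0 mul0r mul0r subr0 mulr1 -expr2.
pose I := rint (fun t => normc (trace g t)).
have I0 : 0 <= I by apply: rint_ge0 => t; exact: normc_ge0.
have step n : (forall s, 0 < s <= 2^-1 -> Z n s = 0) ->
    cint (fun t => trace g t * b t ^+ n.+1) = 0.
  move=> Zn; set c := cint _.
  pose M := 2 * ((n.+2%:R + n.+1%:R) * 4 * (I + 1)) : R.
  have M0 : 0 < M by rewrite !mulr_gt0 ?ltr_wpDl ?ler0n// ltr0n.
  have bound s : 0 < s <= 2^-1 -> normc c <= s * M.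
    move=> s02; have /andP[s0 s2] := s02.
    have s02' : 0 <= s <= 2^-1 by rewrite ltW.
    have := Zn _ s02; rewrite Z_rec// -/c => /eqP; rewrite addr_eq0 => /eqP e.
    apply: (@le_trans _ _ (normc (n.+1%:R * c))).
      rewrite normcM -(rmorph_nat (real_complex R)) normc_real ger0_norm//.
      by rewrite ler_peMl ?normc_ge0// ler1n.
    rewrite e normcN normcM normc_real gtr0_norm// ler_pM2l//.
    have ibd := rintegrableZ ((n.+2%:R + n.+1%:R) * 4) (cintegrable_normc ig).
    have mZ : cmeasurable (fun t => trace g t * (b t ^+ n.+2 * (n.+2%:R - n.+1%:R *
        s%:C * b t) / (1 - s%:C * b t) ^+ 2)).
      by apply: cmeasurableM => //; exact: cintegrable_measurable.
    apply: le_trans (normc_cint_le mZ ibd _) _ => [t|].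
      by rewrite normcM mulrC ler_wpM2r ?normc_ge0// integrand_bound.
    rewrite rintZ ?cintegrable_normc// /M ler_pM2l// -/I.
    by rewrite ler_wpM2l ?lerDl// mulr_ge0// addr_ge0.
  apply/eqP; rewrite -normc_eq0 eq_le normc_ge0 andbT leNgt; apply/negP => c0.
  pose s := Num.min 2^-1 (normc c / (2 * M)).
  have s02 : 0 < s <= 2^-1.
    by rewrite lt_min ge_min lexx /= invr_gt0 ltr0n divr_gt0// mulr_gt0.
  have := bound _ s02; rewrite leNgt => /negP; apply.
  have : s <= normc c / (2 * M) by rewrite ge_min lexx orbT.
  rewrite ler_pdivlMr ?mulr_gt0//; have /andP[s0 _] := s02; nra.
have ZN n : forall s, 0 < s <= 2^-1 -> Z n s = 0.
  elim: n => [|n IH] s s02; first exact: Z0.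
  have /andP[s0 s2] := s02; have s02' : 0 <= s <= 2^-1 by rewrite ltW.
  have := IH s s02; rewrite Z_rec// step// mulr0 add0r => /eqP.
  rewrite mulf_eq0 -normc_eq0 normc_real gtr0_norm// gt_eqF//=.
  by move=> /eqP.
by move=> [//|n] _; exact: step (ZN n).
Qed.

End holomorphic_moments.

(** * The square of the Hankel operator *)

Section hankel_square.
Context {R : realType}.
Local Notation C := R[i].
Local Notation mu := (@circle R).
Implicit Types (h k u v r : C -> C) (q : {poly C}) (n m : nat).

Lemma Rplus_ae_congr u v : L2 u -> L2 v -> ae_eq_circle u v ->
  ae_eq_circle (Rplus u) (Rplus v).
Proof.
move=> Lu Lv uv; have [Hv v0] := RplusP Lv; have LRv := H2_L2 Hv.
apply: Rplus_ae_eq => // k Hk; rewrite -(v0 k Hk).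
apply: inner_ae_eq; [exact: L2B|exact: L2B|exact: H2_L2|exact: H2_L2| |].
  by apply: (aeS _ uv) => t ->.
exact: aeW.
Qed.

Lemma Rminus_ae_congr u v : L2 u -> L2 v -> ae_eq_circle u v ->
  ae_eq_circle (Rminus u) (Rminus v).
Proof.
move=> Lu Lv uv; have [_ uM] := RminusP Lu; have [_ vM] := RminusP Lv.
have uvP := Rplus_ae_congr Lu Lv uv.
have uvB : ae_eq_circle (fun z => u z - Rplus u z) (fun z => v z - Rplus v z).
  by apply: (aeS2 _ uv uvP) => t -> ->.
exact: ae_eq_circle_trans (ae_eq_circle_trans uM uvB) (ae_eq_circle_sym vM).
Qed.

Lemma inner_suml n (w : 'I_n -> C) (F : 'I_n -> C -> C) r :
  (forall i, L2 (F i)) -> L2 r ->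
  L2 (fun z => \sum_(i < n) w i * F i z) /\
  inner (fun z => \sum_(i < n) w i * F i z) r = \sum_(i < n) w i * inner (F i) r.
Proof.
move=> LF Lr; elim: n w F LF => [|n IH] w F LF.
  have -> : (fun z => \sum_(i < 0) w i * F i z) = horner 0.
    by apply/funext => z; rewrite big_ord0 horner0.
  split; first exact: L2_horner.
  by rewrite inner_horner// size_poly0 !big_ord0.
have -> : (fun z => \sum_(i < n.+1) w i * F i z) =
    fun z => \sum_(i < n) w (widen_ord (leqnSn n) i) *
      F (widen_ord (leqnSn n) i) z + w ord_max * F ord_max z.
  by apply/funext => z; rewrite big_ord_recr.
have [Ls inner_s] := IH (fun i => w (widen_ord (leqnSn n) i))
  (fun i => F (widen_ord (leqnSn n) i)) (fun i => LF _).
split; first by apply: L2D => //; exact: L2Z.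
by rewrite big_ord_recr/= innerDl ?innerZl ?inner_s//; exact: L2Z.
Qed.

(** There are finitely many roots, and each is [expi t] for at most one [t] strictly between 0 and
    [2 * pi], since [chord_ge_dist] makes [expi] injective there. *)
Lemma ae_circle_horner_neq0 q : q != 0 ->
  {ae mu, forall t, q.[expi t] != 0}.
Proof.
move=> q0; have [rs qE] := closed_field_poly_normal q.
suff : {ae mu, forall t, expi t \notin rs}.
  apply: aeS => t; apply: contraNneq => qt.
  rewrite -(root_prod_XsubC rs); move: qt; rewrite qE hornerZ => /eqP.
  by rewrite mulf_eq0 lead_coef_eq0 (negbTE q0).
elim: rs {qE} => [|x rs IH]; first exact: aeW.
have aex : {ae mu, forall t, expi t != x}.
  have [[t0 [t02 <-]]|no] := pselect (exists t0, 0 < t0 < 2 * pi /\ expi t0 = x).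
    apply: (aeS2 _ ae_circle_itv (ae_circle_neq t0)) => t /andP[tg0 tl2].
    apply: contraNneq => ett0; have [c /andP[c0 _]] := chord_ge_dist t02.
    have tb : 0 <= t <= 2 * pi by rewrite !ltW.
    move=> /(_ t tb); rewrite /chord -ett0 subrr normc0 pmulr_rle0//.
    by rewrite normr_le0 subr_eq0 eq_sym.
  apply: (aeS _ ae_circle_itv) => t t02; apply/eqP => tx.
  by apply: no; exists t.
by apply: (aeS2 _ aex IH) => t tx trs; rewrite inE negb_or tx.
Qed.

Variables (f g : C -> C) (Mf Mg : R).
Hypotheses (bf : bounded_by f Mf) (bg : bounded_by g Mg).
Hypothesis fg : ae_eq_circle f (fun z => (g z)^*).
Hypothesis g0 : forall n, (0 < n)%N ->
  cint (fun t => trace g t * expi t ^+ n) = 0.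

Let W := pv_op (Wkernel f g).
Let Rm h := Rminus (fun z => f z * h z).

Let LRm h : L2 h -> L2 (Rm h).
Proof. by move=> Lh; apply: Rminus_L2; exact: L2M bf Lh. Qed.

Lemma RplusW_ae_eq h : H2 h ->
  ae_eq_circle (Rplus (W (Rplus h))) (Rplus (fun z => g z * Rm h z)).
Proof.
move=> Hh; have Lh := H2_L2 Hh; have [HR _] := RplusP Lh; have LR := H2_L2 HR.
have [LW aeW'] := pv_op_Wkernel bf bg g0 HR.
have aeR := Rplus_H2 Hh.
apply: (Rplus_ae_congr LW (L2M bg (LRm Lh))).
have aeRm : ae_eq_circle (Rm (Rplus h)) (Rm h).
  apply: Rminus_ae_congr; [exact: L2M bf LR|exact: L2M bf Lh|].
  by apply: (aeS _ aeR) => t ->.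
by apply: (aeS2 _ aeW' aeRm) => t e1 e2; rewrite /W e1 -e2.
Qed.

Lemma inner_Rm h k : L2 h -> L2 k ->
  inner (Rm h) (Rm k) = inner (fun z => f z * h z) (Rm k).
Proof.
move=> Lh Lk; apply: inner_Rminus; first exact: L2M bf Lh.
by have [] := RminusP (L2M bf Lk).
Qed.

Lemma inner_RplusM h k : H2 h -> H2 k ->
  inner (Rm k) (Rm h) = inner k (Rplus (fun z => g z * Rm h z)).
Proof.
move=> Hh Hk; have [Lh Lk] := (H2_L2 Hh, H2_L2 Hk).
have LgR := L2M bg (LRm Lh); have [HP P0] := RplusP LgR; have LP := H2_L2 HP.
have -> : inner k (Rplus (fun z => g z * Rm h z)) = inner k (fun z => g z * Rm h z).
  apply/eqP; rewrite eq_sym -subr_eq0 -innerBr//.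
  by rewrite innerC ?P0 ?conjC0//; exact: L2B.
rewrite inner_Rm//; apply: cint_ae_eq.
- exact: cintegrable_measurable (inner_integrable (L2M bf Lk) (LRm Lh)).
- exact: cintegrable_measurable (inner_integrable Lk LgR).
- by apply: (aeS _ fg) => t ->; rewrite conjM; ring.
Qed.

Lemma RplusW_adjoint h : H2 h ->
  ae_eq_circle (Rplus (W (Rplus h))) (adjoint H2 (Hankel f) (Hankel f h)).
Proof.
move=> Hh; have Lh := H2_L2 Hh.
apply: ae_eq_circle_trans (RplusW_ae_eq Hh) _; apply: ae_eq_circle_sym.
have [HP _] := RplusP (L2M bg (LRm Lh)).
apply: adjoint_H2_ae_eq => // k Hk.
by rewrite -inner_RplusM// /Hankel inner_flip//; apply: LRm; exact: H2_L2.
Qed.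

(** The first [n.+1] monomials are sent into the span of [n] functions, so some nonzero combination
    [q] of them is sent to 0. The squared norm of [Rm q] is the pairing of that image with [q]. *)
Lemma finite_rank_kernel : finite_rank H2 (fun h => Rplus (W (Rplus h))) ->
  exists2 q : {poly C}, q != 0 & ae_eq_circle (Rm (horner q)) (fun=> 0).
Proof.
move=> [n [e [He rank_n]]].
have /choice[c cE] : forall j : 'I_n.+1, exists c : 'I_n -> C,
    ae_eq_circle (Rplus (W (Rplus (fun z => z ^+ j)))) (fun z => \sum_(i < n) c i * e i z).
  by move=> j; exact: rank_n (H2_exprn j).
pose M := \matrix_(j < n.+1, i < n) c j i.
have kerM : kermx M != 0.
  by rewrite -mxrank_eq0 mxrank_ker -lt0n subn_gt0 ltnS rank_leq_col.
pose v := nz_row (kermx M).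
have v0 : v != 0 by rewrite nz_row_eq0.
have vM : v *m M = 0 by apply/sub_kermxP; exact: nz_row_sub.
pose q := \poly_(j < n.+1) v 0 (inord j).
have qE z : q.[z] = \sum_(j < n.+1) v 0 j * z ^+ j.
  rewrite horner_poly; apply: eq_bigr => j _; by rewrite inord_val.
have q0 : q != 0.
  apply: contraNneq v0 => q0; apply/eqP/rowP => j; rewrite mxE.
  have := congr1 (fun p : {poly C} => p`_j) q0.
  by rewrite coef_poly ltn_ord inord_val coef0.
exists q => //; have Lq := L2_horner q; have LRq := LRm Lq.
(* Only the left factor of the inner product is expanded in the coefficients of [q]; the resulting
   sums over [j] are the entries of [v *m M]. *)
apply: sqn_eq0 => //; apply: complexI; rewrite -inner_sqn inner_Rm//.
have -> : (fun z => f z * q.[z]) =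
    fun z => \sum_(j < n.+1) v 0 j * (f z * z ^+ j).
  by apply/funext => z; rewrite qE mulr_sumr; apply: eq_bigr => j _; rewrite mulrCA.
have Lfz (j : 'I_n.+1) : L2 (fun z => f z * z ^+ j) by exact: L2M bf (L2_exprn j).
have [_ ->] := inner_suml (fun j => v 0 j) Lfz LRq.
have Le i : L2 (e i) by exact: H2_L2.
have coefE (j : 'I_n.+1) : inner (fun z => f z * z ^+ j) (Rm (horner q)) =
    \sum_(i < n) c j i * inner (e i) (horner q).
  have Lzj := @L2_exprn R j.
  have [Ls <-] := inner_suml (c j) Le Lq.
  rewrite -inner_Rm// innerC; [|exact: LRm|exact: LRm].
  have LP := L2M bg (LRm Lzj); have [HP _] := RplusP LP.
  rewrite inner_RplusM; [|exact: H2_exprn|exact: H2_horner].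
  rewrite -innerC//; last exact: H2_L2.
  apply: inner_ae_eq => //; [exact: H2_L2| |exact: aeW].
  apply: ae_eq_circle_trans (cE j); apply: ae_eq_circle_sym.
  exact: RplusW_ae_eq (H2_exprn j).
under eq_bigr do rewrite coefE mulr_sumr.
rewrite exchange_big big1//= => i _.
under eq_bigr do rewrite mulrA.
rewrite -mulr_suml; have -> : \sum_(j < n.+1) v 0 j * c j i = (v *m M) 0 i.
  by rewrite mxE; apply: eq_bigr => j _; rewrite mxE.
by rewrite vM mxE mul0r.
Qed.

Lemma rational_of_kernel q : q != 0 ->
  ae_eq_circle (Rm (horner q)) (fun=> 0) -> rational_circle f.
Proof.
move=> q0 Rq0; have Lq := L2_horner q; have LU := L2M bf Lq.
set U := fun z => _ in LU.
have HU : H2 U.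
  apply: H2_ae_eq LU (sub_Rminus_H2 LU) _.
  by apply: (aeS _ Rq0) => t; rewrite /Rm -/U => ->; rewrite subr0.
(* For an index [j] of [q] the difference [m - j] is positive, so moving [f] across as [g] turns
   every term into the conjugate of a vanishing moment. *)
have U0 m : (size q <= m)%N -> inner U (fun z => z ^+ m) = 0.
  move=> qm; have Lgz := L2M bg (L2_exprn m).
  have -> : inner U (fun z => z ^+ m) =
      inner (horner q) (fun z => g z * z ^+ m).
    apply: cint_ae_eq.
    - exact: cintegrable_measurable (inner_integrable LU (L2_exprn m)).
    - exact: cintegrable_measurable (inner_integrable Lq Lgz).
    - by apply: (aeS _ fg) => t; rewrite /U => ->; rewrite conjM; ring.
  rewrite inner_horner// big1// => j _.
  have jm : (j < m)%N by exact: leq_trans (ltn_ord j) qm.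
  rewrite (_ : inner _ _ = (cint (fun t => trace g t * expi t ^+ (m - j)))^*).
    by rewrite g0 ?subn_gt0// conjC0 mulr0.
  rewrite -cintJ; last first.
    exact: L2_mul_integrable (bounded_L2 bg) (L2_exprn (m - j)).
  congr cint; apply/funext => t.
  have mE : m = (j + (m - j))%N by rewrite subnKC// ltnW.
  move: (m - j)%N mE => k ->; rewrite /trace exprD !conjM !conjX.
  by rewrite mulrCA [X in _ * X]mulrA -exprMn mul_expi_conj expr1n mul1r.
(* The numerator is the Fourier polynomial of [f q]: the difference [U - p] lies in [H2] and has no
   nonzero coefficient left. *)
pose p := \poly_(i < size q) inner U (fun z => z ^+ i).
have Up : ae_eq_circle U (horner p).
  have HUp : H2 (fun z => U z - p.[z]) by apply: H2B => //; exact: H2_horner.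
  have : ae_eq_circle (fun z => U z - p.[z]) (fun=> 0).
    apply: H2_orth_self => // m; have LUp := H2_L2 HUp.
    rewrite innerC//; last exact: L2_exprn.
    rewrite innerBl//; [|exact: L2_horner|exact: L2_exprn].
    rewrite inner_horner_exprn coef_poly.
    case: ltnP => [_|qm]; first by rewrite subrr conjC0.
    by rewrite U0// subr0 conjC0.
  by apply: aeS => t /eqP; rewrite subr_eq0 => /eqP.
exists p, q; split => //.
apply: (aeS2 _ Up (ae_circle_horner_neq0 q0)) => t <- qt.
by rewrite /U mulfK.
Qed.

End hankel_square.

Unset Implicit Arguments.
Set Strict Implicit.
Local Open Scope complex_scope.

Theorem proposition3p3 (R : realType) (f g : R[i] -> R[i])
  (f_bounded : Linfty f) (g_bounded : Linfty g)
  (f_conj_g : ae_eq_circle f (fun z => (g z)^*))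
  (g_holomorphic : holomorphic_disc (poisson g)) :
  let W := pv_op (Wkernel f g) in
  (forall h : R[i] -> R[i], H2 h ->
     ae_eq_circle (Rplus (W (Rplus h))) (adjoint H2 (Hankel f) (Hankel f h)))
  /\
  (finite_rank H2 (fun h => Rplus (W (Rplus h))) -> rational_circle f).
Proof.
have [[Mf bf] [Mg bg]] := (Linfty_bounded f_bounded, Linfty_bounded g_bounded).
have g0 := holomorphic_poisson_moments (L2_integrable (bounded_L2 bg)) g_holomorphic.
split=> [h Hh|fin_rank]; first exact: (RplusW_adjoint bf bg f_conj_g g0 Hh).
have [q q0 Rq0] := finite_rank_kernel bf bg f_conj_g g0 fin_rank.
exact: (rational_of_kernel bf bg f_conj_g g0 q0 Rq0).
Qed.
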